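(* Let $\xi(\cdot)$ be the birth-and-death process started at $0$ with birth rates $\lambda(x)$ and death rates $\mu(x)$, $x\in\mathbb{Z}^+$, described in the context, where $$\lim_{x\to\infty}\frac{\lambda(x)}{P_l x^l}=\lim_{x\to\infty}\frac{\mu(x)}{Q_m x^m}=1$$ for positive constants $P_l,Q_m$ and exponents $l\ge 0$, $m\ge 0$ with $\max(l,m)>0$. For $T>0$ let $\xi_T(t)=\xi(tT)/T$, $t\in[0,1]$. Let $F$ be the set of continuous functions $f:[0,1]\to\mathbb{R}$ with $f(0)=0$ and $f(t)>0$ for $0<t\le 1$. Then the family $\xi_T(\cdot)$ satisfies the local large deviation principle on $F$ with the following normalising function $\psi$ and rate functional $I$; that is, for every $f\in F$, $$\lim_{\varepsilon\to 0}\limsup_{T\to\infty}\frac{1}{\psi(T)}\ln\mathbf{P}(\xi_T(\cdot)\in U_\varepsilon(f))=\lim_{\varepsilon\to 0}\liminf_{T\to\infty}\frac{1}{\psi(T)}\ln\mathbf{P}(\xi_T(\cdot)\in U_\varepsilon(f))=-I(f),$$ where: (a) if $l>m$, then $\psi(T)=T^{l+1}$ and $I(f)=P_l\int_0^1 f^l(t)\,dt$; (b) if $l=m$ and $P_l\ne Q_m$, then $\psi(T)=T^{l+1}$ and $I(f)=(\sqrt{P_l}-\sqrt{Q_m})^2\int_0^1 f^l(t)\,dt$; (c) if $l<m$, then $\psi(T)=T^{m+1}$ and $I(f)=Q_m\int_0^1 f^m(t)\,dt$.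
   Context: $\mathbb{Z}^+=\{0\}\cup\mathbb{N}$. The process $\xi(t)$, $t\ge 0$, is a continuous-time Markov process with state space $\mathbb{Z}^+\cup\{\infty\}$ and $\xi(0)=0$. When at $x\in\mathbb{Z}^+$, it stays there for an exponentially distributed time with parameter $h(x)=\lambda(x)+\mu(x)>0$ and then jumps to $x+1$ with probability $\lambda(x)/h(x)$ and to $x-1$ with probability $\mu(x)/h(x)$. Here $\lambda(x)>0$ for all $x\in\mathbb{Z}^+$, $\mu(x)>0$ for $x\in\mathbb{N}$, and $\mu(0)=0$. The process may explode in finite time; after explosion it remains in the absorbing state $\infty$. $\mathbb{D}[0,1]$ is the space of (real-valued) right-continuous functions on $[0,1]$ with left limits, $\rho(f,g)=\sup_{t\in[0,1]}|f(t)-g(t)|$, and $U_\varepsilon(f)=\{g\in\mathbb{D}[0,1]:\rho(f,g)<\varepsilon\}$. In particular, on the event $\{\xi_T(\cdot)\in U_\varepsilon(f)\}$ the process $\xi$ does not explode on $[0,T]$. In case (b), $P_l$ and $Q_m$ are two separate constants although $l=m$. *)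

(* Defs.v *)
From HB Require Import structures.
From mathcomp Require Import all_boot all_order all_algebra.
From mathcomp Require Import all_classical all_reals all_analysis.

Set Implicit Arguments.
Unset Strict Implicit.
Unset Printing Implicit Defensive.

Import Order.TTheory GRing.Theory Num.Theory.
Import numFieldNormedType.Exports.

Local Open Scope classical_set_scope.
Local Open Scope ring_scope.

Section BirthDeath.
Context (d : measure_display) (Omega : measurableType d) (R : realType).
Variable P : probability Omega R.
Variables lambda mu : nat -> R.

Definition exit_rate (x : nat) : R := lambda x + mu x.

Definition jump_prob (x y : nat) : R :=
  if y == x.+1 then lambda x / exit_rate x
  else if x == y.+1 then mu x / exit_rate x
  else 0.

(* The history of the process up to its n-th jump: the visited states are
   x 0, ..., x n and the holding times in x 0, ..., x n.-1 lie in B 0, ...,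
   B n.-1. *)
Definition history (Y : nat -> Omega -> nat) (S : nat -> Omega -> R)
    (x : nat -> nat) (B : nat -> set R) (n : nat) : set Omega :=
  [set w | (forall i, (i <= n)%N -> Y i w = x i) /\
           (forall i, (i < n)%N -> B i (S i w))].

Definition jump_time (S : nat -> Omega -> R) (n : nat) (w : Omega) : R :=
  \sum_(i < n) S i w.

(* [xi t w] is the state at time t >= 0, [None] being the absorbing state
   infinity (values at t < 0 are irrelevant).  [Y n] is the state after the n-th
   jump and [S n] the time spent there: given the history, [S n] is exponential
   with parameter [exit_rate (Y n)] and, independently, the next state is drawn
   from [jump_prob (Y n)]. *)
Definition birth_death_process (xi : R -> Omega -> option nat) : Prop :=
  exists (Y : nat -> Omega -> nat) (S : nat -> Omega -> R),
  [/\ (forall n, measurable_fun [set: Omega] (Y n)) /\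
      (forall n, measurable_fun [set: Omega] (S n)),
      (forall w, Y 0%N w = 0%N) /\ (forall n w, 0 < S n w),
      forall (n : nat) (x : nat -> nat) (B : nat -> set R) (y : nat),
        (forall i, measurable (B i)) ->
        P (history Y S x B n `&` [set w | B n (S n w) /\ Y n.+1 w = y]) =
        (P (history Y S x B n) * exponential_prob (exit_rate (x n)) (B n)
          * (jump_prob (x n) y)%:E)%E,
      forall t w n, jump_time S n w <= t < jump_time S n.+1 w ->
        xi t w = Some (Y n w)
    & forall t w, (forall n, jump_time S n w <= t) -> xi t w = None].

End BirthDeath.

(* Value of a state in the extended reals; [None] is infinity. *)
Definition state_val (R : realType) (s : option nat) : \bar R :=
  if s is Some k then (k%:R)%:E else +oo%E.

Definition scaled (R : realType) (Omega : Type) (xi : R -> Omega -> option nat)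
    (T t : R) (w : Omega) : \bar R :=
  (state_val R (xi (t * T)%R w) * (T^-1)%:E)%E.

(* Functions on [0, 1] are represented by functions on R of which only the
   restriction to [0, 1] matters. *)
Section Skorokhod.
Variable R : realType.

Definition D01 : set (R -> R) :=
  [set g : R -> R | (forall t : R, 0 <= t < 1 -> g x @[x --> t^'+] --> g t) /\
           (forall t : R, 0 < t <= 1 ->
              exists a : R, g x @[x --> t^'-] --> a)].

Definition rho (f g : R -> R) : \bar R :=
  ereal_sup [set (`|f t - g t|)%:E | t in `[0, 1]].

Definition U_eps (eps : R) (f : R -> R) : set (R -> R) :=
  [set g : R -> R | D01 g /\ (rho f g < eps%:E)%E].

Definition F_pos : set (R -> R) :=
  [set f : R -> R | [/\ {within `[0, 1]%classic, continuous f},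
               f 0 = 0
             & forall t, 0 < t <= 1 -> 0 < f t]].

End Skorokhod.

Section LocalLDP.
Context (d : measure_display) (Omega : measurableType d) (R : realType).
Variable P : probability Omega R.

(* The event that the trajectory of X on [0, 1] is finite and belongs to A. *)
Definition traj_in (X : R -> Omega -> \bar R) (A : set (R -> R)) : set Omega :=
  [set w | exists2 g, A g & forall t, 0 <= t <= 1 -> X t w = (g t)%:E].

(* [lne 0 = -oo], so an event of probability 0 contributes -oo. *)
Definition log_prob (X : R -> R -> Omega -> \bar R) (psi : R -> R)
    (f : R -> R) (eps T : R) : \bar R :=
  (((psi T)^-1)%:E * lne (P (traj_in (X T) (U_eps eps f))))%E.

Definition local_ldp (X : R -> R -> Omega -> \bar R) (F : set (R -> R))
    (psi : R -> R) (I : (R -> R) -> \bar R) : Prop :=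
  forall f, F f ->
    limf_esup (log_prob X psi f eps) (pinfty_nbhs R) @[eps --> 0^'+]
      --> (- I f)%E /\
    limf_einf (log_prob X psi f eps) (pinfty_nbhs R) @[eps --> 0^'+]
      --> (- I f)%E.

End LocalLDP.

Definition power_integral (R : realType) (a : R) (f : R -> R) : \bar R :=
  (\int[lebesgue_measure]_(t in `[0%R, 1%R]) (f t `^ a)%:E)%E.

(* Main.v *)
(* Write L = max l m, so that lambda x ~ p x^L and mu x ~ q x^L with p, q >= 0.

   Upper bound: for rho > 0 put W = h - lambda rho - mu / rho, where h is the exit rate.  Then
   rho^(xi t) exp (int_0^t W (xi s) ds) is a supermartingale; on the tube around f the exponent
   is about (p + q - p rho - q / rho) T^(L+1) int f^L, while the factor rho^(xi T) is only
   exp (O(T)).  Optimising over rho gives (sqrt p - sqrt q)^2.  In terms of jumps this is a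
   Chernoff bound for each path of the embedded chain, and lowering W by a constant makes the
   sum over the number of jumps geometric.

   Lower bound: let the scaled process follow a step function close to f.  On each step the
   chain is confined to a window of D states and its holding times are prescribed up to cells of
   length kappa T^(-L), of which m are used in total.  With n jumps there are 'C(m + n, n)
   choices of cells, and the number of confined paths grows almost like 2^n when D is large; the
   best n yields a factor exp (2 sqrt (p q) x^L tau) which compensates part of the exit rates.
   The O(T) jumps between consecutive levels cost only exp (O(T ln T)). *)

Require Import Defs.
From HB Require Import structures.
From mathcomp Require Import all_boot all_order all_algebra.
From mathcomp Require Import all_classical all_reals all_analysis.
From mathcomp Require Import measurable_realfun.
From mathcomp Require Import zify ring lra.
Import Order.TTheory GRing.Theory Num.Theory.
Import numFieldNormedType.Exports.
Local Open Scope classical_set_scope.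
Local Open Scope ring_scope.

Set Implicit Arguments.
Unset Strict Implicit.
Unset Printing Implicit Defensive.

(** * Embedded chain and lower bounds from histories *)

(** A cost paid O(T) times, each time polynomial in T, is invisible on the scale T^(L + 1); a factor
    lost at each of the order of T^(L + 1) jumps made inside the windows is not. Such a factor must
    be arbitrarily close to 1, which is why the window carries an almost harmonic weight, and why
    the width [D], the number [K] of time steps and the cell size [kappa] are fixed before T grows.

    The same tilt serves both bounds. For p, q > 0 the minimum 2 sqrt (p q) of p rho + q / rho is at
    rho = sqrt (q / p); with s = sqrt (p q) one has s / rho = p and s rho = q, so conjugation by
    rho^x makes the walk in the window symmetric, with rate s in both directions. If p or q
    vanishes, the infimum is 0 and is not attained: the upper bound takes a tilt depending on the
    precision wanted, and the lower bound takes s = 0, where one long holding time fills each step.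

    The cells determine the times only up to one cell per jump. The resulting delay of the clock is
    proportional to [kappa * T] in each step, and [kappa] is so small that the delays never add up
    to more than one time step. *)

Lemma exponential_prob_ge (R : realType) (r a b : R) : 0 < r -> 0 <= a -> a <= b ->
  ((r * (b - a) * expR (- (r * b)))%:E <= exponential_prob r `[a, b[%classic)%E.
Proof.
move=> r0 a0 ab; rewrite /exponential_prob.
apply: (@le_trans _ _ (\int[lebesgue_measure]_(x in `[a, b[%classic)
    (cst ((r * expR (- (r * b)))%:E) x))%E).
  rewrite integral_cst//= lebesgue_measure_itv/= lte_fin.
  case: ltP => [_|ba]; first by rewrite -EFinM lee_fin mulrAC.
  by rewrite (@le_anti _ _ a b) ?ab// subrr mulr0 mul0r mule0.
apply: ge0_le_integral => //=.
- by move=> x _; rewrite lee_fin mulr_ge0 ?expR_ge0// ltW.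
- by apply/measurable_EFinP/measurable_funTS; exact: measurable_exponential_pdf.
- move=> x; rewrite in_itv/= => /andP[ax xb].
  rewrite lee_fin exponential_pdfE ?(le_trans a0)//.
  rewrite ler_pM2l// ler_expR mulNr lerN2 ler_pM2l//; exact: ltW.
Qed.

Lemma jump_time_index (d : measure_display) (Omega : measurableType d) (R : realType)
    (S : nat -> Omega -> R) (w : Omega) n0 n1 s : (n0 <= n1)%N ->
  jump_time S n0 w <= s < jump_time S n1 w ->
  exists2 i, (n0 <= i < n1)%N & jump_time S i w <= s < jump_time S i.+1 w.
Proof.
elim: n1 => [|n1 IH] n01 /andP[Ja Jb].
  by move: Ja Jb; rewrite (_ : n0 = 0%N)//; [lra|lia].
have [n0E|n0n] := eqVneq n0 n1.+1.
  by move: Ja Jb; rewrite n0E; lra.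
have n01' : (n0 <= n1)%N by lia.
have [sn1|n1s] := ltP s (jump_time S n1 w).
  have [|i ? ?] := IH n01'; first by rewrite Ja.
  by exists i => //; lia.
by exists n1; [lia|rewrite n1s Jb].
Qed.

Section history.
Context (d : measure_display) (Omega : measurableType d) (R : realType).
Context (P : probability Omega R) (lambda mu : nat -> R).
Context (Y : nat -> Omega -> nat) (S : nat -> Omega -> R).
Hypothesis mY : forall n, measurable_fun [set: Omega] (Y n).
Hypothesis mS : forall n, measurable_fun [set: Omega] (S n).
Hypothesis law : forall (n : nat) (x : nat -> nat) (B : nat -> set R) (y : nat),
  (forall i, measurable (B i)) ->
  P (history Y S x B n `&` [set w | B n (S n w) /\ Y n.+1 w = y]) =
  (P (history Y S x B n) * exponential_prob (exit_rate lambda mu (x n)) (B n)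
    * (jump_prob lambda mu (x n) y)%:E)%E.
Hypothesis lambda_gt0 : forall x, 0 < lambda x.
Hypothesis mu_gt0 : forall x, (0 < x)%N -> 0 < mu x.
Hypothesis mu0 : mu 0%N = 0.

Local Notation h := (exit_rate lambda mu).
Local Notation jp := (jump_prob lambda mu).

Lemma mu_ge0 x : 0 <= mu x.
Proof. by case: x => [|x]; [rewrite mu0|apply/ltW/mu_gt0]. Qed.

Lemma exit_rate_gt0 x : 0 < h x.
Proof. by rewrite /exit_rate ltr_wpDr ?mu_ge0. Qed.

Lemma jump_prob_ge0 x y : 0 <= jp x y.
Proof.
rewrite /jump_prob; case: ifP => _; first by rewrite divr_ge0 ?ltW// exit_rate_gt0.
by case: ifP => _ //; rewrite divr_ge0 ?mu_ge0 ?ltW// exit_rate_gt0.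
Qed.

Lemma measurable_eqY n y : measurable [set w | Y n w = y].
Proof. by have := mY n measurableT (I : measurable [set y]); rewrite setTI. Qed.

Lemma measurable_inS n (B : set R) : measurable B -> measurable [set w | B (S n w)].
Proof. by move=> mB; rewrite -[X in measurable X]setTI; exact: (mS n measurableT). Qed.

Lemma measurable_history x B n : (forall i, measurable (B i)) ->
  measurable (history Y S x B n).
Proof.
move=> mB.
rewrite (_ : history _ _ _ _ _ =
    \bigcap_i ((if (i <= n)%N then [set w | Y i w = x i] else setT) `&`
               (if (i < n)%N then [set w | B i (S i w)] else setT))); last first.
  apply/seteqP; split=> [w [HY HS] i _|w Hw].
    by split; case: ifP => // ?; [exact: HY|exact: HS].
  split=> i Hi.
    by have [+ _] := Hw i I; rewrite Hi.
  by have [_ +] := Hw i I; rewrite Hi.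
apply: bigcap_measurable => // i _; apply: measurableI.
  by case: ifP => // _; exact: measurable_eqY.
by case: ifP => // _; exact: measurable_inS.
Qed.

Lemma history_rcons x B n (b : set R) y :
  history Y S x B n `&` [set w | b (S n w) /\ Y n.+1 w = y] =
  history Y S (fun i => if (i <= n)%N then x i else y)
              (fun i => if (i < n)%N then B i else b) n.+1.
Proof.
apply/seteqP; split=> [w [[HY HS] [Hb Hy]]|w [HY HS]].
  split=> i; rewrite ?ltnS => Hi.
    case: ifPn => [Hin|]; first exact: HY.
    by rewrite -ltnNge => Hn; rewrite (_ : i = n.+1)//; lia.
  case: ifPn => [Hin|]; first exact: HS.
  by rewrite -leqNgt => Hn; rewrite (_ : i = n)//; lia.
split; last split.
- split=> i Hi.
    by have := HY i (leqW Hi); rewrite Hi.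
  by have := HS i (leqW Hi); rewrite Hi.
- by have := HS n (leqnn _); rewrite ltnn.
- by have := HY n.+1 (leqnn _); rewrite ltnn.
Qed.

Lemma history_law x B n (b : set R) y : (forall i, measurable (B i)) -> measurable b ->
  P (history Y S x B n `&` [set w | b (S n w) /\ Y n.+1 w = y]) =
  (P (history Y S x B n) * exponential_prob (h (x n)) b * (jp (x n) y)%:E)%E.
Proof.
move=> mB mb.
pose B' i := if (i < n)%N then B i else b.
have mB' i : measurable (B' i) by rewrite /B'; case: ifP.
have HE : history Y S x B' n = history Y S x B n.
  apply/seteqP; split=> w [HY HS]; split=> // i Hi; have := HS i Hi; rewrite /B' Hi //.
by have := law n x y mB'; rewrite HE /B' ltnn.
Qed.

(* [A] need not be measurable: [c] bounds its inner measure, conditionally on any history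
   that is in [x] after the [n]-th jump. *)
Definition lower_bounded n x (A : set Omega) (c : R) : Prop :=
  forall (xs : nat -> nat) (B : nat -> set R),
    (forall i, measurable (B i)) -> xs n = x ->
  exists A' : set Omega, [/\ measurable A', A' `<=` history Y S xs B n `&` A &
    (c%:E * P (history Y S xs B n) <= P A')%E].

Lemma lower_boundedS n x A A' c c' : A `<=` A' -> c' <= c ->
  lower_bounded n x A c -> lower_bounded n x A' c'.
Proof.
move=> AA' cc' HA xs B mB xsn; have [A1 [mA1 A1s A1P]] := HA xs B mB xsn.
exists A1; split=> //; first by move=> w /A1s[? /AA'].
by apply: le_trans A1P; rewrite lee_wpmul2r// lee_fin.
Qed.

Lemma lower_bounded_setT n x : lower_bounded n x setT 1.
Proof.
move=> xs B mB xsn; exists (history Y S xs B n); split; last by rewrite mul1e.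
  exact: measurable_history.
by rewrite setIT.
Qed.

Lemma lower_bounded_le0 n x A c : c <= 0 -> lower_bounded n x A c.
Proof.
move=> c0 xs B mB xsn; exists set0; split=> //.
by rewrite measure0 mule_le0_ge0// lee_fin.
Qed.

Lemma lower_boundedU n x A1 A2 c1 c2 : A1 `&` A2 = set0 ->
  lower_bounded n x A1 c1 -> lower_bounded n x A2 c2 ->
  lower_bounded n x (A1 `|` A2) (c1 + c2).
Proof.
move=> A12 H1 H2 xs B mB xsn.
have [A1' [mA1 A1s A1P]] := H1 xs B mB xsn.
have [A2' [mA2 A2s A2P]] := H2 xs B mB xsn.
exists (A1' `|` A2'); split; first exact: measurableU.
  by move=> w [/A1s|/A2s] [? ?]; split => //; [left|right].
rewrite measureU//; last first.
  by rewrite -subset0 => w [/A1s[_ ?] /A2s[_ ?]]; rewrite -A12.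
rewrite EFinD muleDl ?leeD ?fin_num_measure//; exact: measurable_history.
Qed.

Lemma lower_bounded_exists n x N (A : nat -> set Omega) (c : nat -> R) :
  (forall i j, (i < j)%N -> A i `&` A j = set0) ->
  (forall i, (i < N)%N -> lower_bounded n x (A i) (c i)) ->
  lower_bounded n x [set w | exists2 i, (i < N)%N & A i w] (\sum_(i < N) c i).
Proof.
move=> tA; elim: N => [|N IH] HA; first by rewrite big_ord0; exact: lower_bounded_le0.
rewrite big_ord_recr/=.
apply: (@lower_boundedS _ _ ([set w | exists2 i, (i < N)%N & A i w] `|` A N) _ _ _ _ (lexx _)).
  by move=> w [[i iN Ai]|AN]; [exists i => //; exact: ltnW|exists N].
apply: lower_boundedU; last exact: HA.
  by rewrite -subset0 => w [[i iN Ai] AN]; rewrite -(tA _ _ iN).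
by apply: IH => i iN; apply: HA; exact: ltnW.
Qed.

(** A history followed by one more prescribed jump is again a history, so the hypothesis on [A]
    applies to it, and the law of the process supplies the factor. Iteration builds the bound for a
    path from its last jump back to its first. *)
Lemma lower_bounded_step n x y (b : set R) A (c w : R) :
  measurable b -> 0 <= c -> (w%:E <= exponential_prob (h x) b)%E ->
  lower_bounded n.+1 y A c ->
  lower_bounded n x [set u | [/\ b (S n u), Y n.+1 u = y & A u]] (w * jp x y * c).
Proof.
move=> mb c0 wb HA xs B mB xsn.
have [||A' [mA' A's A'P]] := HA (fun i => if (i <= n)%N then xs i else y)
  (fun i => if (i < n)%N then B i else b); first by move=> i; case: ifP.
  by rewrite ltnn.
rewrite -history_rcons in A's A'P.
exists A'; split=> //; first by move=> u /A's[[? []]].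
apply: le_trans A'P; rewrite history_law// xsn.
have pE : P (history Y S xs B n) \is a fin_num.
  by rewrite fin_num_measure//; exact: measurable_history.
rewrite -(fineK pE).
apply: (@le_trans _ _ (c%:E * ((fine (P (history Y S xs B n)))%:E * w%:E * (jp x y)%:E))%E).
  by rewrite -!EFinM lee_fin le_eqVlt; apply/orP; left; apply/eqP; ring.
rewrite lee_wpmul2l ?lee_fin// lee_wpmul2r ?lee_fin ?jump_prob_ge0//.
by rewrite lee_wpmul2l// lee_fin fine_ge0.
Qed.

(** Every history considered here already ends in [x]. Recording the current state lets it be
    checked against the bounds of a segment. *)
Lemma lower_bounded_here n x A c : lower_bounded n x A c ->
  lower_bounded n x [set w | Y n w = x /\ A w] c.
Proof.
move=> HA xs B mB xsn; have [A' [mA' A's A'P]] := HA xs B mB xsn.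
exists A'; split=> // w /A's[Hw Aw]; split=> //; split=> //.
by case: Hw => /(_ n (leqnn n)); rewrite xsn.
Qed.

(** * Holding times prescribed up to cells, and pieces of a path *)

Section cells.
Variable dl : R.

(** Half-open, so that distinct cells are disjoint and the bounds for different choices of cells add
    up. *)
Definition cell k : set R := `[k%:R * dl, k.+1%:R * dl[%classic.

(** The state after jump [n1] is left free: it is the first state of the next segment, so that
    segments concatenate. *)
Definition segment n0 n1 lo hi (a b : R) (w : Omega) : Prop :=
  [/\ (n0 <= n1)%N, forall i, (n0 <= i < n1)%N -> (lo <= Y i w <= hi)%N
    & a <= jump_time S n1 w - jump_time S n0 w <= b].

Lemma segment0 n lo hi w : segment n n lo hi 0 0 w.
Proof. by split=> [//|i|]; [case: ltngtP|rewrite subrr lexx]. Qed.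

Lemma segmentS n k lo hi w : (lo <= Y n w <= hi)%N -> cell k (S n w) ->
  segment n n.+1 lo hi (k%:R * dl) (k.+1%:R * dl) w.
Proof.
move=> YB; rewrite /cell /= in_itv/= => /andP[Sa Sb]; split=> //.
  move=> i; rewrite ltnS => /andP[ni iN].
  by rewrite (_ : i = n)//; apply/eqP; rewrite eqn_leq iN.
by rewrite /jump_time big_ord_recr/= addrAC subrr add0r Sa ltW.
Qed.

Lemma segment_cat n0 n1 n2 lo hi a b a' b' w :
  segment n0 n1 lo hi a b w -> segment n1 n2 lo hi a' b' w ->
  segment n0 n2 lo hi (a + a') (b + b') w.
Proof.
move=> [n01 YB /andP[H1 H2]] [n12 YB' /andP[H3 H4]]; split.
- exact: leq_trans n12.
- move=> i /andP[n0i in2]; have [in1|n1i] := ltnP i n1.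
    by apply: YB; rewrite n0i.
  by apply: YB'; rewrite n1i.
- by apply/andP; split; lra.
Qed.

Lemma segmentW n0 n1 lo hi a b lo' hi' a' b' w :
  (lo' <= lo)%N -> (hi <= hi')%N -> a' <= a -> b <= b' ->
  segment n0 n1 lo hi a b w -> segment n0 n1 lo' hi' a' b' w.
Proof.
move=> lol hih aa bb [n01 YB /andP[H1 H2]]; split=> //.
  by move=> i /YB /andP[? ?]; apply/andP; split; lia.
by apply/andP; split; lra.
Qed.

Hypothesis dl_gt0 : 0 < dl.

Lemma cell_disjoint i j (s : R) : (i < j)%N -> cell i s -> ~ cell j s.
Proof.
rewrite /cell /= !in_itv/= => ij /andP[_ si] /andP[js _].
have := lt_le_trans (le_lt_trans js si) _; move=> /(_ (j%:R * dl)).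
by rewrite ltxx ler_pM2r// ler_nat => /(_ ij).
Qed.

(** The exit rate in the exponential density cancels the denominator of the jump probability, so
    only the birth rate remains. The exponential is taken at the right end of the cell. *)
Lemma lower_bounded_up n x k A c : 0 <= c -> lower_bounded n.+1 x.+1 A c ->
  lower_bounded n x [set u | [/\ cell k (S n u), Y n.+1 u = x.+1 & A u]]
    (lambda x * dl * expR (- (h x * (k.+1%:R * dl))) * c).
Proof.
move=> c0 HA.
have kd : (0 <= k%:R * dl) by rewrite mulr_ge0// ltW.
have kd1 : (k%:R * dl <= k.+1%:R * dl) by rewrite ler_pM2r// ler_nat.
have mc : measurable (cell k) by exact: measurable_itv.
have := lower_bounded_step mc c0 (exponential_prob_ge (exit_rate_gt0 x) kd kd1) HA.
apply: lower_boundedS => //; rewrite ler_wpM2r// /jump_prob eqxx le_eqVlt.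
apply/orP; left; apply/eqP; rewrite -mulrBl -natr1.
have := exit_rate_gt0 x; move: (h x) => a a0; set ee := expR _.
by field; rewrite gt_eqF.
Qed.

Lemma lower_bounded_down n x k A c : 0 <= c -> lower_bounded n.+1 x A c ->
  lower_bounded n x.+1 [set u | [/\ cell k (S n u), Y n.+1 u = x & A u]]
    (mu x.+1 * dl * expR (- (h x.+1 * (k.+1%:R * dl))) * c).
Proof.
move=> c0 HA.
have kd : (0 <= k%:R * dl) by rewrite mulr_ge0// ltW.
have kd1 : (k%:R * dl <= k.+1%:R * dl) by rewrite ler_pM2r// ler_nat.
have mc : measurable (cell k) by exact: measurable_itv.
have := lower_bounded_step mc c0 (exponential_prob_ge (exit_rate_gt0 x.+1) kd kd1) HA.
apply: lower_boundedS => //; rewrite ler_wpM2r// /jump_prob eqxx le_eqVlt.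
rewrite (_ : x == x.+2 = false); last by lia.
apply/orP; left; apply/eqP; rewrite -mulrBl -natr1.
have := exit_rate_gt0 x.+1; move: (h x.+1) => a a0; set ee := expR _.
by field; rewrite gt_eqF.
Qed.

Section move.
Variables (lo hi : nat) (w0 : R).
Hypothesis w0_ge0 : 0 <= w0.
Hypothesis w0_up : forall x, (lo <= x <= hi)%N ->
  w0 <= lambda x * dl * expR (- (h x * dl)).
Hypothesis w0_down : forall x, (lo <= x <= hi)%N -> (0 < x)%N ->
  w0 <= mu x * dl * expR (- (h x * dl)).
Variables (A : nat -> set Omega) (c : R).
Hypothesis c_ge0 : 0 <= c.

Let moved n (b : R) := [set u | exists n1, segment n n1 lo hi 0 b u /\ A n1 u].

Lemma lower_bounded_moveup e n x : (lo <= x)%N -> (x + e <= hi)%N ->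
  (forall n1, lower_bounded n1 (x + e) (A n1) c) ->
  lower_bounded n x (moved n (e%:R * dl)) (w0 ^+ e * c).
Proof.
elim: e n x => [|e IH] n x lx xh HA.
  rewrite expr0 mul1r mul0r; have := HA n; rewrite addn0.
  by apply: lower_boundedS => // u Au; exists n; split=> //; exact: segment0.
have {IH}Hn : lower_bounded n.+1 x.+1 (moved n.+1 (e%:R * dl)) (w0 ^+ e * c).
  by apply: IH; [lia|lia|rewrite addSnnS].
have c'0 : 0 <= w0 ^+ e * c by rewrite mulr_ge0// exprn_ge0.
have := lower_bounded_here (lower_bounded_up 0%N c'0 Hn).
apply: lower_boundedS.
  move=> u [Yx [c0 _ [n1 [seg An1]]]]; exists n1; split=> //.
  have Yb : (lo <= Y n u <= hi)%N by rewrite Yx; lia.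
  apply: segmentW (segment_cat (segmentS Yb c0) seg) => //.
    by rewrite mul0r addr0.
  by rewrite -mulrDl nat1r.
by rewrite exprS -mulrA ler_wpM2r// mul1r; apply: w0_up; lia.
Qed.

Lemma lower_bounded_movedown e n x : (lo <= x)%N -> (x + e <= hi)%N ->
  (forall n1, lower_bounded n1 x (A n1) c) ->
  lower_bounded n (x + e) (moved n (e%:R * dl)) (w0 ^+ e * c).
Proof.
elim: e n => [|e IH] n lx xh HA.
  rewrite expr0 mul1r mul0r addn0; have := HA n.
  by apply: lower_boundedS => // u Au; exists n; split=> //; exact: segment0.
rewrite addnS.
have {IH}Hn : lower_bounded n.+1 (x + e) (moved n.+1 (e%:R * dl)) (w0 ^+ e * c).
  by apply: IH; [lia|lia|].
have c'0 : 0 <= w0 ^+ e * c by rewrite mulr_ge0// exprn_ge0.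
have := lower_bounded_here (lower_bounded_down 0%N c'0 Hn).
apply: lower_boundedS.
  move=> u [Yx [c0 _ [n1 [seg An1]]]]; exists n1; split=> //.
  have Yb : (lo <= Y n u <= hi)%N by rewrite Yx; lia.
  apply: segmentW (segment_cat (segmentS Yb c0) seg) => //.
    by rewrite mul0r addr0.
  by rewrite -mulrDl nat1r.
by rewrite exprS -mulrA ler_wpM2r// mul1r; apply: w0_down; lia.
Qed.

(** One exponent [e] serves all pairs of states: since [w0 <= 1], a walk shorter than [e] only costs
    less. All its jumps are made in cell 0, hence the duration at most [e * dl]. *)
Lemma lower_bounded_move e n x y : w0 <= 1 -> (lo <= x <= hi)%N -> (lo <= y <= hi)%N ->
  (x <= y + e)%N -> (y <= x + e)%N -> (forall n1, lower_bounded n1 y (A n1) c) ->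
  lower_bounded n x (moved n (e%:R * dl)) (w0 ^+ e * c).
Proof.
move=> w01 /andP[lx xh] /andP[ly yh] xye yxe HA.
have conv f : (f <= e)%N -> lower_bounded n x (moved n (f%:R * dl)) (w0 ^+ f * c) ->
    lower_bounded n x (moved n (e%:R * dl)) (w0 ^+ e * c).
  move=> fe; apply: lower_boundedS; last first.
    by rewrite ler_wpM2r// ler_wiXn2l.
  move=> u [n1 [seg An1]]; exists n1; split=> //.
  by apply: segmentW seg => //; rewrite ler_pM2r// ler_nat.
have [xy|yx] := leqP x y.
  apply: (conv (y - x)%N); first lia.
  by apply: lower_bounded_moveup; [lia|lia|rewrite subnKC].
apply: (conv (x - y)%N); first lia.
rewrite -{1}(subnKC (ltnW yx)).
by apply: lower_bounded_movedown; [lia|lia|].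
Qed.

End move.

Lemma hockey_stick m n : (\sum_(k < m.+1) 'C(m - k + n, n) = 'C(m + n.+1, n.+1))%N.
Proof.
elim: m => [|m IH]; first by rewrite big_ord_recl big_ord0 !binn.
rewrite big_ord_recl subn0 [in RHS]addSn binS -IH [RHS]addnC addSnnS; by [].
Qed.

(** * Confinement to a window for a prescribed time *)

Section stay.
Variables (X D : nat) (hp g w0 : R) (Phi : nat -> R).
Hypothesis g_ge0 : 0 <= g.
Hypothesis w0_ge0 : 0 <= w0.
Hypothesis Phi_ge0 : forall i, (i <= D)%N -> 0 <= Phi i.
Hypothesis Phi_le1 : forall i, (i <= D)%N -> Phi i <= 1.
Hypothesis Phi0 : Phi 0%N = 0.
Hypothesis PhiD : Phi D = 0.
Hypothesis h_le : forall i, (i <= D)%N -> h (X + i) <= hp.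
Hypothesis w0_le : forall i, (i <= D)%N -> w0 <= lambda (X + i) * dl * expR (- (hp * dl)).
Hypothesis Phi_sub : forall i, (0 < i < D)%N ->
  g * Phi i <= (lambda (X + i) * Phi i.+1 + mu (X + i) * Phi i.-1) * dl * expR (- (hp * dl)).
Variables (A : nat -> set Omega) (c : R).
Hypothesis c_ge0 : 0 <= c.
Hypothesis HA : forall n1 y, (X <= y <= X + D.+1)%N -> lower_bounded n1 y (A n1) c.

(** There are [N + 1] jumps whose cell indices add up to [m]; each holding time exceeds the left end
    of its cell by at most [dl], hence the upper end [m + N + 1]. *)
Let stayed n m N :=
  [set u | exists n1,
     segment n n1 X (X + D) (m%:R * dl) ((m + N).+1%:R * dl) u /\ A n1 u].
(** The binomial counts the ways to write [m] as a sum of [N + 1] cell indices, and [g] is the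
    factor gained per jump by the almost harmonic [Phi]. The factor [w0] pays for the last jump,
    where [Phi <= 1] is dropped. *)
Let weight m N i := 'C(m + N, N)%:R * g ^+ N * expR (- (hp * (m%:R * dl))) * Phi i * w0 * c.

(* After a first holding time in cell [k], the remaining [N] jumps share [m - k] cells; the
   binomials for [k = 0, ..., m] add up by [hockey_stick]. *)
Lemma lower_bounded_stay N n m i : (i <= D)%N ->
  lower_bounded n (X + i) (stayed n m N) (weight m N i).
Proof.
have hp_ge0 : 0 <= hp by apply: le_trans (h_le (leq0n D)); exact/ltW/exit_rate_gt0.
(* The uniform rate [hp] replaces the exit rates. The right end of cell [k] is [k + 1], and this
   additional cell produces the factor [expR (- (hp * dl))] present in [Phi_sub]. *)
have expk j k : (j <= D)%N ->
    expR (- (hp * dl)) * expR (- (hp * (k%:R * dl))) <= expR (- (h (X + j) * (k.+1%:R * dl))).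
  move=> jD; rewrite -expRD ler_expR -opprD lerN2 -mulrDr -natr1.
  rewrite [leRHS](_ : _ = hp * ((k%:R + 1) * dl)); last by ring.
  by rewrite ler_wpM2r ?h_le// mulr_ge0 ?addr_ge0// ltW.
have w_ge0 m' N' j : (j <= D)%N -> 0 <= weight m' N' j.
  by move=> jD; rewrite /weight !mulr_ge0// ?exprn_ge0// ?expR_ge0// Phi_ge0.
elim: N n m i => [|N IH] n m i iD.
  (* The last jump goes up and may leave the window by its top; this is why [HA] covers the states
     up to [X + D.+1]. *)
  have Hn : lower_bounded n.+1 (X + i).+1 (A n.+1) c by apply: HA; lia.
  have := lower_bounded_here (lower_bounded_up m c_ge0 Hn).
  apply: lower_boundedS.
    move=> u [Yx [cm _ An1]]; exists n.+1; split=> //; rewrite addn0.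
    by apply: segmentS => //; rewrite Yx; lia.
  rewrite /weight bin0 mul1r expr0 mul1r; apply: ler_wpM2r => //.
  apply: (@le_trans _ _ (expR (- (hp * (m%:R * dl))) * w0)).
    by rewrite ler_wpM2r// ler_piMr ?expR_ge0// Phi_le1.
  rewrite mulrC; apply: (@le_trans _ _ (lambda (X + i) * dl * expR (- (hp * dl)) * expR (- (hp * (m%:R * dl))))).
    by rewrite ler_wpM2r ?expR_ge0// w0_le.
  rewrite -[leLHS]mulrA ler_wpM2l//; last exact: expk.
  by rewrite mulr_ge0 ?ltW.
(* At both edges [Phi] vanishes and there is nothing to prove; from an interior state both
   neighbours lie in the window. *)
have [i0|i_gt0] := posnP i.
  by apply: lower_bounded_le0; rewrite /weight i0 Phi0 mulr0 !mul0r.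
have [iDE|iltD] := eqVneq i D.
  by apply: lower_bounded_le0; rewrite /weight iDE PhiD mulr0 !mul0r.
have iltD' : (i < D)%N by rewrite ltn_neqAle iltD.
pose Ak k := [set u | [/\ cell k (S n u), Y n.+1 u = (X + i).+1 &
                       stayed n.+1 (m - k) N u]] `|`
             [set u | [/\ cell k (S n u), Y n.+1 u = (X + i.-1)%N &
                       stayed n.+1 (m - k) N u]].
pose ck k := lambda (X + i) * dl * expR (- (h (X + i) * (k.+1%:R * dl))) * weight (m - k)%N N i.+1
  + mu (X + i) * dl * expR (- (h (X + i) * (k.+1%:R * dl))) * weight (m - k)%N N i.-1.
have HAk k : (k < m.+1)%N -> lower_bounded n (X + i) (Ak k) (ck k).
  move=> km; apply: lower_boundedU.
  - by rewrite -subset0 => u [[_ + _] [_ + _]]; lia.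
  - by apply: lower_bounded_up; [exact: w_ge0|rewrite -addnS; exact: IH].
  - have XiE : (X + i = (X + i.-1).+1)%N by lia.
    by rewrite XiE; apply: lower_bounded_down; [apply: w_ge0; lia|apply: IH; lia].
have Hex := lower_bounded_here (lower_bounded_exists _ HAk).
apply: lower_boundedS (Hex _).
- move=> u [Yx [k km Aku]].
  have [n1 [ck' seg An1]] : exists n1, [/\ cell k (S n u),
      segment n.+1 n1 X (X + D) ((m - k)%:R * dl) ((m - k + N).+1%:R * dl) u & A n1 u].
    by case: Aku => [[? _ [n1 [? ?]]]|[? _ [n1 [? ?]]]]; exists n1.
  exists n1; split=> //.
  have Yb : (X <= Y n u <= X + D)%N by rewrite Yx; lia.
  apply: segmentW (segment_cat (segmentS Yb ck') seg) => //.
    by rewrite -mulrDl -natrD ler_pM2r// ler_nat; lia.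
  by rewrite -mulrDl -natrD ler_pM2r// ler_nat; lia.
- rewrite /weight -hockey_stick natr_sum !mulr_suml; apply: ler_sum => k _.
  rewrite /ck /weight.
  have km : (k <= m)%N by rewrite -ltnS.
  have ie : expR (- (hp * (m%:R * dl))) =
      expR (- (hp * (k%:R * dl))) * expR (- (hp * ((m - k)%:R * dl))).
    by rewrite -expRD; congr expR; rewrite natrB//; ring.
  rewrite ie exprS.
  set E1 := expR (- (hp * ((m - k)%:R * dl))).
  set E2 := expR (- (hp * (k%:R * dl))).
  set E3 := expR (- (h (X + i) * _)).
  set Q := 'C(m - k + N, N)%:R * g ^+ N.
  have Q0 : 0 <= Q * E1 * w0 * c by rewrite !mulr_ge0 ?exprn_ge0 ?expR_ge0.
  have E23 : expR (- (hp * dl)) * E2 <= E3 by exact: expk.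
  have Phis := Phi_sub (i := i); rewrite i_gt0 iltD' in Phis.
  apply: (@le_trans _ _ ((lambda (X + i) * Phi i.+1 + mu (X + i) * Phi i.-1) * dl *
     (expR (- (hp * dl)) * E2) * (Q * E1 * w0 * c))).
    rewrite -[leLHS](_ : g * Phi i * E2 * (Q * E1 * w0 * c) = _); last first.
      by rewrite /Q; ring.
    rewrite ler_wpM2r// mulrA ler_wpM2r ?expR_ge0//; exact: Phis.
  rewrite [leRHS](_ : _ = (lambda (X + i) * Phi i.+1 + mu (X + i) * Phi i.-1) * dl * E3 *
     (Q * E1 * w0 * c)); last by rewrite /Q; ring.
  rewrite ler_wpM2r// ler_wpM2l// mulr_ge0 ?(ltW dl_gt0)// addr_ge0// mulr_ge0 ?mu_ge0//.
  + by rewrite ltW.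
  + by apply: Phi_ge0; exact: iltD'.
  + by apply: Phi_ge0; lia.
- move=> j k jk; rewrite -subset0 => u.
  by move=> [[[cj _ _]|[cj _ _]] [[ck' _ _]|[ck' _ _]]]; exact: (cell_disjoint jk cj ck').
Qed.

End stay.

End cells.

End history.

(** * Chaining segments *)

Section chain.
Context (d : measure_display) (Omega : measurableType d) (R : realType).
Context (P : probability Omega R) (lambda mu : nat -> R).
Context (Y : nat -> Omega -> nat) (S : nat -> Omega -> R).
Hypothesis mY : forall n, measurable_fun [set: Omega] (Y n).
Hypothesis mS : forall n, measurable_fun [set: Omega] (S n).
Hypothesis Y0 : forall w, Y 0%N w = 0%N.
Local Notation lower_bounded := (lower_bounded P Y S).

(** One step of the schedule in continuation form: [A] is what happens afterwards, and [wt] the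
    factor paid for reaching it. The steps then compose by substitution, the last one being treated
    first. The duration is known only up to [sigma]. *)
Definition traverses lo hi X hi' (tau sigma wt : R) : Prop :=
  forall (A : nat -> set Omega) (c : R), 0 <= c ->
    (forall n1 y, (X <= y <= hi')%N -> lower_bounded n1 y (A n1) c) ->
  forall n y, (lo <= y <= hi)%N ->
    lower_bounded n y
      [set u | exists n1, segment Y S n n1 lo hi tau (tau + sigma) u /\ A n1 u]
      (wt * c).

Variables (T tau sigma : R) (K : nat) (ok : R -> nat -> Prop).
Variables (lo hi X hi' : nat -> nat) (wt : nat -> R).
Hypothesis wt_ge0 : forall j, 0 <= wt j.
Hypothesis tau_gt : T < K%:R * tau.
Hypothesis okP : forall j s y, (j < K)%N ->
  j%:R * tau <= s -> s <= j.+1%:R * (tau + sigma) -> s <= T -> (lo j <= y <= hi j)%N -> ok s y.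
Hypothesis lohi : forall j y, (j < K)%N -> (X j <= y <= hi' j)%N ->
  (lo j.+1 <= y <= hi j.+1)%N.
Hypothesis trav : forall j, (j < K)%N ->
  traverses (lo j) (hi j) (X j) (hi' j) tau sigma (wt j).

Let covered n (s : R) (w : Omega) := exists i, [/\ (n <= i)%N,
  jump_time S i w <= s < jump_time S i.+1 w & ok s (Y i w)].

(** An implication, since the clock reading after [j] steps depends on the past: it is established
    only when the earlier steps are put in front. The delays accumulate to at most [j * sigma]. *)
Let good j n := [set w | j%:R * tau <= jump_time S n w <= j%:R * (tau + sigma) ->
  forall s, jump_time S n w <= s <= T -> covered n s w].

(** Backward induction, [e] being the number of steps still to come. With none left the clock is
    already past [T], by [tau_gt], and no time remains to be covered. *)
Lemma lower_bounded_good e n y : (e <= K)%N ->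
  (lo (K - e) <= y <= hi (K - e))%N ->
  lower_bounded n y (good (K - e) n) (\prod_(K - e <= j < K) wt j).
Proof.
elim: e n y => [|e IH] n y eK yB.
  rewrite subn0 big_geq//; have : lower_bounded n y setT 1 by exact: lower_bounded_setT.
  apply: lower_boundedS => // w _ /andP[Ja Jb] s /andP[Js sT].
  by move: tau_gt; rewrite ltNge (le_trans Ja)// (le_trans Js).
set j := (K - e.+1)%N in yB *.
have jK : (j < K)%N by rewrite /j; lia.
have jS : (K - e = j.+1)%N by rewrite /j; lia.
rewrite big_ltn//.
have := @trav j jK (good j.+1) (\prod_(j.+1 <= i < K) wt i) _ _ n y yB.
have H1 : 0 <= \prod_(j.+1 <= i < K) wt i by exact: prodr_ge0.
have H2 n1 y0 : (X j <= y0 <= hi' j)%N ->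
    lower_bounded n1 y0 (good j.+1 n1) (\prod_(j.+1 <= i < K) wt i).
  by move=> /(lohi jK); rewrite -jS; apply: IH; exact: ltnW.
move=> /(_ H1 H2); apply: lower_boundedS => //.
move=> w [n1 [[n01 YB /andP[Ja Jb]] Gn1]] /andP[Jj Jj'] s /andP[Js sT].
have Jn1 : j.+1%:R * tau <= jump_time S n1 w <= j.+1%:R * (tau + sigma).
  by rewrite -natr1; apply/andP; split; rewrite mulrDl mul1r; lra.
have [sn1|n1s] := ltP s (jump_time S n1 w).
  have [|i iB Jis] := @jump_time_index _ _ _ S w n n1 s n01; first by rewrite Js.
  exists i; split=> //; first by case/andP: iB.
  apply: (okP jK) (YB _ iB) => //; first by lra.
  by case/andP: Jn1; lra.
have [|i [n1i ? ?]] := Gn1 Jn1 s; first by rewrite n1s sT.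
by exists i; split=> //; exact: leq_trans n1i.
Qed.

Lemma probability_covered : (lo 0 <= 0 <= hi 0)%N ->
  exists A : set Omega, [/\ measurable A, ((\prod_(j < K) wt j)%:E <= P A)%E &
    forall w, A w -> forall s, 0 <= s <= T ->
      exists i, jump_time S i w <= s < jump_time S i.+1 w /\ ok s (Y i w)].
Proof.
move=> lo0; have := @lower_bounded_good K 0 0 (leqnn K); rewrite subnn => /(_ lo0).
move=> /(_ (fun=> 0%N) (fun=> setT) (fun=> measurableT) erefl).
have -> : history Y S (fun=> 0%N) (fun=> setT) 0 = setT.
  by rewrite -subTset => w _; split=> // i; rewrite leqn0 => /eqP ->.
move=> [A [mA As]]; rewrite probability_setT mule1 big_mkord => PA.
exists A; split=> // w /As[_ Aw] s sT.
have J0 : jump_time S 0 w = 0 by rewrite /jump_time big_ord0.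
have [||i [_ ? ?]] := Aw _ s; rewrite ?J0 ?mul0r ?lexx//.
by exists i.
Qed.

End chain.

(** * A move to a level followed by a stay *)

Section traverse.
Context (d : measure_display) (Omega : measurableType d) (R : realType).
Context (P : probability Omega R) (lambda mu : nat -> R).
Context (Y : nat -> Omega -> nat) (S : nat -> Omega -> R).
Hypothesis mY : forall n, measurable_fun [set: Omega] (Y n).
Hypothesis mS : forall n, measurable_fun [set: Omega] (S n).
Hypothesis law : forall (n : nat) (x : nat -> nat) (B : nat -> set R) (y : nat),
  (forall i, measurable (B i)) ->
  P (history Y S x B n `&` [set w | B n (S n w) /\ Y n.+1 w = y]) =
  (P (history Y S x B n) * exponential_prob (exit_rate lambda mu (x n)) (B n)
    * (jump_prob lambda mu (x n) y)%:E)%E.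
Hypothesis lambda_gt0 : forall x, 0 < lambda x.
Hypothesis mu_gt0 : forall x, (0 < x)%N -> 0 < mu x.
Hypothesis mu0 : mu 0%N = 0.
Local Notation h := (exit_rate lambda mu).

Variables (dl : R) (lo hi X D e m N : nat) (hp g w0 : R) (Phi : nat -> R).
Hypothesis dl_gt0 : 0 < dl.
Hypothesis D_gt0 : (0 < D)%N.
Hypothesis loX : (lo <= X)%N.
Hypothesis XDhi : (X + D <= hi)%N.
Hypothesis lohie : (hi <= lo + e)%N.
Hypothesis w0_ge0 : 0 <= w0.
Hypothesis w0_le1 : w0 <= 1.
Hypothesis w0_up : forall x, (lo <= x <= hi)%N ->
  w0 <= lambda x * dl * expR (- (h x * dl)).
Hypothesis w0_down : forall x, (lo <= x <= hi)%N -> (0 < x)%N ->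
  w0 <= mu x * dl * expR (- (h x * dl)).
Hypothesis g_ge0 : 0 <= g.
Hypothesis Phi_ge0 : forall i, (i <= D)%N -> 0 <= Phi i.
Hypothesis Phi_le1 : forall i, (i <= D)%N -> Phi i <= 1.
Hypothesis Phi0 : Phi 0%N = 0.
Hypothesis PhiD : Phi D = 0.
Hypothesis h_le : forall i, (i <= D)%N -> h (X + i) <= hp.
Hypothesis w0_le : forall i, (i <= D)%N -> w0 <= lambda (X + i) * dl * expR (- (hp * dl)).
Hypothesis Phi_sub : forall i, (0 < i < D)%N ->
  g * Phi i <= (lambda (X + i) * Phi i.+1 + mu (X + i) * Phi i.-1) * dl * expR (- (hp * dl)).

(** The stay is entered at [X + 1], since the weight vanishes at the bottom [X]. The move takes up
    to [e] cells, which are added to the delay of the stay. *)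
Lemma traverses_window :
  traverses P Y S lo hi X (X + D.+1) (m%:R * dl) ((e + N).+1%:R * dl)
    (w0 ^+ e * ('C(m + N, N)%:R * g ^+ N * expR (- (hp * (m%:R * dl))) * Phi 1%N * w0)).
Proof.
move=> A c c0 HA n y yB.
pose A' n2 := [set u | exists n1,
     segment Y S n2 n1 X (X + D) (m%:R * dl) ((m + N).+1%:R * dl) u /\ A n1 u].
have HA' n2 : lower_bounded P Y S n2 (X + 1) (A' n2)
    ('C(m + N, N)%:R * g ^+ N * expR (- (hp * (m%:R * dl))) * Phi 1%N * w0 * c).
  by apply: (lower_bounded_stay mY mS law).
have w1 : 0 <= 'C(m + N, N)%:R * g ^+ N * expR (- (hp * (m%:R * dl))) * Phi 1%N * w0 * c.
  by rewrite !mulr_ge0// ?exprn_ge0// ?expR_ge0// Phi_ge0.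
have X1B : (lo <= X + 1 <= hi)%N by lia.
have [ye ey] : (y <= X + 1 + e)%N /\ (X + 1 <= y + e)%N by lia.
have /(_ n) := lower_bounded_move mY mS law lambda_gt0 mu_gt0 mu0 dl_gt0 w0_ge0 w0_up w0_down
  w1 w0_le1 yB X1B ye ey HA'.
apply: lower_boundedS; last by rewrite -!mulrA.
move=> u [n2 [seg1 [n1 [seg2 An1]]]]; exists n1; split=> //.
have seg2' := segmentW loX XDhi (lexx _) (lexx _) seg2.
apply: segmentW (segment_cat seg1 seg2') => //; first by rewrite add0r.
by rewrite -!mulrDl -!natrD ler_pM2r// ler_nat; lia.
Qed.

End traverse.

(** * Exponential moments of holding times *)

Section density.
Context (d : measure_display) (T : measurableType d) (R : realType).
Variables (m : {measure set T -> \bar R}) (S : T -> R) (g : T -> R).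
Hypothesis mS : measurable_fun setT S.
Hypothesis mg : measurable_fun setT g.
Hypothesis g_ge0 : forall x, 0 <= g x.
Variable phi : R -> R.
Hypothesis phi_ge0 : forall s, 0 <= phi s.
Hypothesis mphi : measurable_fun setT phi.

Let mEphi : measurable_fun setT (EFin \o phi).
Proof. exact/measurable_EFinP. Qed.

Let h := nnsfun_approx measurableT mEphi.

Import HBNNSimple.

Let mhS n : measurable_fun setT (fun x => h n (S x)).
Proof. by apply: measurableT_comp. Qed.

(** The right-hand side depends on [m], [S] and [g] only through the integrals of [g] over preimages
    under [S]. Two such triples that agree on these have the same left-hand side, which is how a law
    on the sample space is compared with a density on the line. *)
Lemma integral_comp_density_lim :
  (\int[m]_x (phi (S x) * g x)%:E)%E =
  lim ((\sum_(y \in range (h n)) (y%:E * \int[m]_(x in S @^-1` (h n @^-1` [set y])) (g x)%:E))%E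
       @[n --> \oo]).
Proof.
have lim1 x : ((phi (S x) * g x)%:E = lim ((h n (S x) * g x)%:E @[n --> \oo]))%E.
  apply/esym/cvg_lim => //; rewrite EFinM.
  apply: (@cvg_trans _ ((EFin \o h ^~ (S x)) n * (g x)%:E @[n --> \oo])%E) => //.
  apply: cvgeZr => //.
  by apply: cvg_nnsfun_approx => // s _; rewrite /= lee_fin.
under eq_integral do rewrite lim1.
rewrite monotone_convergence//; first last.
- move=> x _ a b ab; rewrite lee_fin ler_wpM2r//.
  by have /lefP := nd_nnsfun_approx measurableT mEphi ab; apply.
- by move=> n x _; rewrite lee_fin mulr_ge0.
- by move=> n; apply/measurable_EFinP; apply: measurable_funM.
have congr_lim (u v : nat -> \bar R) : u =1 v -> limn u = limn v by move=> /funext ->.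
apply: congr_lim => n.
have ge0n y x : 0 <= y * \1_(h n @^-1` [set y]) (S x) * g x.
  rewrite mulr_ge0//; have := nnfun_muleindic_ge0 (h n) y (S x).
  by rewrite -EFinM lee_fin.
have mI y : measurable_fun setT (fun x : T => (y * \1_(h n @^-1` [set y]) (S x) * g x)).
  apply: measurable_funM => //; apply: measurable_funM => //.
  by apply: measurableT_comp => //; exact: measurable_indic.
transitivity (\int[m]_x (\sum_(y \in range (h n)) (y * \1_(h n @^-1` [set y]) (S x) * g x)%:E))%E.
  apply: eq_integral => x _; rewrite {1}(fimfunE (h n)) fsumEFin//; congr EFin.
  exact: mulr_fsuml.
rewrite ge0_integral_fsum//; first last.
- by move=> y x _; rewrite lee_fin.
- by move=> y; apply/measurable_EFinP; exact: mI.
apply: eq_fsbigr => y; rewrite inE => -[s _ hsy].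
have y0 : 0 <= y by rewrite -hsy.
under eq_integral do rewrite -mulrA EFinM.
rewrite ge0_integralZl//; first last.
- by move=> x _; rewrite lee_fin mulr_ge0.
- apply/measurable_EFinP; apply: measurable_funM => //.
  by apply: measurableT_comp => //; exact: measurable_indic.
congr (_ * _)%E; rewrite [RHS]integral_mkcond; apply: eq_integral => x _.
rewrite patchE /indic /=; case: ifPn => /=.
  by rewrite !inE /= => hy; rewrite mem_set// mul1r.
by move=> xn; rewrite memNset ?mul0r// => hy; move/negP: xn; apply; rewrite inE.
Qed.

End density.

Section exponential_moment.
Import HBNNSimple.

(** The last hypothesis says that, under the density [g], the law of [S] is [c] times the
    exponential law of rate [r]; the value is [c] times its moment generating function. *)
Lemma integral_expR_exponential (d : measure_display) (T : measurableType d)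
    (R : realType) (m : {measure set T -> \bar R}) (S g : T -> R) (c r a : R) :
  measurable_fun setT S -> measurable_fun setT g -> (forall x, 0 <= g x) ->
  0 <= c -> 0 < r -> a < r ->
  (forall B, measurable B ->
     (\int[m]_(x in S @^-1` B) (g x)%:E = c%:E * exponential_prob r B)%E) ->
  (\int[m]_x (expR (a * S x) * g x)%:E)%E = (c * (r / (r - a)))%:E.
Proof.
move=> mS mg g0 c0 r0 ar mE.
have me : measurable_fun [set: R] (fun s : R => expR (a * s)).
  by apply: measurableT_comp => //; exact: mulrl_measurable.
have mp : measurable_fun [set: R] (fun s => c * exponential_pdf r s).
  by apply: measurable_funM => //; exact: measurable_exponential_pdf.
have p0 s : 0 <= c * exponential_pdf r s.
  by rewrite mulr_ge0// exponential_pdf_ge0// ltW.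
transitivity (\int[lebesgue_measure]_x (expR (a * x) * (c * exponential_pdf r x))%:E)%E.
  have mid : measurable_fun [set: R] (fun x : R => x) by exact: measurable_id.
  rewrite (integral_comp_density_lim m mS mg g0 (fun s => expR_ge0 (a * s)) me).
  have -> := (integral_comp_density_lim lebesgue_measure mid mp p0 (fun s => expR_ge0 (a * s)) me).
  have congr_lim (u v : nat -> \bar R) : u =1 v -> limn u = limn v by move=> /funext ->.
  apply: congr_lim => n; apply: eq_fsbigr => y _; congr (_ * _)%E.
  set B := _ @^-1` [set y]; have mB : measurable B by apply: measurable_funPTI; exact: measurable_set1.
  rewrite mE// /exponential_prob -ge0_integralZl//=.
  - by apply/measurable_EFinP/measurable_funTS; exact: measurable_exponential_pdf.
  - by move=> s _; rewrite lee_fin exponential_pdf_ge0// ltW.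
have ra0 : 0 < r - a by lra.
(* Tilting the exponential density of rate [r] by [expR (a * x)] gives [r / (r - a)] times the
   density of rate [r - a]. *)
transitivity (\int[lebesgue_measure]_x ((c * (r / (r - a)))%:E * (exponential_pdf (r - a) x)%:E))%E.
  apply: eq_integral => x _; rewrite -EFinM; congr EFin.
  have [x0|x0] := ltP x 0; first by rewrite !lt0_exponential_pdf// !mulr0.
  rewrite !exponential_pdfE//.
  rewrite (_ : - (r - a) * x = a * x + - r * x); last by ring.
  by rewrite expRD; field; rewrite gt_eqF.
rewrite ge0_integralZl//=.
- by rewrite integral_exponential_pdf// mule1.
- by apply/measurable_EFinP; exact: measurable_exponential_pdf.
- by move=> x _; rewrite lee_fin exponential_pdf_ge0// ltW.
- by rewrite lee_fin mulr_ge0// divr_ge0// ltW.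
Qed.

End exponential_moment.

Section moments.
Context (d : measure_display) (Omega : measurableType d) (R : realType).
Context (P : probability Omega R) (lambda mu : nat -> R).
Context (Y : nat -> Omega -> nat) (S : nat -> Omega -> R).
Hypothesis mY : forall n, measurable_fun [set: Omega] (Y n).
Hypothesis mS : forall n, measurable_fun [set: Omega] (S n).
Hypothesis law : forall (n : nat) (x : nat -> nat) (B : nat -> set R) (y : nat),
  (forall i, measurable (B i)) ->
  P (history Y S x B n `&` [set w | B n (S n w) /\ Y n.+1 w = y]) =
  (P (history Y S x B n) * exponential_prob (exit_rate lambda mu (x n)) (B n)
    * (jump_prob lambda mu (x n) y)%:E)%E.
Hypothesis lambda_gt0 : forall x, 0 < lambda x.
Hypothesis mu_gt0 : forall x, (0 < x)%N -> 0 < mu x.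
Hypothesis mu0 : mu 0%N = 0.

Local Notation h := (exit_rate lambda mu).
Local Notation jp := (jump_prob lambda mu).
Local Notation history := (history Y S).

Let h_gt0 x : 0 < h x. Proof. exact: exit_rate_gt0. Qed.

Lemma exponential_prob_setT (r : R) : 0 < r -> exponential_prob r setT = 1%E.
Proof. by move=> r0; rewrite /exponential_prob integral_exponential_pdf. Qed.

Lemma eq_history x B B' n : (forall i, (i < n)%N -> B i = B' i) ->
  history x B n = history x B' n.
Proof.
by move=> BB; apply/seteqP; split=> w [HY HS]; split=> // i iN; have := HS i iN; rewrite BB.
Qed.

Lemma historyS x B n : history x B n.+1 =
  history x B n `&` [set w | B n (S n w) /\ Y n.+1 w = x n.+1].
Proof.
apply/seteqP; split=> [w [HY HS]|w [[HY HS] [HB Hx]]].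
  by split; [split=> i iN; [apply: HY|apply: HS]; exact: leqW|split; [exact: HS|exact: HY]].
split=> i; rewrite ?ltnS leq_eqVlt => /orP[/eqP ->//|]; rewrite ?ltnS.
  exact: HY.
exact: HS.
Qed.

(** Given the visited states the holding times are independent and exponential, so constraining one
    that was free only multiplies by its own probability. *)
Lemma probability_history_update x B n k b : (forall i, measurable (B i)) ->
  measurable b -> (k < n)%N -> B k = setT ->
  P (history x (fun i => if i == k then b else B i) n) =
  (P (history x B n) * exponential_prob (h (x k)) b)%E.
Proof.
move=> mB mb; have mB' i : measurable (if i == k then b else B i) by case: ifP.
elim: n => // n IH; rewrite ltnS => kn BkT; rewrite !historyS !law//.
have [kn'|nk] := eqVneq k n.
  rewrite -kn' (@eq_history _ _ B) => [|i ik]; last first.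
    by rewrite ifF//; apply/negbTE; rewrite neq_ltn ik.
  by rewrite BkT exponential_prob_setT// mule1 muleAC.
rewrite IH//; last by lia.
by rewrite [RHS]muleAC; congr (_ * _)%E; exact: muleAC.
Qed.

Variable a : nat -> R.
Variable x : nat -> nat.
Hypothesis a_lt : forall i, a i < h (x i).

Lemma measurable_prod_expR k :
  measurable_fun setT (fun w => \prod_(i < k) expR (a i * S i w)).
Proof.
elim: k => [|k IH].
  by rewrite (_ : (fun _ => _) = cst 1)//; apply/funext => w; rewrite big_ord0.
rewrite (_ : (fun _ => _) = (fun w => \prod_(i < k) expR (a i * S i w) * expR (a k * S k w))); last first.
  by apply/funext => w; rewrite big_ord_recr.
apply: measurable_funM => //; apply: measurableT_comp => //.
by apply: measurable_funM.
Qed.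

(** Induction on the number [k] of holding times integrated out. The sets from index [k] on stay
    arbitrary, because the law of [S k] under the density [g] is identified by applying the
    induction hypothesis with [S k] restricted to a set [b]. *)
Lemma integral_history_expR n k B : (k <= n)%N -> (forall i, measurable (B i)) ->
  (forall i, (i < k)%N -> B i = setT) ->
  (\int[P]_(w in history x B n) (\prod_(i < k) expR (a i * S i w))%:E)%E =
  ((\prod_(i < k) (h (x i) / (h (x i) - a i))) * fine (P (history x B n)))%:E.
Proof.
elim: k B => [|k IH] B kn mB BT.
  have mH := measurable_history mY mS x n mB.
  under eq_integral do rewrite big_ord0.
  by rewrite integral_cst// big_ord0 !mul1r mul1e fineK// fin_num_measure.
have mH := measurable_history mY mS x n mB.
have HT := BT k (ltnSn k).
rewrite integral_mkcond.
pose g w := \1_(history x B n) w * \prod_(i < k) expR (a i * S i w).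
have g0 w : 0 <= g w by rewrite mulr_ge0// prodr_ge0// => i _; exact: expR_ge0.
have mg : measurable_fun setT g.
  by apply: measurable_funM; [exact: measurable_indic|exact: measurable_prod_expR].
transitivity (\int[P]_w (expR (a k * S k w) * g w)%:E)%E.
  apply: eq_integral => w _; rewrite patchE big_ord_recr/= /g indicE.
  by case: ifPn => wH; rewrite ?mul0r ?mulr0// mul1r mulrC.
rewrite big_ord_recr/= [in RHS]mulrAC.
apply: integral_expR_exponential => //.
  rewrite mulr_ge0 ?fine_ge0// prodr_ge0// => i _.
  by rewrite divr_ge0 ?ltW// subr_gt0.
move=> b mb.
have bT : forall i, (i < k)%N -> (if i == k then b else B i) = setT.
  by move=> i ik; rewrite ifF ?BT//; [lia|apply/negbTE; rewrite neq_ltn ik].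
have mB' i : measurable (if i == k then b else B i) by case: ifP.
have IHk := IH (fun i => if i == k then b else B i) (ltnW kn) mB' bT.
have PE : P (history x (fun i => if i == k then b else B i) n) =
    (P (history x B n) * exponential_prob (h (x k)) b)%E.
  exact: probability_history_update.
rewrite [RHS](_ : _ = (\prod_(i < k) (h (x i) / (h (x i) - a i)))%:E *
    P (history x (fun i => if i == k then b else B i) n))%E; last first.
  by rewrite PE EFinM fineK ?fin_num_measure// muleA.
rewrite -[X in _ = (_ * X)%E]fineK; last first.
  by rewrite fin_num_measure//; exact: measurable_history.
rewrite -EFinM -IHk integral_mkcond [RHS]integral_mkcond.
apply: eq_integral => w _; rewrite !patchE /g indicE.
have HE : history x (fun i => if i == k then b else B i) n =
    history x B n `&` (S k @^-1` b).
  apply/seteqP; split=> [v [HY HS]|v [[HY HS] Sb]]; split=> //.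
  - by split=> // i iN; have := HS i iN; case: eqVneq => // ->; rewrite HT.
  - by have := HS k kn; rewrite eqxx.
  - by move=> i iN; case: eqVneq => [->//|_]; exact: HS.
rewrite HE in_setI.
by case: (w \in S k @^-1` b); case: (w \in history x B n) => //=; rewrite ?mul1r ?mul0r.
Qed.

End moments.

(** * Upper bound for unions of histories *)

Section path_sum.
Context (R : realType) (M : nat) (k : nat -> nat -> R) (G : nat -> R) (r : R).
Hypothesis k_ge0 : forall y z, 0 <= k y z.
Hypothesis kG : forall y, (y <= M)%N -> \sum_(z < M.+1) k y z * G z <= r * G y.
Hypothesis r_ge0 : 0 <= r.

Fixpoint path_weight (y : nat) (s : seq nat) : R :=
  if s is z :: s' then k y z * path_weight z s' else 1.

Lemma path_weightE y s :
  path_weight y s = \prod_(i < size s) k (nth 0%N (y :: s) i) (nth 0%N s i).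
Proof.
elim: s y => [|z s IH] y; first by rewrite big_ord0.
by rewrite /= big_ord_recl/= IH.
Qed.

(** The hypothesis [kG] makes [G] superharmonic up to the factor [r]; each step of the path, summed
    out, costs one such factor. *)
Lemma sum_path_weight n y : (y <= M)%N ->
  \sum_(t : n.-tuple 'I_M.+1)
     path_weight y (map val t) * G (last y (map val t)) <= r ^+ n * G y.
Proof.
elim: n y => [|n IH] y yM.
  rewrite (big_pred1 [tuple]) => [|t]; first by rewrite expr0 /=.
  by rewrite [t]tuple0; apply/esym/eqP; apply: val_inj.
rewrite (reindex (fun p : 'I_M.+1 * n.-tuple 'I_M.+1 => [tuple of p.1 :: p.2])); last first.
  exists (fun t : n.+1.-tuple 'I_M.+1 => (thead t, [tuple of behead t])) => [[z t] _|t _].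
    by congr (_, _); apply: val_inj.
  by rewrite /= [RHS](tuple_eta t); apply: val_inj.
rewrite -(pair_bigA _ (fun z (t : n.-tuple 'I_M.+1) =>
    path_weight y (map val (z :: t)) * G (last y (map val (z :: t)))))/=.
apply: (@le_trans _ _ (\sum_(z < M.+1) k y z * (r ^+ n * G z))).
  apply: ler_sum => z _; under eq_bigr do rewrite -mulrA.
  by rewrite -mulr_sumr ler_wpM2l// IH// -ltnS.
under eq_bigr do rewrite mulrCA.
by rewrite -mulr_sumr exprSr -mulrA ler_wpM2l ?exprn_ge0// kG.
Qed.

End path_sum.

Section chernoff.
Context (d : measure_display) (Omega : measurableType d) (R : realType).
Context (P : probability Omega R) (lambda mu : nat -> R).
Context (Y : nat -> Omega -> nat) (S : nat -> Omega -> R).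
Hypothesis mY : forall n, measurable_fun [set: Omega] (Y n).
Hypothesis mS : forall n, measurable_fun [set: Omega] (S n).
Hypothesis Y0 : forall w, Y 0%N w = 0%N.
Hypothesis law : forall (n : nat) (x : nat -> nat) (B : nat -> set R) (y : nat),
  (forall i, measurable (B i)) ->
  P (history Y S x B n `&` [set w | B n (S n w) /\ Y n.+1 w = y]) =
  (P (history Y S x B n) * exponential_prob (exit_rate lambda mu (x n)) (B n)
    * (jump_prob lambda mu (x n) y)%:E)%E.
Hypothesis lambda_gt0 : forall x, 0 < lambda x.
Hypothesis mu_gt0 : forall x, (0 < x)%N -> 0 < mu x.
Hypothesis mu0 : mu 0%N = 0.

Local Notation h := (exit_rate lambda mu).
Local Notation jp := (jump_prob lambda mu).
Local Notation visits x n := (history Y S x (fun=> setT) n).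

Let h_gt0 x : 0 < h x. Proof. exact: exit_rate_gt0. Qed.
Let jp_ge0 x y : 0 <= jp x y. Proof. exact: jump_prob_ge0. Qed.

Let mvisits x n : measurable (visits x n).
Proof. exact: measurable_history. Qed.

(** At [x = 0] the truncated predecessor is 0 itself, and the second term vanishes because
    [jp 0 0 = 0]. *)
Lemma jump_prob_sum x : jp x x.+1 + jp x x.-1 = 1.
Proof.
have := h_gt0 x; rewrite /jump_prob /exit_rate eqxx; case: x => [|x] h0 /=.
  by rewrite mu0 !addr0 divff// gt_eqF.
rewrite eqxx (_ : (x == x.+2) = false); last by lia.
by rewrite -mulrDl divff// gt_eqF.
Qed.

Lemma probability_visitsS x n : P (visits x n.+1) =
  (P (visits x n) * (jp (x n) (x n.+1))%:E)%E.
Proof.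
by rewrite historyS (law n x (x n.+1) (fun=> measurableT)) exponential_prob_setT// mule1.
Qed.

Lemma probability_visits_le x n :
  (P (visits x n) <= (\prod_(i < n) jp (x i) (x i.+1))%:E)%E.
Proof.
elim: n => [|n IH]; first by rewrite big_ord0; exact: probability_le1.
by rewrite probability_visitsS big_ord_recr/= EFinM lee_wpmul2r// lee_fin.
Qed.

Variable W : nat -> R.
Hypothesis W_lt : forall y, W y < h y.

(** Exponential Chebyshev inequality. The holding time [S n] is the one in progress at the horizon,
    only partly used, hence the positive part of [W]. One more jump is prescribed because the moment
    formula handles completed holding times only. *)
Lemma chernoff_visitsS n x E b : measurable E ->
  (forall w, E w -> visits x n.+1 w -> b <= \sum_(i < n) W (x i) * S i w
     + Num.max 0 (W (x n)) * S n w) ->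
  (P (E `&` visits x n.+1) <=
   (expR (- b) * (\prod_(i < n) (h (x i) / (h (x i) - W (x i)))
      * (h (x n) / (h (x n) - Num.max 0 (W (x n))))))%:E * P (visits x n.+1))%E.
Proof.
move=> mE Eb.
pose a i := if (i < n)%N then W (x i) else Num.max 0 (W (x i)).
have a_lt i : a i < h (x i) by rewrite /a; case: ifP => // _; rewrite gt_max h_gt0/=.
have mI := integral_history_expR mY mS law lambda_gt0 mu_gt0 mu0 a_lt (leqnn n.+1)
  (fun=> measurableT) (fun _ _ => erefl).
have prodE : \prod_(i < n.+1) (h (x i) / (h (x i) - a i)) =
    \prod_(i < n) (h (x i) / (h (x i) - W (x i))) * (h (x n) / (h (x n) - Num.max 0 (W (x n)))).
  rewrite big_ord_recr/= /a ltnn; congr (_ * _).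
  by apply: eq_bigr => i _; rewrite ltn_ord.
rewrite prodE in mI.
have pV : P (visits x n.+1) \is a fin_num by rewrite fin_num_measure.
rewrite -[P (visits x n.+1)]fineK// -EFinM -mulrA EFinM -mI.
rewrite -[leLHS]mul1e -[X in (X * _ <= _)%E](_ : (expR (- b) * expR b)%:E = _); last first.
  by rewrite mulrC expRxMexpNx_1.
rewrite EFinM -muleA.
apply: lee_wpmul2l; first by rewrite lee_fin expR_ge0.
have mEV : measurable (E `&` visits x n.+1) by exact: measurableI.
have mprod := measurable_prod_expR mS a n.+1.
apply: (@le_trans _ _ (\int[P]_(w in E `&` visits x n.+1)
    (\prod_(i < n.+1) expR (a i * S i w))%:E)%E); last first.
  apply: ge0_subset_integral => //.
  - by apply/measurable_EFinP/measurable_funTS; exact: mprod.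
  - by move=> w _; rewrite lee_fin prodr_ge0// => i _; exact: expR_ge0.
rewrite -integral_cst//; apply: ge0_le_integral => //.
- by move=> w _; rewrite lee_fin expR_ge0.
- by apply/measurable_EFinP/measurable_funTS; exact: mprod.
- move=> w [Ew Vw]; rewrite lee_fin.
  rewrite -expR_sum ler_expR big_ord_recr/= {2}/a ltnn.
  under eq_bigr => i _ do rewrite /a ltn_ord.
  exact: Eb.
Qed.

(** The additional jump is removed by summing over the two neighbours of [x n], whose probabilities
    add up to 1. *)
Lemma chernoff_visits n x E b : measurable E ->
  (forall w, E w -> visits x n w -> b <= \sum_(i < n) W (x i) * S i w
     + Num.max 0 (W (x n)) * S n w) ->
  (P (E `&` visits x n) <=
   (expR (- b) * (\prod_(i < n) (jp (x i) (x i.+1) * (h (x i) / (h (x i) - W (x i))))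
      * (h (x n) / (h (x n) - Num.max 0 (W (x n))))))%:E)%E.
Proof.
move=> mE Eb.
pose x' y i := if (i <= n)%N then x i else y.
have x'E y i : (i <= n)%N -> x' y i = x i by rewrite /x' => ->.
have Vx' y : visits (x' y) n = visits x n.
  apply/seteqP; split=> w [HY HS]; split=> // i iN; first by rewrite HY// x'E.
  by rewrite x'E// HY.
have x'n y : x' y n.+1 = y by rewrite /x' ltnn.
pose F y := E `&` visits (x' y) n.+1.
have mF y : measurable (F y) by exact: measurableI.
set C := (\prod_(i < n) (h (x i) / (h (x i) - W (x i))) * (h (x n) / (h (x n) - Num.max 0 (W (x n))))).
have HF y : (P (F y) <= (expR (- b) * C)%:E * P (visits (x' y) n.+1))%E.
  have := @chernoff_visitsS n (x' y) E b mE.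
  rewrite (x'E y n (leqnn n)).
  have -> : \prod_(i < n) (h (x' y i) / (h (x' y i) - W (x' y i))) =
      \prod_(i < n) (h (x i) / (h (x i) - W (x i))).
    by apply: eq_bigr => i _; rewrite x'E// ltnW.
  apply=> w Ew; rewrite historyS Vx' => -[/(Eb w Ew) + _].
  by under [in X in _ -> X]eq_bigr => i _ do rewrite (x'E y i (ltnW (ltn_ord i))).
have PF y : P (visits (x' y) n.+1) = (P (visits x n) * (jp (x n) y)%:E)%E.
  by rewrite probability_visitsS Vx' x'n (x'E y n (leqnn n)).
have pV : P (visits x n) \is a fin_num by rewrite fin_num_measure.
have C0 : 0 <= C.
  rewrite /C mulr_ge0//; first by apply: prodr_ge0 => i _; rewrite divr_ge0// ltW// subr_gt0.
  by rewrite divr_ge0 ?ltW// subr_gt0 gt_max h_gt0/=.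
(* the jumps other than those to a neighbour have probability zero *)
pose N := visits x n `\` (visits (x' (x n).+1) n.+1 `|` visits (x' (x n).-1) n.+1).
have dis : visits (x' (x n).+1) n.+1 `&` visits (x' (x n).-1) n.+1 = set0.
  rewrite -subset0 => w []; rewrite !historyS !x'n => [[_ [_ E1]] [_ [_ E2]]].
  by move: E2; rewrite E1; lia.
have mN : measurable N by apply: measurableD => //; exact: measurableU.
have PN : P N = 0%E.
  have mU : measurable (visits (x' (x n).+1) n.+1 `|` visits (x' (x n).-1) n.+1).
    exact: measurableU.
  set U := (X in _ `\` X) in N mN mU *.
  have -> : P N = (P (visits x n) - P (visits x n `&` U))%E.
    by apply: measureD => //; rewrite -ge0_fin_numE.
  rewrite setIC setIidl; last first.
    by move=> w []; rewrite !historyS !Vx' => -[].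
  have PU : P (visits (x' (x n).+1) n.+1 `|` visits (x' (x n).-1) n.+1) =
      (P (visits (x' (x n).+1) n.+1) + P (visits (x' (x n).-1) n.+1))%E by exact: measureU.
  rewrite /U PU !PF -muleDr ?ge0_adde_def ?inE ?lee_fin//.
  by rewrite -EFinD jump_prob_sum mule1 subee.
apply: (@le_trans _ _ (P (F (x n).+1) + P (F (x n).-1) + P N)%E).
  apply: (@le_trans _ _ (P (F (x n).+1 `|` F (x n).-1 `|` N))).
    apply: le_measure; rewrite ?inE; [exact: measurableI| |].
      by apply: measurableU; [exact: measurableU|exact: mN].
    move=> w [Ew Vw]; have [Nw|nN] := pselect (N w); [by right|left].
    have : (visits (x' (x n).+1) n.+1 `|` visits (x' (x n).-1) n.+1) w.
      by apply: contrapT => nU; apply: nN.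
    by move=> [?|?]; [left|right].
  rewrite (le_trans (measureU2 _ _ _))// ?leeD2r//; first exact: measurableU.
  exact: measureU2.
rewrite PN adde0; apply: (le_trans (leeD (HF _) (HF _))).
rewrite !PF -muleDr ?ge0_adde_def ?inE ?mule_ge0 ?lee_fin//.
rewrite -muleDr ?ge0_adde_def ?inE ?lee_fin// -EFinD jump_prob_sum mule1.
apply: (@le_trans _ _ ((expR (- b) * C)%:E * (\prod_(i < n) jp (x i) (x i.+1))%:E)%E).
  by rewrite lee_wpmul2l ?probability_visits_le// lee_fin mulr_ge0// expR_ge0.
rewrite -EFinM lee_fin big_split/= /C le_eqVlt; apply/orP; left; apply/eqP; ring.
Qed.

Lemma measure_bigsetU_le (I : Type) (s : seq I) (F : I -> set Omega) :
  (forall i, measurable (F i)) ->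
  (P (\big[setU/set0]_(i <- s) F i) <= \sum_(i <- s) P (F i))%E.
Proof.
move=> mF; elim: s => [|i s IH]; first by rewrite !big_nil measure0.
rewrite !big_cons (le_trans (measureU2 _ _ _))// ?leeD2l//.
exact: bigsetU_measurable.
Qed.

Variables (M : nat) (rho H b : R) (E : nat -> set Omega).
Hypothesis rho_gt0 : 0 < rho.
Hypothesis H_ge0 : 0 <= H.
Hypothesis W_le : forall y, lambda y * rho + mu y / rho + 1 <= h y - W y.
Hypothesis H_ge : forall y, (y <= M)%N -> lambda y * rho + mu y / rho <= H.
Hypothesis mE : forall n, measurable (E n).
Hypothesis EM : forall n w, E n w -> forall i, (i <= n)%N -> (Y i w <= M)%N.
Hypothesis Eb : forall n w, E n w ->
  b <= \sum_(i < n) W (Y i w) * S i w + Num.max 0 (W (Y n w)) * S n w.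

(** Dominates both [rho] and its inverse, so that no case distinction on the side of 1 on which the
    tilt lies is needed. *)
Let rr := Num.max rho rho^-1.
(** Contraction factor: by [W_le] the kernel multiplies the powers of [rho] by at most a / (a + 1)
    with a = lambda rho + mu / rho, and a is at most [H]. *)
Let r := H / (H + 1).
Let k y z := jp y z * (h y / (h y - W y)).

Let mu_ge0 := mu_ge0 mu_gt0 mu0.
Let rr_ge1 : 1 <= rr.
Proof.
rewrite /rr le_max; have [//|r1] := leP 1 rho.
by rewrite orFb invf_ge1// ltW.
Qed.

Let hW_gt0 y : 0 < h y - W y.
Proof. by rewrite subr_gt0. Qed.

Let k_ge0 y z : 0 <= k y z.
Proof. by rewrite mulr_ge0// divr_ge0// ltW. Qed.

Let r_ge0 : 0 <= r.
Proof. by rewrite divr_ge0// addr_ge0. Qed.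

(** An upward jump multiplies [rho ^+ y] by [rho], a downward jump by its inverse, so the full sum
    is (lambda rho + mu / rho) / (h - W) times [rho ^+ y]. Truncation at [M] only drops nonnegative
    terms. *)
Let kernel_sum y : (y <= M)%N -> \sum_(z < M.+1) k y z * rho ^+ z <= r * rho ^+ y.
Proof.
move=> yM.
have step : lambda y * rho + mu y / rho <= r * (h y - W y).
  rewrite (le_trans _ (ler_wpM2l r_ge0 (W_le y)))// /r mulrAC ler_pdivlMr ?ltr_pwDr//.
  by have := H_ge yM; nra.
have hn0 : h y != 0 by rewrite gt_eqF.
have hWn0 : h y - W y != 0 by rewrite gt_eqF.
have rho_n0 : rho != 0 by rewrite gt_eqF.
pose up := lambda y / (h y - W y) * rho ^+ y.+1.
pose down := mu y / (h y - W y) * rho ^+ y.-1.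
have kE z : k y z * rho ^+ z =
    (if z == y.+1 then up else 0) + (if y == z.+1 then down else 0).
  rewrite /k /jump_prob /up /down; case: eqP => [->|_].
    by rewrite ifF ?addr0; [field; rewrite hn0 hWn0|lia].
  rewrite add0r; case: eqP => [yE|_]; last by rewrite !mul0r.
  rewrite (_ : y.-1 = z); last by rewrite yE.
  by field; rewrite hn0 hWn0.
have up_ge0 : 0 <= up by rewrite mulr_ge0 ?divr_ge0 ?exprn_ge0// ltW.
have down_ge0 : 0 <= down by rewrite mulr_ge0 ?divr_ge0 ?exprn_ge0// ltW.
have single (c : R) n i : 0 <= c -> \sum_(z < n) (if z == i :> nat then c else 0) <= c.
  by move=> c0; rewrite -big_mkcond big_ord1_eq; case: ifP.
under eq_bigr do rewrite kE.
rewrite big_split/=.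
apply: (@le_trans _ _ ((lambda y * rho + mu y / rho) * rho ^+ y / (h y - W y))); last first.
  by rewrite ler_pdivrMr// mulrAC ler_wpM2r// exprn_ge0// ltW.
have -> : (lambda y * rho + mu y / rho) * rho ^+ y / (h y - W y) =
    up + (if (0 < y)%N then down else 0).
  rewrite /up /down; case: (y) hWn0 => [|y'] hWn0'.
    by rewrite mu0 mul0r !addr0 expr0 expr1; field; rewrite hWn0'.
  by rewrite /= !exprS; field; rewrite hWn0' rho_n0.
apply: lerD; first exact: single.
case: (y) => [|y'] /=; first by rewrite big1.
by under eq_bigr do rewrite eqSS eq_sym; exact: single.
Qed.

(** Where [W] is positive, [h y - W y] is at least lambda rho + mu / rho, hence at least
    [h y / rr]. *)
Let hold_le y : h y / (h y - Num.max 0 (W y)) <= rr.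
Proof.
have [W0|W0] := leP (W y) 0.
  by rewrite subr0 divff ?gt_eqF.
rewrite ler_pdivrMr//; apply: (@le_trans _ _ (rr * (lambda y * rho + mu y / rho))); last first.
  rewrite ler_pM2l; last by apply: lt_le_trans rr_ge1.
  by rewrite (le_trans _ (W_le y))// lerDl.
have rr1 : 1 <= rr * rho.
  by rewrite -(@mulVf _ rho) ?gt_eqF// (ler_wpM2r (ltW rho_gt0))// le_max lexx orbT.
have rr2 : 1 <= rr / rho.
  by rewrite -[leLHS](@divff _ rho) ?gt_eqF// ler_wpM2r ?invr_ge0 ?(ltW rho_gt0)// le_max lexx.
rewrite (_ : rr * _ = rr * rho * lambda y + rr / rho * mu y); last by ring.
by rewrite /exit_rate lerD// ler_peMl// ltW.
Qed.

(** Trades the weight [rho ^+ z] at the end of a path for [rr ^+ M], which is only exp (O(T)) when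
    [M] is of order T. *)
Let pow_le z : (z <= M)%N -> 1 <= rr ^+ M * rho ^+ z.
Proof.
move=> zM; rewrite -(subnK zM) exprD -mulrA -exprMn.
have rr1 : 1 <= rr * rho.
  by rewrite -(@mulVf _ rho) ?gt_eqF// (ler_wpM2r (ltW rho_gt0))// le_max lexx orbT.
have e1 : 1 <= (rr * rho) ^+ z by rewrite exprn_ege1.
by rewrite (le_trans e1)// ler_peMl ?exprn_ege1// (le_trans _ e1).
Qed.

(** States stay below [M], so the event splits along finitely many paths. Chernoff's bound turns
    each probability into a path weight, and inserting [pow_le] gives the sum contracted by
    [kernel_sum]. *)
Let E_le n : (P (E n) <= (expR (- b) * rr * rr ^+ M * r ^+ n)%:E)%E.
Proof.
pose x (t : n.-tuple 'I_M.+1) i := nth 0%N (0%N :: map val t) i.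
have -> : E n = \big[setU/set0]_(t : n.-tuple 'I_M.+1) (E n `&` visits (x t) n).
  apply/seteqP; split=> [w Ew|w]; last first.
    by rewrite -bigcup_seq => -[t _ []].
  pose t := [tuple inord (Y i.+1 w) | i < n] : n.-tuple 'I_M.+1.
  rewrite -bigcup_seq; exists t => /=; first by rewrite mem_index_enum.
  split=> //; split=> // -[|i] iN; rewrite /x /=; first by rewrite Y0.
  rewrite (nth_map ord0) ?size_tuple ?card_ord//.
  have := tnth_nth ord0 t (Ordinal iN); rewrite tnth_mktuple /= => <-.
  by rewrite inordK// ltnS (EM Ew).
apply: (@le_trans _ _ (\sum_(t : n.-tuple 'I_M.+1) P (E n `&` visits (x t) n))%E).
  by apply: measure_bigsetU_le => t; exact: measurableI.
apply: (@le_trans _ _ (\sum_(t : n.-tuple 'I_M.+1) (expR (- b) * rr * path_weight k 0 (map val t))%:E)%E).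
  apply: lee_sum => t _.
  apply: le_trans (chernoff_visits (b := b) (mE n) _) _.
    move=> w Ew [HY _]; rewrite -HY//.
    under eq_bigr => i _ do rewrite -HY ?(ltnW (ltn_ord i))//.
    exact: Eb.
  rewrite lee_fin -mulrA ler_wpM2l ?expR_ge0// mulrC.
  rewrite path_weightE size_map size_tuple.
  by apply: ler_wpM2r => //; apply: prodr_ge0 => i _; exact: k_ge0.
rewrite sumEFin lee_fin -mulr_sumr -[leRHS]mulrA ler_wpM2l//.
  by rewrite mulr_ge0 ?expR_ge0// (le_trans _ rr_ge1).
apply: (@le_trans _ _ (rr ^+ M * \sum_(t : n.-tuple 'I_M.+1)
    path_weight k 0 (map val t) * rho ^+ (last 0%N (map val t)))).
  rewrite mulr_sumr; apply: ler_sum => t _.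
  rewrite mulrCA ler_peMr//; first by rewrite path_weightE prodr_ge0// => i _; exact: k_ge0.
  apply: pow_le; have := mem_last 0%N (map val t); rewrite in_cons => /predU1P[-> //|].
  by move=> /mapP[z _ ->]; have := ltn_ord z; rewrite ltnS.
rewrite ler_wpM2l ?exprn_ge0 ?(le_trans _ rr_ge1)//.
have := sum_path_weight k_ge0 kernel_sum r_ge0 n (leq0n M).
by rewrite expr0 mulr1.
Qed.

Lemma probability_bigcup_le :
  (P (\bigcup_n E n) <= (expR (- b) * rr * rr ^+ M * (H + 1))%:E)%E.
Proof.
apply: (le_trans (measure_sigma_subadditive _ _ _ (subset_refl _))) => //.
  exact: bigcup_measurable.
set c := expR (- b) * rr * rr ^+ M.
apply: lime_le; first exact: is_cvg_nneseries.
apply: nearW => n.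
apply: (@le_trans _ _ (\sum_(0 <= i < n) (c * r ^+ i)%:E)%E).
  by apply: lee_sum => i _; exact: E_le.
rewrite sumEFin lee_fin -mulr_sumr ler_wpM2l//.
  by rewrite !mulr_ge0 ?expR_ge0 ?exprn_ge0// (le_trans _ rr_ge1).
(* Partial sum plus tail of the geometric series, whose total is 1 / (1 - r) = H + 1. *)
have {}geo : \sum_(0 <= i < n) r ^+ i + r ^+ n * (H + 1) = H + 1.
  elim: n => [|n IH]; first by rewrite big_geq// add0r mul1r.
  rewrite big_nat_recr//= -[RHS]IH -addrA exprSr; congr (_ + _).
  by rewrite /r; field; rewrite gt_eqF// ltr_pwDr.
by rewrite -[leRHS]geo lerDl mulr_ge0 ?exprn_ge0// addr_ge0.
Qed.

End chernoff.

(** * Uniform continuity and primitives *)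

(** Compactness in its near-covering form: a property that holds near each point, jointly for small
    positive [del], holds for one [del] on the whole segment. *)
Lemma uniform_continuity (R : realType) (a b : R) (f : R -> R) (e : R) :
  {within `[a, b]%classic, continuous f} -> 0 < e ->
  exists2 del, 0 < del & forall x y, a <= x <= b -> a <= y <= b ->
    `|x - y| < del -> `|f x - f y| < e.
Proof.
move=> fc e0.
have /compact_near_coveringP := @segment_compact R a b.
pose Q (del x : R) := a <= x <= b -> forall y, a <= y <= b -> `|x - y| < del -> `|f x - f y| < e.
move=> /(_ _ 0^'+ Q (at_right_proper_filter 0)) [].
  move=> x /= xab; have xab' : `[a, b]%classic x by [].
  have /cvgrPdist_lt/(_ (e / 2)) : f @ within `[a, b]%classic (nbhs x) --> f x.
    by move: x {xab} xab'; exact/subspace_continuousP.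
  rewrite divr_gt0// => /(_ isT); rewrite /within/= => -[d0 d00 Hd0].
  exists (ball x (d0 / 2), [set del | 0 < del < d0 / 2]) => /=.
    split; first by apply: nbhsx_ballx; rewrite divr_gt0.
    near=> del; apply/andP; split; near: del; first exact: nbhs_right_gt.
    by apply: nbhs_right_lt; rewrite divr_gt0.
  move=> [x' del] /= [xx' /andP[del0 deld]] x'ab y yab xy.
  have /Hd0 H1 : ball_ (fun x => `|x|) x d0 x'.
    by move: xx'; rewrite /ball/= => /lt_trans; apply; rewrite ltr_pdivrMr//; lra.
  have /Hd0 H2 : ball_ (fun x => `|x|) x d0 y.
    rewrite /ball_/= (_ : x - y = (x - x') + (x' - y)); last by ring.
    by rewrite (le_lt_trans (ler_normD _ _))//; move: xx'; rewrite /ball/=; lra.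
  move: H1 H2; rewrite /= !in_itv/= => /(_ x'ab) H1 /(_ yab) H2.
  rewrite (_ : f x' - f y = (f x - f y) - (f x - f x')); last by ring.
  by rewrite (le_lt_trans (ler_normB _ _))//; lra.
move=> del0 /= del0P Hdel; exists (del0 / 2); first by rewrite divr_gt0.
move=> x y xab yab xy.
apply: (Hdel (del0 / 2)) => //=.
- by rewrite sub0r normrN gtr0_norm ?divr_gt0//; lra.
- by rewrite divr_gt0.
Unshelve. all: by end_near.
Qed.

Lemma powR_uniform_continuity (R : realType) (L M e : R) : 0 < L -> 0 < M -> 0 < e ->
  exists2 del, 0 < del & forall u v, 0 <= u <= M -> 0 <= v <= M ->
    `|u - v| < del -> `|u `^ L - v `^ L| < e.
Proof.
move=> L0 M0 e0; apply: (uniform_continuity (f := fun u => u `^ L)) => //.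
have powR_cont x : 0 < x -> {for x, continuous (fun u : R => u `^ L)}.
  move=> x0; apply: differentiable_continuous; apply/derivable1_diffP.
  by apply: derivable_powR; rewrite in_itv/= x0.
apply/continuous_within_itvP => //; split.
- by move=> x; rewrite in_itv/= => /andP[x0 _]; exact: powR_cont.
- by rewrite powR0 ?gt_eqF//; exact: powR_cvg0.
- by apply: cvg_at_left_filter; exact: powR_cont.
Qed.

Section positive_functions.
Context (R : realType) (f : R -> R).
Hypothesis f_pos : F_pos f.

Lemma F_pos_ge0 t : 0 <= t <= 1 -> 0 <= f t.
Proof.
have [_ f0 fgt] := f_pos; move=> /andP[]; rewrite le_eqVlt => /predU1P[<-|t0] t1.
  by rewrite f0.
by rewrite ltW// fgt// t0.
Qed.

Lemma F_pos_bounded : exists2 M, 0 < M & forall t, 0 <= t <= 1 -> 0 <= f t <= M.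
Proof.
have [fc _ _] := f_pos.
have [c _ fM] := EVT_max (@ler01 R) fc.
exists (`|f c| + 1); first by rewrite ltr_wpDl.
move=> t t01; rewrite F_pos_ge0//= (le_trans (fM _ _)) ?in_itv//.
by rewrite (le_trans (ler_norm _))// lerDl.
Qed.

Variable L : R.
Hypothesis L_gt0 : 0 < L.

Lemma F_pos_powR_continuous : {within `[0, 1]%classic, continuous (fun t => f t `^ L)}.
Proof.
have [fc _ _] := f_pos; have [M M0 fM] := F_pos_bounded.
apply/subspace_continuousP => x /=; rewrite in_itv/= => x01.
apply/cvgrPdist_lt => e e0.
have [del del0 Hdel] := powR_uniform_continuity L_gt0 M0 e0.
have [del' del'0 Hdel'] := uniform_continuity fc del0.
near=> y; apply: Hdel; [exact: fM|apply: fM|apply: Hdel' => //].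
- by near: y; rewrite near_withinE; apply: nearW => y /=; rewrite ?in_itv.
- by near: y; rewrite near_withinE; apply: nearW => y /=; rewrite ?in_itv.
- near: y; rewrite near_withinE; exists del' => //= y.
Unshelve. all: by end_near.
Qed.

Let g t := f t `^ L.

Let g_int a b : 0 <= a -> b <= 1 ->
  lebesgue_measure.-integrable `[a, b]%classic (EFin \o g).
Proof.
move=> a0 b1; apply: (@continuous_compact_integrable R g); first exact: segment_compact.
apply: (continuous_subspaceW _ F_pos_powR_continuous).
by move=> t /=; rewrite !in_itv/= => /andP[at' tb]; rewrite (le_trans a0)//= (le_trans tb).
Qed.

(** All that is used of the integral later: a real-valued primitive whose increments are controlled
    by constant bounds on the integrand. The half-open ranges fit the intervals between jumps. *)
Lemma power_integral_primitive : exists F : R -> R,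
  [/\ power_integral L f = (F 1)%:E, F 0 = 0,
    forall u v c, 0 <= u -> u <= v -> v <= 1 ->
      (forall t, u <= t < v -> f t `^ L <= c) -> F v - F u <= c * (v - u) &
    forall u v c, 0 <= u -> u <= v -> v <= 1 ->
      (forall t, u <= t < v -> c <= f t `^ L) -> c * (v - u) <= F v - F u].
Proof.
pose F t := Rintegral lebesgue_measure `[0, t]%classic g.
have FB u v : 0 <= u -> u <= v -> v <= 1 ->
    F v - F u = Rintegral lebesgue_measure `[u, v[%classic g.
  move=> u0 uv v1; rewrite /F Rintegral_itvB ?bnd_simp//; last exact: g_int.
  rewrite Rintegral_itv_obnd_cbnd; last first.
    apply: integrableS (g_int u0 v1) => //.
    by apply: subset_itv; rewrite bnd_simp.
  rewrite Rintegral_itv_bndo_bndc//.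
  apply: integrableS (g_int u0 v1) => //.
  by apply: subset_itv; rewrite bnd_simp.
have cst_int u v (c : R) : lebesgue_measure.-integrable `[u, v[%classic (EFin \o cst c).
  have : lebesgue_measure.-integrable `[u, v]%classic (EFin \o cst c).
    apply: (@continuous_compact_integrable R (cst c)); first exact: segment_compact.
    by apply: continuous_subspaceT => x; exact: cst_continuous.
  by apply: integrableS => //; apply: subset_itv; rewrite bnd_simp.
have gint u v : 0 <= u -> v <= 1 -> lebesgue_measure.-integrable `[u, v[%classic (EFin \o g).
  move=> u0 v1; apply: integrableS (g_int u0 v1) => //.
  by apply: subset_itv; rewrite bnd_simp.
have cstE u v (c : R) : u <= v -> Rintegral lebesgue_measure `[u, v[%classic (cst c) = c * (v - u).
  move=> uv; rewrite Rintegral_cst//= lebesgue_measure_itv/= lte_fin.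
  by case: ltP => //= vu; rewrite (@le_anti _ _ u v) ?uv// subrr.
exists F; split.
- rewrite /power_integral /F /Rintegral fineK//.
  exact: integrable_fin_num (g_int _ _).
- by rewrite /F set_itv1 Rintegral_set1.
- move=> u v c u0 uv v1 gc; rewrite FB// -cstE//; apply: le_Rintegral; [by []|exact: gint|exact: cst_int|].
  by move=> t /=; rewrite in_itv/= => /gc.
- move=> u v c u0 uv v1 gc; rewrite FB// -cstE//; apply: le_Rintegral; [by []|exact: cst_int|exact: gint|].
  by move=> t /=; rewrite in_itv/= => /gc.
Qed.

End positive_functions.

(** * Trajectories in a tube *)

Section trajectories.
Context (d : measure_display) (Omega : measurableType d) (R : realType).
Context (Y : nat -> Omega -> nat) (S : nat -> Omega -> R).
Context (xi : R -> Omega -> option nat).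
Hypothesis mY : forall n, measurable_fun [set: Omega] (Y n).
Hypothesis mS : forall n, measurable_fun [set: Omega] (S n).
Hypothesis S_gt0 : forall n w, 0 < S n w.
Hypothesis xi_some : forall t w n, jump_time S n w <= t < jump_time S n.+1 w ->
  xi t w = Some (Y n w).
Hypothesis xi_none : forall t w, (forall n, jump_time S n w <= t) -> xi t w = None.

Local Notation J := (jump_time S).

Lemma jump_time0 w : J 0%N w = 0.
Proof. by rewrite /jump_time big_ord0. Qed.

Lemma jump_timeS n w : J n.+1 w = J n w + S n w.
Proof. by rewrite /jump_time big_ord_recr. Qed.

Lemma jump_time_le m n w : (m <= n)%N -> J m w <= J n w.
Proof.
move=> /subnKC <-; elim: (n - m)%N => [|k IH]; first by rewrite addn0.
by rewrite addnS jump_timeS (le_trans IH)// lerDl ltW.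
Qed.

Lemma measurable_jump_time n : measurable_fun [set: Omega] (J n).
Proof. by apply: measurable_sum => i; exact: mS. Qed.

Lemma measurable_in_jump n s : measurable [set w | J n w <= s < J n.+1 w].
Proof.
rewrite (_ : [set w | _] = J n @^-1` `]-oo, s] `&` J n.+1 @^-1` `]s, +oo[); last first.
  by apply/seteqP; split=> w /=; rewrite !in_itv/= andbT => /andP.
by apply: measurableI; rewrite -[X in measurable X]setTI;
  apply: measurable_jump_time => //; exact: measurable_itv.
Qed.

Lemma scaled_some T t n w : J n w <= t * T < J n.+1 w ->
  scaled xi T t w = ((Y n w)%:R / T)%:E.
Proof. by move=> /xi_some; rewrite /scaled => ->. Qed.

Lemma in_jump_exists s w : 0 <= s -> ~ (forall n, J n w <= s) ->
  exists n, J n w <= s < J n.+1 w.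
Proof.
move=> s0 /existsNP[n /negP]; rewrite -ltNge => sn.
have [|i _ Ji] := @jump_time_index _ _ _ S w 0 n s (leq0n n); first by rewrite jump_time0 s0.
by exists i.
Qed.

Variable T : R.
Hypothesis T_gt0 : 0 < T.

(** The witness is the scaled path itself, constant between jumps. A bound by [c < eps] at all times
    is what keeps the supremum strictly below [eps]. *)
Lemma traj_in_of_covered (f : R -> R) eps c w : c < eps ->
  (forall s, 0 <= s <= T ->
     exists i, J i w <= s < J i.+1 w /\ `|f (s / T) - (Y i w)%:R / T| <= c) ->
  traj_in (scaled xi T) (U_eps eps f) w.
Proof.
move=> ceps cov; pose g t := fine (scaled xi T t w).
have tT t : 0 <= t <= 1 -> 0 <= t * T <= T.
  by move=> /andP[? ?]; rewrite mulr_ge0 ?(ltW T_gt0)//= ler_piMl// ltW.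
have gE t n : J n w <= t * T < J n.+1 w -> g t = (Y n w)%:R / T.
  by move=> /scaled_some; rewrite /g => ->.
exists g; last first.
  move=> t /tT /cov[i [Ji _]]; by rewrite (gE _ _ Ji) (scaled_some Ji).
split; last first.
  apply: (@le_lt_trans _ _ c%:E); last by rewrite lte_fin.
  apply: ge_ereal_sup => _ [t + <-]; rewrite /= in_itv/= => /tT /cov[i [Ji]].
  by rewrite mulfK ?gt_eqF// (gE _ _ Ji) lee_fin.
split=> t /andP[t0 t1].
- have /tT/cov[i [Ji _]] : 0 <= t <= 1 by rewrite t0 ltW.
  rewrite (gE _ _ Ji); case/andP: Ji => Ja Jb.
  have tJ : t < J i.+1 w / T by rewrite ltr_pdivlMr.
  apply: cvg_near_cst; near=> x; apply: gE; apply/andP; split.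
    by rewrite (le_trans Ja)// ler_wpM2r ?(ltW T_gt0)//; near: x; exact: nbhs_right_ge.
  by rewrite -ltr_pdivlMr//; near: x; exact: nbhs_right_lt.
- have /tT/cov[i [Ji _]] : 0 <= t <= 1 by rewrite (ltW t0).
  (* For the left limit the holding interval is closed on the right: it is the preceding one when
     [t * T] is a jump time. *)
  have [k [Jk1 Jk2]] : exists k, J k w < t * T /\ t * T <= J k.+1 w.
    case/andP: Ji => Ja Jb; have [Jlt|Jge] := ltP (J i w) (t * T).
      by exists i; rewrite Jlt (ltW Jb).
    case: i Ja Jb Jge => [|i] Ja Jb Jge.
      by move: Jge; rewrite jump_time0 leNgt mulr_gt0.
    exists i; split=> //; apply: lt_le_trans Ja.
    by rewrite jump_timeS ltrDl.
  have kt : J k w / T < t by rewrite ltr_pdivrMr.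
  exists ((Y k w)%:R / T); apply: cvg_near_cst; near=> x; apply: gE; apply/andP; split.
    by rewrite -ler_pdivrMr// ltW//; near: x; exact: nbhs_left_gt.
  rewrite (lt_le_trans _ Jk2)// ltr_pM2r//; near: x; exact: nbhs_left_lt.
Unshelve. all: by end_near.
Qed.

Section characterization.
Variables (f : R -> R) (eps : R).
Hypothesis f_cont : {within `[0, 1]%classic, continuous f}.

(** The constant [c] is the uniform distance itself. The first claim is the absence of explosion:
    the state infinity at time [T] would scale to [+oo], which is no value of a real function. *)
Lemma traj_in_jump w : traj_in (scaled xi T) (U_eps eps f) w ->
  (exists n, J n w <= T < J n.+1 w) /\
  exists2 c, c < eps & forall t n, 0 <= t <= 1 -> J n w <= t * T < J n.+1 w ->
    `|f t - (Y n w)%:R / T| <= c.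
Proof.
move=> [g [Dg rhog] Xg]; split.
  apply: in_jump_exists; first exact: ltW.
  have h01 : (0 : R) <= (1 : R) <= 1 by rewrite ler01 lexx.
  have := Xg _ h01; rewrite /scaled mul1r => X1 /xi_none xiN.
  by move: X1; rewrite xiN /= gt0_mulye// lte_fin invr_gt0.
have rho_ge t : 0 <= t <= 1 -> (`|f t - g t|%:E <= rho f g)%E.
  by move=> t01; apply: ereal_sup_ubound; exists t => //; rewrite /= in_itv.
have rho_fin : rho f g \is a fin_num.
  rewrite fin_real// (lt_trans rhog) ?ltry// andbT.
  apply: lt_le_trans (rho_ge 0 _); first exact: ltNyr.
  by rewrite lexx ler01.
exists (fine (rho f g)); first by rewrite -lte_fin fineK.
move=> t n t01 Jn; have := rho_ge t t01; rewrite -[X in (_ <= X)%E]fineK// lee_fin.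
by have := Xg t t01; rewrite (scaled_some Jn) => -[->].
Qed.

Lemma jump_traj_in c w : c < eps -> (exists n, J n w <= T < J n.+1 w) ->
  (forall (q : rat) n, 0 <= (ratr q : R) <= 1 -> J n w <= ratr q * T < J n.+1 w ->
    `|f (ratr q) - (Y n w)%:R / T| <= c) ->
  traj_in (scaled xi T) (U_eps eps f) w.
Proof.
move=> ceps [N /andP[N1 N2]] fc; apply: (traj_in_of_covered ceps) => s /andP[s0 sT].
have [|i _ Ji] := @jump_time_index _ _ _ S w 0%N N.+1 s (leq0n _).
  by rewrite jump_time0 s0 (le_lt_trans sT).
exists i; split=> //.
(* The end point 1 has no rational on its right inside the interval, but is itself rational. *)
have [s1|s1] := eqVneq s T.
  have := Ji; rewrite s1 => Ji'.
  have := fc 1 i; rewrite rmorph1 ler01 /= mul1r => /(_ (lexx _) Ji').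
  by rewrite divff ?gt_eqF.
have sT' : s < T by rewrite lt_neqAle s1.
set t := s / T.
have t01 : 0 <= t < 1 by rewrite divr_ge0 ?(ltW T_gt0)//= ltr_pdivrMr// mul1r.
apply/ler_addgt0Pr => e e0.
have [del del0 fdel] : exists2 del, 0 < del & forall x, t <= x <= 1 -> x < t + del ->
    `|f x - f t| <= e.
  have [del del0 Hdel] := uniform_continuity f_cont e0.
  exists del => // x /andP[tx x1] xt; rewrite ltW// Hdel//.
  - by rewrite x1 (le_trans _ tx)//; case/andP: t01.
  - by case/andP: t01 => -> /ltW ->.
  - by rewrite ger0_norm ?subr_ge0//; lra.
have [Ja Jb] := andP Ji.
(* A rational just after [t] is taken before 1, before [f] has moved by more than [e], and before
   the next jump, so that the state is the same at both times. *)
have tm : t < Num.min 1 (Num.min (t + del) (J i.+1 w / T)).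
  rewrite !lt_min; case/andP: t01 => _ ->; rewrite ltrDl del0/=.
  by rewrite ltr_pM2r ?invr_gt0.
have [q] := rat_in_itvoo tm; rewrite in_itv/= !lt_min => /andP[tq /and3P[q1 qdel qJ]].
have [t0 t1] := andP t01.
have q01 : 0 <= (ratr q : R) <= 1 by rewrite (le_trans t0 (ltW tq)) ltW.
have := fc q i q01; rewrite -ltr_pdivlMr// qJ andbT.
rewrite (le_trans Ja); last by rewrite -ler_pdivrMr// ltW.
move=> /(_ isT) fq.
have := fdel (ratr q); rewrite (ltW tq) (ltW q1) => /(_ isT qdel).
move: fq; rewrite (distrC (f (ratr q)) (f t)) => H1 H2.
rewrite (_ : f t - _ = (f (ratr q) - (Y i w)%:R / T) + (f t - f (ratr q))); last by ring.
by rewrite (le_trans (ler_normD _ _))// lerD.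
Qed.

(* By right continuity the tube condition need only be tested at rational times. *)
Lemma measurable_traj_in : measurable (traj_in (scaled xi T) (U_eps eps f)).
Proof.
pose close c (q : rat) n := [set w | J n w <= ratr q * T < J n.+1 w]%classic `&`
   [set w | c < `|f (ratr q) - (Y n w)%:R / T|].
have mclose c q n : measurable (close c q n).
  apply: measurableI; first exact: measurable_in_jump.
  have := mY n measurableT (I : measurable [set y | c < `|f (ratr q) - y%:R / T|]).
  by rewrite setTI.
(* The m-th rational, in the enumeration given by [unpickle], violates the tube of radius [c]. The
   radii [eps - k.+1%:R^-1] express that the supremum is strictly below [eps]. *)
pose bad c m := if @unpickle rat m is Some q then
   if 0 <= (ratr q : R) <= 1 then \bigcup_n close c q n else set0 else set0.
have -> : traj_in (scaled xi T) (U_eps eps f) =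
    (\bigcup_n [set w | J n w <= T < J n.+1 w]) `&`
    \bigcup_k ~` (\bigcup_m bad (eps - k.+1%:R^-1) m).
  apply/seteqP; split=> [w /traj_in_jump[[n Jn] [c ceps fc]]|w [[n _ Jn] [k _ Hk]]].
    split; first by exists n.
    have [k kP] : exists k : nat, c <= eps - k.+1%:R^-1.
      exists (Num.truncn (eps - c)^-1); rewrite lerBrDl -lerBrDr.
      rewrite invf_ple ?posrE ?subr_gt0 ?ltr0n// ltW// truncnS_gt//.
    exists k => // -[m _]; rewrite /bad; case: unpickle => // q; case: ifP => // q01.
    by move=> [i _ [/= Ji]]; rewrite ltNge (le_trans (fc _ _ q01 Ji)).
  apply: (@jump_traj_in (eps - k.+1%:R^-1)); last first.
  - move=> q i q01 Ji; rewrite leNgt; apply/negP => close_q; apply: Hk.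
    exists (pickle q); first exact: I.
    rewrite /bad (pickleK q) q01; exists i; first exact: I.
    by split.
  - by exists n.
  - by rewrite ltrBlDr ltrDl invr_gt0.
apply: measurableI.
  by apply: bigcupT_measurable => n; exact: measurable_in_jump.
apply: bigcupT_measurable => k; apply: measurableC; apply: bigcupT_measurable => m.
rewrite /bad; case: unpickle => // q; case: ifP => // _.
by apply: bigcupT_measurable => n; exact: mclose.
Qed.

End characterization.

End trajectories.

(** * From exponential bounds to the local large deviation principle *)

Lemma limf_bounds (R : realType) (u : R -> \bar R) (a b : \bar R) :
  (\forall T \near +oo, (a <= u T <= b)%E) ->
  (a <= limf_esup u (pinfty_nbhs R) <= b)%E /\ (a <= limf_einf u (pinfty_nbhs R) <= b)%E.
Proof.
move=> uab; rewrite limf_esupE limf_einfE.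
have near_ex (V : set R) : pinfty_nbhs R V -> exists2 T, V T & (a <= u T <= b)%E.
  move=> HV; have /filter_ex[T [VT uT]] : pinfty_nbhs R (V `&` [set T | (a <= u T <= b)%E]).
    exact: filterI.
  by exists T.
split; apply/andP; split.
- apply: le_ereal_inf_tmp => _ [V HV <-].
  have [T VT /andP[aT _]] := near_ex V HV.
  by apply: le_trans aT _; apply: ereal_sup_ubound; exists T.
- apply: ereal_inf_le; exists (ereal_sup (u @` [set T | (a <= u T <= b)%E])); first by exists [set T | (a <= u T <= b)%E].
  by apply: ge_ereal_sup => _ [T /andP[_ Tb] <-].
- apply: ereal_sup_ge; exists (ereal_inf (u @` [set T | (a <= u T <= b)%E])); first by exists [set T | (a <= u T <= b)%E].
  by apply: le_ereal_inf_tmp => _ [T /andP[Ta _] <-].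
- apply: ge_ereal_sup => _ [V HV <-].
  have [T VT /andP[_ Tb]] := near_ex V HV.
  by apply: le_trans _ Tb; apply: ereal_inf_lbound; exists T.
Qed.

(** Only the upper bound needs a narrow tube, depending on [delta]; the lower bound holds in every
    tube, being produced by paths that follow [f] as closely as desired. *)
Lemma local_ldp_bounds (d : measure_display) (Omega : measurableType d) (R : realType)
    (P : probability Omega R) (X : R -> R -> Omega -> \bar R) (F : set (R -> R))
    (psi : R -> R) (I : (R -> R) -> R) :
  (forall T, 0 < T -> 0 < psi T) ->
  (forall f delta, F f -> 0 < delta ->
    exists2 eps0, 0 < eps0 & forall eps, 0 < eps < eps0 -> \forall T \near +oo,
      (P (traj_in (X T) (U_eps eps f)) <= (expR (- (psi T * (I f - delta))))%:E)%E) ->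
  (forall f eps delta, F f -> 0 < eps -> 0 < delta -> \forall T \near +oo,
      ((expR (- (psi T * (I f + delta))))%:E <= P (traj_in (X T) (U_eps eps f)))%E) ->
  local_ldp P X F psi (fun f => (I f)%:E).
Proof.
move=> psi_gt0 upper lower f Ff.
have bounds delta : 0 < delta -> \forall eps \near 0^'+,
    (((- I f - delta)%:E <= limf_esup (log_prob P X psi f eps) (pinfty_nbhs R) <= (- I f + delta)%:E) /\
    ((- I f - delta)%:E <= limf_einf (log_prob P X psi f eps) (pinfty_nbhs R) <= (- I f + delta)%:E))%E.
  move=> delta0; have [eps0 eps00 up] := upper f delta Ff delta0.
  near=> eps; apply: limf_bounds.
  have eps_gt0 : 0 < eps by near: eps; exact: nbhs_right_gt.
  have eps_lt : eps < eps0 by near: eps; exact: nbhs_right_lt.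
  near=> T.
  have T0 : 0 < T by near: T; exact: nbhs_pinfty_gt.
  have psi0 := psi_gt0 T T0.
  have ne x : ((- (psi T * x))%:E = lne (expR (- (psi T * x)))%:E)%E.
    by rewrite lne_EFin ?expR_gt0// expRK.
  have scaleE x : ((- x)%:E = (psi T)^-1%:E * (- (psi T * x))%:E)%E.
    by rewrite -EFinM mulrN mulKf// gt_eqF.
  rewrite /log_prob; apply/andP; split.
    rewrite -opprD scaleE lee_wpmul2l ?lee_fin ?invr_ge0 ?(ltW psi0)// ne lee_lne.
    - by near: T; exact: lower.
    - by rewrite in_itv/= leey lee_fin expR_ge0.
    - by rewrite in_itv/= leey measure_ge0.
  rewrite addrC -opprB scaleE lee_wpmul2l ?lee_fin ?invr_ge0 ?(ltW psi0)// ne lee_lne.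
  - by near: T; apply: up; rewrite eps_gt0.
  - by rewrite in_itv/= leey measure_ge0.
  - by rewrite in_itv/= leey lee_fin expR_ge0.
have cvg_of (v : R -> \bar R) : (forall delta, 0 < delta -> \forall eps \near 0^'+,
    ((- I f - delta)%:E <= v eps <= (- I f + delta)%:E)%E) ->
    v eps @[eps --> 0^'+] --> (- (I f)%:E)%E.
  move=> vb; rewrite -EFinN; apply/fine_cvgP; split.
    near=> eps; have /andP[va vc] : ((- I f - 1)%:E <= v eps <= (- I f + 1)%:E)%E.
      by near: eps; exact: vb.
    by rewrite fin_real// (lt_le_trans _ va) ?ltNyr//= (le_lt_trans vc) ?ltry.
  apply/cvgrPdist_le => e e0; near=> eps.
  have /andP[] : ((- I f - e)%:E <= v eps <= (- I f + e)%:E)%E by near: eps; exact: vb.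
  rewrite /=; case: (v eps) => [r| |]//=; rewrite !lee_fin => ra rb.
  by rewrite ler_norml; apply/andP; split; lra.
by split; apply: cvg_of => delta /bounds; apply: filterS => eps [].
Unshelve. all: by end_near.
Qed.

(** * Upper bound *)

Lemma near_powR_ge (R : realType) (L c : R) : 0 < L -> \forall T \near +oo, c <= T `^ L.
Proof.
move=> L0; near=> T.
have T0 : (`|c| + 1) `^ L^-1 <= T by near: T; exact: (nbhs_pinfty_ge (num_real _)).
apply: (@le_trans _ _ (((`|c| + 1) `^ L^-1) `^ L)).
  rewrite -powRrM mulVf ?gt_eqF// powRr1 ?addr_ge0//.
  by rewrite (le_trans (ler_norm _))// lerDl.
by apply: ge0_ler_powR; rewrite ?nnegrE ?(ltW L0) ?powR_ge0// (le_trans _ T0)// powR_ge0.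
Unshelve. all: by end_near.
Qed.

(** Absorbs everything in the exponents that is of lower order than T^(L + 1). *)
Lemma near_linear_le (R : realType) (L a1 a2 a3 e : R) : 0 < L -> 0 < e ->
  \forall T \near +oo, a1 + a2 * T + a3 * T `^ L <= e * (T * T `^ L).
Proof.
move=> L0 e0; near=> T.
have T1 : 1 <= T by near: T; exact: (nbhs_pinfty_ge (num_real _)).
have T2 : 2 * `|a3| / e <= T by near: T; exact: (nbhs_pinfty_ge (num_real _)).
have T3 : 2 * (`|a1| + `|a2|) / e <= T `^ L by near: T; exact: near_powR_ge.
have p0 : 0 <= T `^ L by exact: powR_ge0.
move: (T `^ L) p0 T3 => p p0; move: T2; rewrite !ler_pdivrMr// => T2 T3.
have := ler_norm a1; have := ler_norm a2; have := ler_norm a3.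
have := normr_ge0 a1; have := normr_ge0 a2; have := normr_ge0 a3.
move: `|a1| `|a2| `|a3| T2 T3 => b1 b2 b3 T2 T3 b30 b20 b10 ab3 ab2 ab1.
have H1 : a1 + a2 * T <= (b1 + b2) * T by nra.
have H2 : a3 * p <= b3 * p by nra.
have H3 : 2 * ((b1 + b2) * T) <= e * (T * p) by nra.
have H4 : 2 * (b3 * p) <= e * (T * p) by nra.
by lra.
Unshelve. all: by end_near.
Qed.

Section upper.
Context (d : measure_display) (Omega : measurableType d) (R : realType).
Context (P : probability Omega R) (lambda mu : nat -> R).
Context (Y : nat -> Omega -> nat) (S : nat -> Omega -> R).
Context (xi : R -> Omega -> option nat).
Hypothesis mY : forall n, measurable_fun [set: Omega] (Y n).
Hypothesis mS : forall n, measurable_fun [set: Omega] (S n).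
Hypothesis Y0 : forall w, Y 0%N w = 0%N.
Hypothesis S_gt0 : forall n w, 0 < S n w.
Hypothesis law : forall (n : nat) (x : nat -> nat) (B : nat -> set R) (y : nat),
  (forall i, measurable (B i)) ->
  P (history Y S x B n `&` [set w | B n (S n w) /\ Y n.+1 w = y]) =
  (P (history Y S x B n) * exponential_prob (exit_rate lambda mu (x n)) (B n)
    * (jump_prob lambda mu (x n) y)%:E)%E.
Hypothesis xi_some : forall t w n, jump_time S n w <= t < jump_time S n.+1 w ->
  xi t w = Some (Y n w).
Hypothesis xi_none : forall t w, (forall n, jump_time S n w <= t) -> xi t w = None.
Hypothesis lambda_gt0 : forall x, 0 < lambda x.
Hypothesis mu_gt0 : forall x, (0 < x)%N -> 0 < mu x.
Hypothesis mu0 : mu 0%N = 0.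
Local Notation h := (exit_rate lambda mu).
Local Notation J := (jump_time S).

Variables (L C H0 : R).
Hypothesis L_gt0 : 0 < L.
Hypothesis C_gt0 : 0 < C.
(** Each [b] below the rate has its own tilt, since the infimum over [rho] need not be attained. The
    constant [K0] pays for the added 1 and for the small states. *)
Hypothesis tilt : forall b, b < C -> exists2 rho, 0 < rho & exists K0, forall y,
  lambda y * rho + mu y / rho + 1 <= h y - (b * y%:R `^ L - K0).
Hypothesis growth : forall y, h y <= H0 * (y%:R `^ L + 1).
Variable f : R -> R.
Hypothesis f_pos : F_pos f.

Section work.
Variables (F : R -> R) (T eps eta b K0 c : R).
Hypothesis F0 : F 0 = 0.
Hypothesis F_le : forall u v c, 0 <= u -> u <= v -> v <= 1 ->
  (forall t, u <= t < v -> f t `^ L <= c) -> F v - F u <= c * (v - u).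
Hypothesis T_gt0 : 0 < T.
Hypothesis b_ge0 : 0 <= b.
Hypothesis c_lt : c < eps.
Hypothesis eta_unif : forall t y, 0 <= t <= 1 -> `|f t - y%:R / T| < eps ->
  f t `^ L <= (y%:R / T) `^ L + eta.

Let W (y : nat) := b * y%:R `^ L - K0.
(** Lower bound for the integral of [W] along the path up to time [v * T]: on that piece the path
    follows [f], up to the error [eta] in the L-th power. *)
Let Psi v := T * T `^ L * b * (F v - eta * v) - K0 * T * v.

(** While the chain sits in [y], [f] is close to [y / T], and T^L (y / T)^L = y^L turns the bound on
    [f] into one on [W y]. *)
Lemma tilted_action_step y u v : 0 <= u -> u <= v -> v <= 1 ->
  (forall t, u <= t < v -> `|f t - y%:R / T| <= c) -> Psi v - Psi u <= W y * (T * (v - u)).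
Proof.
move=> u0 uv v1 fy.
have Fuv : F v - F u <= ((y%:R / T) `^ L + eta) * (v - u).
  apply: F_le => // t /[dup] tuv /andP[ut tv]; apply: eta_unif.
    by rewrite (le_trans u0)//= (le_trans (ltW tv)).
  by rewrite (le_lt_trans (fy _ _)).
have TL : T `^ L * (y%:R / T) `^ L = y%:R `^ L.
  by rewrite -powRM ?divr_ge0 ?(ltW T_gt0)// mulrCA divff ?gt_eqF// mulr1.
have A0 : 0 <= T * T `^ L * b by rewrite !mulr_ge0 ?powR_ge0// ltW.
rewrite /W -TL.
have := ler_wpM2l A0 Fuv.
rewrite /Psi; move: (T `^ L) ((y%:R / T) `^ L) => p q; lra.
Qed.

(** [Psi] telescopes over the holding intervals. The last one is cut at [T]; replacing [W] by its
    positive part allows the whole of [S n] to be used instead. *)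
Lemma tilted_action n w : J n w <= T < J n.+1 w ->
  (forall t i, 0 <= t <= 1 -> J i w <= t * T < J i.+1 w -> `|f t - (Y i w)%:R / T| <= c) ->
  Psi 1 <= \sum_(i < n) W (Y i w) * S i w + Num.max 0 (W (Y n w)) * S n w.
Proof.
move=> /andP[JnT TJn] fc.
have Psi0 : Psi 0 = 0 by rewrite /Psi F0 !mulr0 subrr mulr0 subrr.
have divT x : x / T * T = x by rewrite divfK// gt_eqF.
have close k u v : (k <= n)%N -> u = J k w / T -> v * T <= J k.+1 w -> v <= 1 ->
    forall t, u <= t < v -> `|f t - (Y k w)%:R / T| <= c.
  move=> kn -> vJ v1 t /andP[ut tv]; apply: fc.
    rewrite (le_trans _ ut)/= ?(le_trans (ltW tv))// divr_ge0 ?(ltW T_gt0)//.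
    by rewrite -(jump_time0 S w) (jump_time_le S_gt0).
  by rewrite -ler_pdivrMr// ut /= (lt_le_trans _ vJ)// ltr_pM2r.
have partial k : (k <= n)%N -> Psi (J k w / T) <= \sum_(i < k) W (Y i w) * S i w.
  elim: k => [|k IH] kn; first by rewrite big_ord0 jump_time0 mul0r Psi0.
  have Jk1 : J k.+1 w <= T by rewrite (le_trans _ JnT)// (jump_time_le S_gt0).
  have Jk0 : 0 <= J k w by rewrite -(jump_time0 S w) (jump_time_le S_gt0).
  have Jkk : J k w <= J k.+1 w by rewrite (jump_time_le S_gt0).
  have := @tilted_action_step (Y k w) (J k w / T) (J k.+1 w / T) _ _ _ _.
  rewrite divr_ge0 ?(ltW T_gt0)// ler_pM2r ?invr_gt0// Jkk ler_pdivrMr// mul1r Jk1.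
  move=> /(_ isT isT isT); rewrite big_ord_recr/=.
  have -> : T * (J k.+1 w / T - J k w / T) = S k w.
    by rewrite jump_timeS; field; rewrite gt_eqF.
  move=> /(_ (close k _ _ (ltnW kn) erefl _ _)).
  rewrite divT lexx ler_pdivrMr// mul1r Jk1 => /(_ isT isT).
  by have := IH (ltnW kn); lra.
have Jn0 : 0 <= J n w by rewrite -(jump_time0 S w) (jump_time_le S_gt0).
have := @tilted_action_step (Y n w) (J n w / T) 1 _ _ _ _.
rewrite divr_ge0 ?(ltW T_gt0)// ler_pdivrMr// mul1r JnT lexx.
move=> /(_ isT isT isT (close n _ _ (leqnn n) erefl _ _)).
rewrite mul1r lexx (ltW TJn) => /(_ isT isT).
have -> : T * (1 - J n w / T) = T - J n w by field; rewrite gt_eqF.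
have := partial n (leqnn n).
have : W (Y n w) * (T - J n w) <= Num.max 0 (W (Y n w)) * S n w.
  apply: (@le_trans _ _ (Num.max 0 (W (Y n w)) * (T - J n w))).
    by rewrite ler_wpM2r ?subr_ge0// le_max lexx orbT.
  rewrite ler_wpM2l ?le_max ?lexx//.
  by move: TJn; rewrite jump_timeS; lra.
by lra.
Qed.

End work.

Theorem traj_in_upper (F : R -> R) (delta : R) : 0 < delta -> F 0 = 0 ->
  (forall u v c, 0 <= u -> u <= v -> v <= 1 ->
    (forall t, u <= t < v -> f t `^ L <= c) -> F v - F u <= c * (v - u)) ->
  0 <= F 1 ->
  exists2 eps0, 0 < eps0 & forall eps, 0 < eps < eps0 -> \forall T \near +oo,
    (P (traj_in (scaled xi T) (U_eps eps f)) <=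
     (expR (- (T `^ (L + 1) * (C * F 1 - delta))))%:E)%E.
Proof.
move=> delta0 F0 F_le F1.
(* The slack [delta] is split: a quarter for taking [b] below [C], a quarter for [eta], and a half
   for the terms of lower order. *)
pose b := Num.max 0 (C - delta / (4 * (F 1 + 1))).
have F11 : 0 < F 1 + 1 by rewrite ltr_wpDl.
have bC : b < C.
  by rewrite gt_max C_gt0/= ltrBlDr ltrDl divr_gt0// mulr_gt0.
have b0 : 0 <= b by rewrite le_max lexx.
have bF : (C - b) * F 1 <= delta / 4.
  have Cb : C - b <= delta / (4 * (F 1 + 1)).
    by rewrite lerBlDl -lerBlDr /b le_max lexx orbT.
  apply: (@le_trans _ _ (delta / (4 * (F 1 + 1)) * (F 1 + 1))).
    by apply: ler_pM => //; [lra|rewrite lerDl].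
  by rewrite le_eqVlt; apply/orP; left; apply/eqP; field; rewrite gt_eqF.
have [rho rho0 [K0 tiltb]] := tilt bC.
pose eta := delta / (4 * (C + 1)).
have C1 : 0 < C + 1 by rewrite addr_gt0.
have eta0 : 0 < eta by rewrite divr_gt0// mulr_gt0.
have beta : b * eta <= delta / 4.
  apply: (@le_trans _ _ ((C + 1) * eta)).
    by rewrite ler_wpM2r ?(ltW eta0)// (le_trans (ltW bC))// lerDl.
  by rewrite le_eqVlt; apply/orP; left; apply/eqP; rewrite /eta; field; rewrite gt_eqF.
have [M M0 fM] := F_pos_bounded f_pos.
have M10 : 0 < M + 1 by rewrite addr_gt0.
have [del del0 Hdel] := powR_uniform_continuity L_gt0 M10 eta0.
exists (Num.min del 1); first by rewrite lt_min del0/=.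
move=> eps /andP[eps0]; rewrite lt_min => /andP[epsdel eps1].
have [fc _ _] := f_pos.
pose W (y : nat) := b * y%:R `^ L - K0.
pose rr := Num.max rho rho^-1.
have rr1 : 1 <= rr.
  by rewrite le_max; have [//|r1] := leP 1 rho; rewrite orFb invf_ge1// ltW.
have rr0 : 0 < rr by apply: lt_le_trans rr1.
have H00 : 0 <= H0.
  have := growth 1; rewrite powR1 => h1; have := exit_rate_gt0 lambda_gt0 mu_gt0 mu0 1.
  by move: (h 1) h1 => x h1 x0; lra.
near=> T.
have T_gt0 : 0 < T by near: T; exact: (nbhs_pinfty_gt (num_real _)).
(* The index [n] is the number of jumps made up to time [T]. *)
pose E n := traj_in (scaled xi T) (U_eps eps f) `&` [set w | J n w <= T < J n.+1 w].
have mE n : measurable (E n).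
  apply: measurableI; last exact: measurable_in_jump.
  exact: (measurable_traj_in mY mS S_gt0 xi_some xi_none).
have trajE : traj_in (scaled xi T) (U_eps eps f) = \bigcup_n E n.
  apply/seteqP; split=> [w tw|w [n _ []]//].
  by have [[n Jn] _] := traj_in_jump xi_some xi_none T_gt0 tw; exists n.
pose Mn := Num.truncn (T * (M + 1)).
have TM0 : 0 <= T * (M + 1) by rewrite mulr_ge0 ?ltW.
have near_f t y : 0 <= t <= 1 -> `|f t - y%:R / T| < eps -> y%:R / T <= M + 1.
  move=> t01 fy; have /andP[_ ftM] := fM t t01.
  by move: fy; rewrite ltr_norml => /andP[fy _]; lra.
pose B := T * T `^ L * b * (F 1 - eta * 1) - K0 * T * 1.
(* A bound for lambda rho + mu / rho on the states inside the tube. It is O(T^L), so even the crude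
   estimate of [H + 1] by [expR H] below costs nothing on the scale T^(L + 1). *)
pose H := rr * (H0 * ((T * (M + 1)) `^ L + 1)).
have H_ge0 : 0 <= H by rewrite !mulr_ge0 ?(ltW rr0) ?addr_ge0 ?powR_ge0.
have := @probability_bigcup_le _ _ _ P lambda mu Y S mY mS Y0 law lambda_gt0 mu_gt0 mu0
  W _ Mn rho H B E rho0 H_ge0.
rewrite -trajE.
have W_le y : lambda y * rho + mu y / rho + 1 <= h y - W y by exact: tiltb.
have W_lt y : W y < h y.
  have := W_le y; have := lambda_gt0 y; have := mu_ge0 mu_gt0 mu0 y.
  move=> m0 l0; have : 0 <= lambda y * rho + mu y / rho.
    by rewrite addr_ge0// ?mulr_ge0 ?invr_ge0// ltW.
  by lra.
move=> /(_ W_lt W_le) main.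
apply: (le_trans (main _ mE _ _)).
- move=> y yM; apply: (@le_trans _ _ (rr * h y)).
    rewrite /exit_rate mulrDr; apply: lerD; rewrite mulrC.
      by apply: ler_wpM2r; [exact: ltW|rewrite le_max lexx].
    by apply: ler_wpM2r; [exact: mu_ge0|rewrite le_max lexx orbT].
  rewrite ler_pM2l// (le_trans (growth y))// ler_wpM2l// lerD2r.
  apply: ge0_ler_powR; rewrite ?nnegrE ?(ltW L_gt0)//.
  by rewrite -truncn_ge_nat.
- move=> n w [tw Jn] i iN.
  have [_ [c ceps fc']] := traj_in_jump xi_some xi_none T_gt0 tw.
  rewrite truncn_ge_nat// mulrC -ler_pdivrMr//.
  have JiT : J i w <= T by rewrite (le_trans (jump_time_le S_gt0 w iN))//; case/andP: Jn.
  have Ji0 : 0 <= J i w by rewrite -(jump_time0 S w) (jump_time_le S_gt0).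
  have t01 : 0 <= J i w / T <= 1 by rewrite divr_ge0 ?(ltW T_gt0)//= ler_pdivrMr// mul1r.
  apply: (near_f _ _ t01); apply: le_lt_trans ceps; apply: fc' => //.
  by rewrite divfK ?gt_eqF// lexx jump_timeS ltrDl S_gt0.
- move=> n w [tw Jn].
  have [_ [c ceps fc']] := traj_in_jump xi_some xi_none T_gt0 tw.
  apply: (@tilted_action F T eps eta b K0 c) => //.
  move=> t y t01 fy; have /andP[ft0 ftM] := fM t t01.
  have := Hdel (f t) (y%:R / T).
  rewrite ft0 (le_trans ftM) ?lerDl// divr_ge0 ?(ltW T_gt0)// (near_f t)//.
  move=> /(_ isT isT (lt_trans fy epsdel)).
  by rewrite ltr_norml => /andP[_]; rewrite ltrBlDl => /ltW.
rewrite lee_fin -/rr.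
have rrM : rr ^+ Mn <= expR (ln rr * (T * (M + 1))).
  rewrite -[X in X ^+ _](lnK rr0) -expRM_natr ler_expR ler_wpM2l ?ln_ge0//.
  by rewrite -truncn_ge_nat.
have rrE : rr = expR (ln rr) by rewrite lnK.
have H1 : H + 1 <= expR H by rewrite addrC expR_ge1Dx.
apply: (@le_trans _ _ (expR (- B) * expR (ln rr) * expR (ln rr * (T * (M + 1))) * expR H)).
  rewrite -rrE; apply: ler_pM => //; [|by rewrite addr_ge0| ].
    by rewrite !mulr_ge0 ?expR_ge0 ?exprn_ge0 ?(ltW rr0).
  by rewrite ler_wpM2l// mulr_ge0 ?expR_ge0 ?(ltW rr0).
rewrite -!expRD ler_expR.
have TL1 : T `^ (L + 1) = T * T `^ L.
  rewrite powRD; last by rewrite (gt_eqF T_gt0) implybT.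
  by rewrite powRr1 ?(ltW T_gt0)// mulrC.
rewrite TL1.
have HE : H = rr * H0 * (M + 1) `^ L * T `^ L + rr * H0.
  by rewrite /H powRM ?(ltW M10) ?(ltW T_gt0)//; ring.
have : (ln rr + rr * H0) + (ln rr * (M + 1) + K0) * T + rr * H0 * (M + 1) `^ L * T `^ L
    <= (delta / 2) * (T * T `^ L).
  by near: T; apply: near_linear_le => //; rewrite divr_gt0.
have Tp0 : 0 <= T * T `^ L by rewrite mulr_ge0 ?powR_ge0// ltW.
rewrite HE /B; move: (T `^ L) Tp0 => p Tp0.
have := ler_wpM2l Tp0 bF; have := ler_wpM2l Tp0 beta.
lra.
Unshelve. all: by end_near.
Qed.

End upper.

(** * Lower bound *)

Lemma expn_le_bin_fact m n : (m ^ n <= 'C(m + n, n) * n`!)%N.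
Proof.
rewrite bin_ffact; elim: n => [|n IH]; first by rewrite ffactn0.
by rewrite addnS ffactSS expnS leq_mul// (leq_trans (leq_addr n m)).
Qed.

(** The inequality 1 - 1 / (n + 1) <= exp (- 1 / (n + 1)) raised to the power n + 1; it drives the
    induction for the Stirling-type bound that follows. *)
Lemma expR1_expn_le (R : realType) n : expR 1 * n%:R ^+ n.+1 <= n.+1%:R ^+ n.+1 :> R.
Proof.
have n1 : n.+1%:R != 0 :> R by rewrite pnatr_eq0.
have -> : expR 1 = expR n.+1%:R^-1 ^+ n.+1 :> R.
  by rewrite -expRM_natr mulVf.
rewrite -exprMn lerXn2r ?nnegrE ?mulr_ge0 ?expR_ge0//.
rewrite mulrC -ler_pdivlMr ?expR_gt0// -expRN.
apply: (@le_trans _ _ (n.+1%:R * (1 + - n.+1%:R^-1))).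
  by rewrite mulrDr mulr1 mulrN mulfV// -natr1 addrK.
by rewrite ler_wpM2l// expR_ge1Dx.
Qed.

Lemma expR_le_expn_fact (R : realType) n :
  expR n%:R <= n.+1%:R * expR 1 * (n%:R ^+ n / n`!%:R) :> R.
Proof.
case: n => [|n].
  by rewrite expR0 expr0 divr1 mulr1 mul1r -expR0 ler_expR.
apply: (@le_trans _ _ (n.+1%:R * expR 1 * (n.+1%:R ^+ n.+1 / n.+1`!%:R))); last first.
  by rewrite !ler_wpM2r ?divr_ge0 ?expR_ge0 ?exprn_ge0// ler_nat.
elim: n => [|n IH]; first by rewrite mul1r expr1n divr1 mulr1.
rewrite -[in expR _]natr1 expRD mulrC.
apply: (le_trans (ler_wpM2l (expR_ge0 1) IH)).
have f0 : 0 < n.+1`!%:R :> R by rewrite ltr0n fact_gt0.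
rewrite (_ : expR 1 * _ = expR 1 * (n.+1%:R ^+ n.+2 * expR 1) / n.+1`!%:R); last first.
  by rewrite (exprS _ n.+1); ring.
rewrite (_ : _ * (_ / n.+2`!%:R) = n.+2%:R ^+ n.+2 * expR 1 / n.+1`!%:R); last first.
  have -> : n.+2`!%:R = n.+2%:R * n.+1`!%:R :> R by rewrite -natrM -factS.
  have a0 : n.+2%:R != 0 :> R by rewrite pnatr_eq0.
  set p := _ ^+ n.+2; set a := n.+2%:R in a0 *.
  rewrite invfM [LHS](_ : _ = a * a^-1 * (p * expR 1 / n.+1`!%:R)); last by ring.
  by rewrite mulfV// mul1r.
by rewrite ler_wpM2r ?invr_ge0 ?(ltW f0)// mulrA ler_wpM2r ?expR_ge0// expR1_expn_le.
Qed.

(** With n the integer part of z, the Stirling-type bound and z < n + 1 give e^z <= e^2 (n + 1) z^n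
    / n!. The factor n + 1 is at most e^(theta z) / theta. *)
Lemma expR_le_powR_fact (R : realType) (z theta : R) : 0 <= z -> 0 < theta -> theta <= 1 ->
  theta * expR (- 2) * expR ((1 - theta) * z) <=
  z ^+ (Num.truncn z) / (Num.truncn z)`!%:R.
Proof.
move=> z0 th0 th1; set n := Num.truncn z.
have /andP[nz zn] := truncn_itv z0; rewrite -/n in nz zn.
have f0 : 0 < n`!%:R :> R by rewrite ltr0n fact_gt0.
apply: (@le_trans _ _ (n%:R ^+ n / n`!%:R)); last first.
  by rewrite ler_wpM2r ?invr_ge0 ?(ltW f0)// lerXn2r ?nnegrE.
have H := expR_le_expn_fact R n.
set q := n%:R ^+ n / _ in H *.
have thz : theta * (n%:R + 1) <= expR (theta * z).
  rewrite (le_trans _ (expR_ge1Dx _))// mulrDr mulr1 addrC lerD// ler_wpM2l// ltW//.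
have zE : expR z <= expR 1 * expR n%:R.
  by rewrite -expRD ler_expR addrC natr1 ltW.
have e2 : expR (- 2) * expR 1 * expR 1 = 1 :> R by rewrite -!expRD -expR0; congr expR; ring.
have q0 : 0 <= q by rewrite divr_ge0 ?exprn_ge0.
rewrite (_ : (1 - theta) * z = z - theta * z); last by ring.
rewrite expRD expRN -[leRHS]mul1r mulrA ler_pdivrMr ?expR_gt0//.
apply: (@le_trans _ _ (theta * expR (- 2) * (expR 1 * (n.+1%:R * expR 1 * q)))).
  rewrite ler_wpM2l ?mulr_ge0 ?expR_ge0 ?(ltW th0)//.
  by rewrite (le_trans zE)// ler_wpM2l ?expR_ge0.
rewrite (_ : _ * _ = theta * (n%:R + 1) * q * (expR (- 2) * expR 1 * expR 1)); last first.
  by rewrite -natr1; ring.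
by rewrite e2 mulr1 mul1r mulrC ler_wpM2l.
Qed.

(** The parabola i (D - i) stands in for the sine, the principal eigenfunction of the walk killed at
    0 and [D]; [rho ^+ i] undoes the asymmetry of the rates s / rho and s rho. The denominator
    brings the values below 1. *)
Definition bump_weight (R : realType) (D : nat) (rho : R) (i : nat) : R :=
  i%:R * (D%:R - i%:R) * rho ^+ i / (D%:R ^+ 2 * Num.max 1 rho ^+ D).

Section bump.
Context (R : realType) (D : nat) (rho : R).
Hypothesis rho_gt0 : 0 < rho.
Hypothesis D_gt1 : (1 < D)%N.
Local Notation Phi := (bump_weight D rho).

Let mx_ge1 : 1 <= Num.max 1 rho. Proof. by rewrite le_max lexx. Qed.
Let nrm_gt0 : 0 < D%:R ^+ 2 * Num.max 1 rho ^+ D :> R.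
Proof.
by rewrite mulr_gt0 ?exprn_gt0 ?ltr0n//; [lia|exact: lt_le_trans mx_ge1].
Qed.

Lemma bump_weight_ge0 i : (i <= D)%N -> 0 <= Phi i.
Proof.
move=> iD; rewrite divr_ge0 ?(ltW nrm_gt0)// !mulr_ge0 ?exprn_ge0 ?(ltW rho_gt0)//.
by rewrite subr_ge0 ler_nat.
Qed.

Lemma bump_weight_gt0 i : (0 < i < D)%N -> 0 < Phi i.
Proof.
move=> /andP[i0 iD]; rewrite divr_gt0// !mulr_gt0 ?exprn_gt0 ?ltr0n//.
by rewrite subr_gt0 ltr_nat.
Qed.

Lemma bump_weight_le1 i : (i <= D)%N -> Phi i <= 1.
Proof.
move=> iD; rewrite ler_pdivrMr// mul1r; apply: ler_pM.
- by rewrite mulr_ge0// subr_ge0 ler_nat.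
- by rewrite exprn_ge0// ltW.
- by rewrite expr2 ler_pM ?subr_ge0 ?ler_nat// lerBlDr lerDl.
- apply: (@le_trans _ _ (Num.max 1 rho ^+ i)).
    have mx0 : 0 <= Num.max 1 rho by exact: le_trans mx_ge1.
    by rewrite lerXn2r ?nnegrE ?(ltW rho_gt0)// le_max lexx orbT.
  by rewrite ler_weXn2l.
Qed.

Lemma bump_weight0 : Phi 0%N = 0. Proof. by rewrite /bump_weight !mul0r. Qed.

Lemma bump_weightD : Phi D = 0. Proof. by rewrite /bump_weight subrr mulr0 !mul0r. Qed.

(* [i (D - i)] is the discrete parabola: its second difference is [-2] *)
Lemma bump_weight_sub i : (0 < i < D)%N ->
  (2 - 2 / D.-1%:R) * Phi i <= Phi i.+1 / rho + Phi i.-1 * rho.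
Proof.
case: i => // i /= iD.
have rn0 : rho != 0 by rewrite gt_eqF.
have D1 : 0 < D.-1%:R :> R by rewrite ltr0n; lia.
rewrite /bump_weight; set nrm := (D%:R ^+ 2 * _).
have -> : i.+2%:R * (D%:R - i.+2%:R) * rho ^+ i.+2 / nrm / rho +
    i%:R * (D%:R - i%:R) * rho ^+ i / nrm * rho =
    (2 * (i.+1%:R * (D%:R - i.+1%:R)) - 2) * rho ^+ i.+1 / nrm.
  by rewrite -!natr1 !exprS; field; rewrite rn0 gt_eqF.
rewrite [leLHS](_ : _ = (2 - 2 / D.-1%:R) * (i.+1%:R * (D%:R - i.+1%:R)) * rho ^+ i.+1 / nrm); last first.
  by rewrite !mulrA.
have nrm0 : 0 < nrm by exact: nrm_gt0.
rewrite (ler_pM2r (_ : 0 < nrm^-1)) ?invr_gt0// (ler_pM2r (_ : 0 < rho ^+ i.+1)) ?exprn_gt0//.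
rewrite mulrBl lerD2l lerN2 -[leLHS]mulr1 -mulrA ler_pM2l//.
rewrite mulrC ler_pdivlMr// mul1r.
(* What remains is i (D - i) >= D - 1 in the interior of the window, the origin of the loss 2 / (D -
   1). *)
rewrite (_ : D.-1%:R = D%:R - 1); last by rewrite -[in RHS](prednK (ltnW D_gt1)) -natr1 addrK.
have : i.+1%:R + 1 <= D%:R :> R by rewrite natr1 ler_nat.
have : 1 <= i.+1%:R :> R by rewrite ler1n.
move: (i.+1%:R) (D%:R) => a b ? ?; nra.
Qed.

End bump.

(** * The weight of one step of the schedule *)

Section level.
Context (d : measure_display) (Omega : measurableType d) (R : realType).
Context (P : probability Omega R) (lambda mu : nat -> R).
Context (Y : nat -> Omega -> nat) (S : nat -> Omega -> R).
Hypothesis mY : forall n, measurable_fun [set: Omega] (Y n).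
Hypothesis mS : forall n, measurable_fun [set: Omega] (S n).
Hypothesis law : forall (n : nat) (x : nat -> nat) (B : nat -> set R) (y : nat),
  (forall i, measurable (B i)) ->
  P (history Y S x B n `&` [set w | B n (S n w) /\ Y n.+1 w = y]) =
  (P (history Y S x B n) * exponential_prob (exit_rate lambda mu (x n)) (B n)
    * (jump_prob lambda mu (x n) y)%:E)%E.
Hypothesis lambda_gt0 : forall x, 0 < lambda x.
Hypothesis mu_gt0 : forall x, (0 < x)%N -> 0 < mu x.
Hypothesis mu0 : mu 0%N = 0.
Local Notation h := (exit_rate lambda mu).

Lemma traversesW lo hi X hi' tau sigma sigma' wt wt' : sigma <= sigma' -> wt' <= wt ->
  traverses P Y S lo hi X hi' tau sigma wt -> traverses P Y S lo hi X hi' tau sigma' wt'.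
Proof.
move=> ss ww tr A c c0 HA n y yB; have := tr A c c0 HA n y yB.
apply: lower_boundedS; last by rewrite ler_wpM2r.
move=> u [n1 [seg An1]]; exists n1; split=> //.
by apply: segmentW seg => //; rewrite lerD2l.
Qed.

Variables (dl theta s rho hp w0 : R) (lo hi X D e m : nat).
Hypothesis dl_gt0 : 0 < dl.
Hypothesis theta_gt0 : 0 < theta.
Hypothesis theta_le1 : theta <= 1.
Hypothesis s_ge0 : 0 <= s.
Hypothesis rho_gt0 : 0 < rho.
Hypothesis D_gt1 : (1 < D)%N.
Hypothesis D_theta : D.-1%:R^-1 <= theta.
Hypothesis loX : (lo <= X)%N.
Hypothesis XDhi : (X + D <= hi)%N.
Hypothesis lohie : (hi <= lo + e)%N.
Hypothesis w0_ge0 : 0 <= w0.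
Hypothesis w0_le1 : w0 <= 1.
Hypothesis w0_up : forall x, (lo <= x <= hi)%N ->
  w0 <= lambda x * dl * expR (- (h x * dl)).
Hypothesis w0_down : forall x, (lo <= x <= hi)%N -> (0 < x)%N ->
  w0 <= mu x * dl * expR (- (h x * dl)).
Hypothesis h_le : forall i, (i <= D)%N -> h (X + i) <= hp.
Hypothesis w0_le : forall i, (i <= D)%N -> w0 <= lambda (X + i) * dl * expR (- (hp * dl)).
Hypothesis lambda_ge : forall i, (i <= D)%N -> s / rho <= lambda (X + i).
Hypothesis mu_ge : forall i, (i <= D)%N -> s * rho <= mu (X + i).
Hypothesis hp_dl : hp * dl <= theta.

(** With z = m g, the binomial times g^N is at least z^N / N!, and N is the integer part of z, where
    this Poisson weight is largest. Of the three factors 1 - theta, one comes from the finite width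
    of the window, one from the length of a cell, and one from [expR_le_powR_fact]. *)
Lemma traverses_level : exists2 N : nat, N%:R <= 2 * s * (m%:R * dl) &
  traverses P Y S lo hi X (X + D.+1) (m%:R * dl) ((e + N).+1%:R * dl)
    (w0 ^+ e.+1 * (theta * expR (- 2) * bump_weight D rho 1) *
     expR ((1 - theta) ^+ 3 * 2 * s * (m%:R * dl) - hp * (m%:R * dl))).
Proof.
have hp_gt0 : 0 < hp by rewrite (lt_le_trans _ (h_le (leq0n D)))// exit_rate_gt0.
pose r : R := 2 - 2 / D.-1%:R.
have D1 : 0 < D.-1%:R^-1 :> R by rewrite invr_gt0 ltr0n ltn_predRL.
have r2 : r <= 2 by rewrite /r lerBlDr lerDl mulr_ge0// ltW.
have rth : 2 * (1 - theta) <= r.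
  by rewrite /r mulrBr mulr1 lerD2l lerN2 ler_wpM2l.
have r0 : 0 <= r by rewrite (le_trans _ rth)// mulr_ge0// subr_ge0.
pose E := expR (- (hp * dl)).
have E0 : 0 <= E by exact: expR_ge0.
have E1 : E <= 1 by rewrite -expR0 ler_expR oppr_le0 mulr_ge0// ltW.
have Eth : 1 - theta <= E by rewrite (le_trans _ (expR_ge1Dx _))// lerD2l lerN2.
pose g := s * r * dl * E.
have g0 : 0 <= g by rewrite !mulr_ge0// ltW.
pose z := m%:R * g.
have z0 : 0 <= z by rewrite mulr_ge0.
have md0 : 0 <= m%:R * dl by rewrite mulr_ge0// ltW.
exists (Num.truncn z).
  have /andP[Nz _] := truncn_itv z0; apply: (le_trans Nz).
  rewrite /z /g (_ : m%:R * _ = r * E * (s * (m%:R * dl))); last by ring.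
  rewrite [leRHS](_ : _ = 2 * 1 * (s * (m%:R * dl))); last by ring.
  by apply: ler_wpM2r; [rewrite mulr_ge0|apply: ler_pM].
have Phi_sub i : (0 < i < D)%N -> g * bump_weight D rho i <=
    (lambda (X + i) * bump_weight D rho i.+1 + mu (X + i) * bump_weight D rho i.-1) * dl * E.
  move=> /[dup] iD /andP[i0 iltD].
  have B1 : 0 <= bump_weight D rho i.+1 by apply: bump_weight_ge0.
  have B2 : 0 <= bump_weight D rho i.-1.
    exact: bump_weight_ge0 (leq_trans (leq_pred i) (ltnW iltD)).
  rewrite (_ : g * _ = s * (r * bump_weight D rho i) * dl * E); last by rewrite /g; ring.
  rewrite ler_wpM2r// ler_wpM2r ?(ltW dl_gt0)//.
  apply: (@le_trans _ _ (s * (bump_weight D rho i.+1 / rho + bump_weight D rho i.-1 * rho))).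
    by rewrite ler_wpM2l//; exact: bump_weight_sub.
  rewrite (_ : s * _ = s / rho * bump_weight D rho i.+1 + s * rho * bump_weight D rho i.-1); last by ring.
  by apply: lerD; apply: ler_wpM2r; rewrite ?lambda_ge ?mu_ge// ltnW.
have := @traverses_window _ _ _ P lambda mu Y S mY mS law lambda_gt0 mu_gt0 mu0
  dl lo hi X D e m (Num.truncn z) hp g w0 (bump_weight D rho) dl_gt0 (ltnW D_gt1) loX XDhi
  lohie w0_ge0 w0_le1 w0_up w0_down g0
  (fun i => @bump_weight_ge0 R D rho rho_gt0 D_gt1 i)
  (fun i => @bump_weight_le1 R D rho rho_gt0 D_gt1 i)
  (bump_weight0 D rho) (bump_weightD D rho) h_le w0_le Phi_sub.
apply: traversesW => //.
have B1 : 0 < bump_weight D rho 1 by apply: bump_weight_gt0.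
have poisson : theta * expR (- 2) * expR ((1 - theta) * z) <=
    'C(m + Num.truncn z, Num.truncn z)%:R * g ^+ Num.truncn z.
  apply: (le_trans (expR_le_powR_fact z0 theta_gt0 theta_le1)).
  rewrite ler_pdivrMr ?ltr0n ?fact_gt0// /z exprMn mulrAC -natrX ler_wpM2r ?exprn_ge0//.
  by rewrite -natrM ler_nat expn_le_bin_fact.
have zge : (1 - theta) ^+ 3 * 2 * s * (m%:R * dl) <= (1 - theta) * z.
  rewrite (_ : (1 - theta) ^+ 3 * 2 * s * (m%:R * dl) =
    (1 - theta) * (2 * (1 - theta) * (1 - theta) * (s * (m%:R * dl)))); last by ring.
  rewrite ler_wpM2l ?subr_ge0// /z /g [leRHS](_ : _ = r * E * (s * (m%:R * dl))); last by ring.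
  by apply: ler_wpM2r; [rewrite mulr_ge0|apply: ler_pM; rewrite ?mulr_ge0 ?subr_ge0].
rewrite expRD exprSr.
set E3 := expR (- (hp * (m%:R * dl))).
rewrite [leLHS](_ : _ = w0 ^+ e * (theta * expR (- 2) *
   expR ((1 - theta) ^+ 3 * 2 * s * (m%:R * dl)) * E3 * bump_weight D rho 1 * w0)); last by ring.
rewrite ler_wpM2l ?exprn_ge0// ler_wpM2r// ler_wpM2r ?(ltW B1)// ler_wpM2r ?expR_ge0//.
apply: le_trans poisson; rewrite ler_wpM2l ?ler_expR// mulr_ge0 ?expR_ge0// ltW//.
Qed.

End level.

(** With q = T^(L / 2) one has ln (T^L) = 2 ln q <= 2 q, and q^2 outgrows q. It makes the O(T ln T)
    cost of moving between levels negligible. *)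
Lemma near_ln_le (R : realType) (L e : R) : 0 < L -> 0 < e ->
  \forall T \near +oo, ln (T `^ L) <= e * T `^ L.
Proof.
move=> L0 e0; have L20 : 0 < L / 2 by rewrite divr_gt0.
near=> T.
have T0 : 0 < T by near: T; exact: (nbhs_pinfty_gt (num_real _)).
have T2 : 2 / e <= T `^ (L / 2) by near: T; exact: near_powR_ge.
have q0 : 0 < T `^ (L / 2) by rewrite powR_gt0.
have -> : T `^ L = T `^ (L / 2) ^+ 2.
  rewrite -powR_mulrn ?(ltW q0)// -powRrM; congr (_ `^ _); lra.
rewrite lnXn//.
have lnq : ln (T `^ (L / 2)) <= T `^ (L / 2).
  by rewrite ltW// ln_sublinear.
move: (T `^ (L / 2)) T2 q0 lnq => q; rewrite ler_pdivrMr// => T2 q0 lnq.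
by rewrite mulr2n; nra.
Unshelve. all: by end_near.
Qed.

Lemma riemann_sum_le (R : realType) (a F : R -> R) (K : nat) (e : R) : (0 < K)%N ->
  F 0 = 0 ->
  (forall u v c, 0 <= u -> u <= v -> v <= 1 ->
    (forall t, u <= t < v -> c <= a t) -> c * (v - u) <= F v - F u) ->
  (forall j t, (j < K)%N -> j%:R / K%:R <= t < j.+1%:R / K%:R -> a (j%:R / K%:R) - e <= a t) ->
  \sum_(j < K) a (j%:R / K%:R) <= K%:R * (F 1 + e).
Proof.
move=> K0 F0 F_ge ae.
have K0' : 0 < K%:R :> R by rewrite ltr0n.
have step (j : 'I_K) : a (j%:R / K%:R) <=
    K%:R * (F (j.+1%:R / K%:R) - F (j%:R / K%:R)) + e.
  have := F_ge (j%:R / K%:R) (j.+1%:R / K%:R) (a (j%:R / K%:R) - e).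
  rewrite divr_ge0// ler_pM2r ?invr_gt0// ler_nat leqnSn.
  rewrite ler_pdivrMr// mul1r ler_nat ltn_ord => /(_ isT isT isT).
  move=> /(_ (fun t => ae j t (ltn_ord j))).
  rewrite -mulrBl -natr1 addrAC subrr add0r mul1r => H.
  have := ler_wpM2l (ltW K0') H; rewrite mulrCA mulfV ?gt_eqF// mulr1.
  by rewrite lerBlDr.
apply: (le_trans (ler_sum _ (fun j _ => step j))).
rewrite big_split/= -mulr_sumr sumr_const card_ord mulrDr lerD//.
  rewrite ler_wpM2l ?(ltW K0')//.
  rewrite (_ : \sum_(i < K) _ = \sum_(0 <= i < K) (F (i.+1%:R / K%:R) - F (i%:R / K%:R))).
    by rewrite telescope_sumr// mul0r F0 subr0 mulfV ?gt_eqF.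
  by rewrite big_mkord.
by rewrite mulr_natl.
Qed.

(** Here [a] and [b] stand for the L-th powers of the bottom and the top of a scaled window: exit
    rates are bounded at the top, the gain from jumping at the bottom. The fourth power combines the
    three factors of [traverses_level] with the one in the lower bounds for the rates; since (1 -
    theta)^4 >= 1 - 4 theta, the excess due to [theta] is at most theta (1 + 8 s0) a. *)
Lemma rate_constants (R : realType) (C s0 ML delta : R) :
  0 <= C -> 0 <= s0 -> 0 <= ML -> 0 < delta ->
  exists theta delta1 : R, [/\ 0 < theta, theta <= 2^-1, 0 < delta1 &
    forall a b, 0 <= a -> a <= ML -> b <= a + delta1 ->
    (C + 2 * s0 + theta) * b - 2 * s0 * (1 - theta) ^+ 4 * a <= C * a + delta].
Proof.
move=> C0 s00 ML0 delta0.
have c0 : 0 < 4 * ((1 + 8 * s0) * (ML + 1)).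
  have A : 0 < 1 + 8 * s0 by lra.
  have B : 0 < ML + 1 by lra.
  by rewrite !mulr_gt0.
have d0 : 0 < 4 * (C + 2 * s0 + 1) by lra.
exists (Num.min 2^-1 (delta / (4 * ((1 + 8 * s0) * (ML + 1))))).
exists (delta / (4 * (C + 2 * s0 + 1))).
set theta := Num.min _ _; set delta1 := delta / (4 * (C + _ + _)).
have th0 : 0 < theta by rewrite lt_min invr_gt0 ltr0n divr_gt0.
have th1 : theta <= 2^-1 by rewrite ge_min lexx.
have th2 : theta * (4 * ((1 + 8 * s0) * (ML + 1))) <= delta.
  by rewrite -ler_pdivlMr// ge_min lexx orbT.
have del0 : 0 < delta1 by rewrite divr_gt0.
have del1 : delta1 * (4 * (C + 2 * s0 + 1)) = delta by rewrite divfK// gt_eqF.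
split=> // a b a0 aML bd.
have th3 : 1 - 4 * theta <= (1 - theta) ^+ 4.
  have : theta <= 1 by lra.
  move: theta th0 {th1 th2} => t t0 t1.
  have t2 : 1 - 2 * t <= (1 - t) ^+ 2 by rewrite expr2; nra.
  have -> : (1 - t) ^+ 4 = (1 - t) ^+ 2 * (1 - t) ^+ 2 by rewrite -exprD.
  rewrite !expr2; nra.
have B1 : (C + 2 * s0 + theta) * b <= (C + 2 * s0 + theta) * (a + delta1).
  by rewrite ler_wpM2l//; lra.
have B2 : (C + 2 * s0 + theta) * delta1 <= delta / 4.
  apply: (@le_trans _ _ ((C + 2 * s0 + 1) * delta1)); last by lra.
  by rewrite ler_wpM2r ?(ltW del0)//; lra.
have B3 : 2 * s0 * (1 - 4 * theta) * a <= 2 * s0 * (1 - theta) ^+ 4 * a.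
  by rewrite ler_wpM2r// ler_wpM2l// mulr_ge0.
have B4 : theta * ((1 + 8 * s0) * a) <= delta / 4.
  apply: (@le_trans _ _ (theta * ((1 + 8 * s0) * (ML + 1)))); last by lra.
  rewrite ler_wpM2l ?(ltW th0)// ler_wpM2l//; first by lra.
  by rewrite (le_trans aML)// lerDl.
nra.
Qed.

Lemma level_bounds (R : realType) (u eta T : R) (D : nat) : 0 <= u -> 0 < eta -> 0 < T ->
  D%:R + 2 <= eta * T ->
  (u + eta) * T <= (Num.truncn ((u + eta) * T)).+1%:R /\
  ((Num.truncn ((u + eta) * T)).+1 + D.+1)%:R <= (u + 2 * eta) * T.
Proof.
move=> u0 eta0 T0 DT.
have /truncn_itv/andP[H1 H2] : 0 <= (u + eta) * T by rewrite mulr_ge0 ?addr_ge0// ltW.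
split; first exact: ltW.
move: H1; rewrite natrD -!natr1; move: (_%:R) => x; lra.
Qed.

Lemma ler_powR_base (R : realType) (L u v : R) : 0 <= L -> 0 <= u -> u <= v ->
  u `^ L <= v `^ L.
Proof.
by move=> L0 u0 uv; apply: ge0_ler_powR; rewrite ?nnegrE// (le_trans u0).
Qed.

Lemma close_trans (R : realType) (a b c e1 eta : R) : 0 <= eta ->
  b - e1 <= c -> c <= b + e1 + 2 * eta -> `|a - b| <= e1 -> `|a - c| <= 2 * e1 + 2 * eta.
Proof. by rewrite !ler_norml => ? ? ? /andP[? ?]; apply/andP; split; lra. Qed.

(** The condition on [kappa] makes the delays of all the steps together shorter than one time step
    [T / k]; hence the 2 in place of 1 in the conclusion. *)
Lemma schedule_le (R : realType) (T k j j1 s tau dl kappa A : R) :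
  1 <= T -> 0 < k -> 0 <= j -> j1 = j + 1 -> s <= j1 * (tau + A * kappa * T) ->
  tau <= T / k + dl -> dl <= kappa -> 0 <= A -> 0 < kappa ->
  kappa * (1 + A) * (k * k) <= 1 -> j + 1 <= k -> s / T <= j / k + 2 / k.
Proof.
move=> T1 k0 j0 -> sle tle dle A0 kap0 kapk jk.
have T0 : 0 < T by lra.
rewrite ler_pdivrMr// -mulrDl mulrAC ler_pdivlMr//.
have H1 : tau * k <= T + kappa * k.
  have := ler_wpM2r (ltW k0) tle; rewrite mulrDl divfK ?gt_eqF// => H.
  by rewrite (le_trans H)// lerD2l ler_wpM2r// ltW.
have H2 : s * k <= (j + 1) * (tau * k + A * kappa * T * k).
  have -> : (j + 1) * (tau * k + A * kappa * T * k) = (j + 1) * (tau + A * kappa * T) * k by ring.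
  by apply: ler_wpM2r => //; exact: ltW.
have H3 : kappa * k <= kappa * k * T by rewrite ler_peMr// mulr_ge0// ltW.
have H4 : (j + 1) * (kappa * (1 + A) * k) <= 1.
  rewrite (le_trans _ kapk)// mulrC (_ : kappa * (1 + A) * (k * k) = kappa * (1 + A) * k * k); last by ring.
  by rewrite ler_wpM2l// !mulr_ge0// ?addr_ge0// ltW.
apply: (le_trans H2).
apply: (@le_trans _ _ ((j + 1) * (T + kappa * k * T + A * kappa * T * k))).
  by rewrite ler_wpM2l ?addr_ge0// lerD2r (le_trans H1)// lerD2l.
rewrite (_ : _ * _ = (j + 1) * T + (j + 1) * (kappa * (1 + A) * k) * T); last by ring.
have := ler_wpM2r (ltW T0) H4; lra.
Qed.

Lemma exponent_bound (R : realType) (k M T p lp lw lc G c delta : R) :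
  - (k * lc) + (- (k * (M + 3) * lw)) * T + (k * G) * p <= delta / 2 * (T * p) ->
  k * (M + 3) * T * lp <= delta / 4 * (T * p) ->
  T * p * G <= T * p * (c + delta / 4) ->
  - (T * p * (c + delta)) <= k * ((M + 3) * T * (lw - lp) + lc) - (T + k) * p * G.
Proof. by move=> H1 H2 H3; lra. Qed.

(** * Following a step function close to [f] *)

Section lower.
Context (d : measure_display) (Omega : measurableType d) (R : realType).
Context (P : probability Omega R) (lambda mu : nat -> R).
Context (Y : nat -> Omega -> nat) (S : nat -> Omega -> R).
Context (xi : R -> Omega -> option nat).
Hypothesis mY : forall n, measurable_fun [set: Omega] (Y n).
Hypothesis mS : forall n, measurable_fun [set: Omega] (S n).
Hypothesis Y0 : forall w, Y 0%N w = 0%N.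
Hypothesis S_gt0 : forall n w, 0 < S n w.
Hypothesis law : forall (n : nat) (x : nat -> nat) (B : nat -> set R) (y : nat),
  (forall i, measurable (B i)) ->
  P (history Y S x B n `&` [set w | B n (S n w) /\ Y n.+1 w = y]) =
  (P (history Y S x B n) * exponential_prob (exit_rate lambda mu (x n)) (B n)
    * (jump_prob lambda mu (x n) y)%:E)%E.
Hypothesis xi_some : forall t w n, jump_time S n w <= t < jump_time S n.+1 w ->
  xi t w = Some (Y n w).
Hypothesis xi_none : forall t w, (forall n, jump_time S n w <= t) -> xi t w = None.
Hypothesis lambda_gt0 : forall x, 0 < lambda x.
Hypothesis mu_gt0 : forall x, (0 < x)%N -> 0 < mu x.
Hypothesis mu0 : mu 0%N = 0.
Local Notation h := (exit_rate lambda mu).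
Local Notation J := (jump_time S).

Variables (L C H0 s0 rho l0 : R).
Hypothesis L_gt0 : 0 < L.
Hypothesis C_ge0 : 0 <= C.
Hypothesis s0_ge0 : 0 <= s0.
Hypothesis rho_gt0 : 0 < rho.
Hypothesis l0_gt0 : 0 < l0.
Hypothesis H0_ge0 : 0 <= H0.
Hypothesis growth : forall y, h y <= H0 * (y%:R `^ L + 1).
Hypothesis lambda_min : forall x, l0 <= lambda x.
Hypothesis mu_min : forall x, (0 < x)%N -> l0 <= mu x.
Variable f : R -> R.
Hypothesis f_pos : F_pos f.

Section fixed_scale.
Variables (theta eta e1 M kappa T eps : R) (K D x0 : nat).
Local Notation S2 := (C + 2 * s0).
Hypothesis theta_gt0 : 0 < theta.
Hypothesis theta_le : theta <= 2^-1.
Hypothesis h_ge : forall x, (x0 <= x)%N -> h x <= (S2 + theta) * x%:R `^ L.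
Hypothesis lambda_ge : forall x, (x0 <= x)%N -> (1 - theta) * s0 / rho * x%:R `^ L <= lambda x.
Hypothesis mu_ge : forall x, (x0 <= x)%N -> (1 - theta) * s0 * rho * x%:R `^ L <= mu x.
Hypothesis f_le : forall t, 0 <= t <= 1 -> 0 <= f t <= M.
Hypothesis M_ge0 : 0 <= M.
Hypothesis f_osc : forall x y, 0 <= x <= 1 -> 0 <= y <= 1 -> `|x - y| <= 2 / K%:R ->
  `|f x - f y| <= e1.
Hypothesis K_gt0 : (0 < K)%N.
Hypothesis D_gt1 : (1 < D)%N.
Hypothesis D_theta : D.-1%:R^-1 <= theta.
Hypothesis T_ge1 : 1 <= T.
Hypothesis eta_gt0 : 0 < eta.
Hypothesis eta_le : eta <= 2^-1.
Hypothesis D_T : D%:R + 2 <= eta * T.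
Hypothesis x0_T : x0%:R <= eta * T.
Hypothesis kappa_gt0 : 0 < kappa.
Hypothesis kappa_le1 : kappa <= 1.
Hypothesis kappa_theta : kappa * ((H0 + S2 + 1) * ((M + 2) `^ L + 1)) <= theta.
Local Notation A := (4 * s0 * (M + 2) `^ L + M + 4).
Hypothesis kappa_K : kappa * (1 + A) * (K%:R * K%:R) <= 1.
Hypothesis eps_gt : 2 * e1 + 2 * eta < eps.

Let T_gt0 : 0 < T. Proof. exact: lt_le_trans ltr01 T_ge1. Qed.
Let K_gt0' : 0 < K%:R :> R. Proof. by rewrite ltr0n. Qed.
Let p := T `^ L.
Let p_ge1 : 1 <= p.
Proof. by have := ler_powR_base (ltW L_gt0) ler01 T_ge1; rewrite powR1. Qed.
Let p_gt0 : 0 < p. Proof. exact: lt_le_trans ltr01 p_ge1. Qed.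
Let dl := kappa / p.
Let dl_gt0 : 0 < dl. Proof. exact: divr_gt0. Qed.
Let dlp : dl * p = kappa. Proof. by rewrite divfK// gt_eqF. Qed.
Let dl_le : dl <= kappa.
Proof. by rewrite ler_pdivrMr// ler_peMr// ltW. Qed.

Let fj j := f (j%:R / K%:R).
(** The level lies [eta * T] above the graph of [f], so that even near time 0, where [f] vanishes,
    the window is above [x0], where the asymptotics of the rates apply. *)
Let X j := (Num.truncn ((fj j + eta) * T)).+1.
Let Xm j := if j is j'.+1 then X j' else 0%N.
(** The range of step [j] contains both the states in which the previous step may end and the window
    of the new level. *)
Let lo j := minn (Xm j) (X j).
Let hi j := (maxn (Xm j) (X j) + D.+1)%N.
Let e := Num.truncn ((M + 2) * T).
(** The successor makes the [K] steps together last strictly longer than [T]. *)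
Let m := (Num.truncn (T / (K%:R * dl))).+1.
Let tau := m%:R * dl.
(** Bounds the weight of any single jump made in cell 0: rates are at least [l0], and the exponent
    is at most [theta], hence at most 1. The minimum with 1 ensures [w0 <= 1]. *)
Let w0 := Num.min l0 1 * dl * expR (- 1).
Let hp j := (S2 + theta) * ((fj j + 2 * eta) * T) `^ L.
Let s j := (1 - theta) * s0 * (fj j * T) `^ L.

Let grid j : (j <= K)%N -> 0 <= (j%:R / K%:R : R) <= 1.
Proof. by move=> jK; rewrite divr_ge0//= ler_pdivrMr// mul1r ler_nat. Qed.

Let fj_bound j : (j <= K)%N -> 0 <= fj j <= M.
Proof. by move=> /grid /f_le. Qed.

Let X_bounds j : (j <= K)%N ->
  (fj j + eta) * T <= (X j)%:R /\ (X j + D.+1)%:R <= (fj j + 2 * eta) * T.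
Proof.
by move=> /fj_bound /andP[f0 _]; apply: level_bounds.
Qed.

Let level_le j : (j <= K)%N -> (fj j + 2 * eta) * T <= (M + 1) * T.
Proof.
move=> /fj_bound /andP[_ fM]; rewrite ler_wpM2r ?(ltW T_gt0)//.
by apply: lerD => //; rewrite mulrC -ler_pdivlMr// mul1r.
Qed.

Let e_ge x : x%:R <= (M + 1) * T -> (x <= e)%N.
Proof.
move=> xM; have MT : (M + 1) * T <= (M + 2) * T.
  by rewrite ler_wpM2r ?(ltW T_gt0)// lerD2l ler1n.
by rewrite truncn_ge_nat ?(le_trans xM MT)// (le_trans _ MT)// (le_trans _ xM).
Qed.

Let hi_le j : (j <= K)%N -> (hi j <= e)%N.
Proof.
move=> jK; have [_ HX] := X_bounds jK; apply: e_ge.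
have HXm : (Xm j + D.+1)%:R <= (M + 1) * T.
  case: j jK HX => [|j] jK _ /=.
    apply: (@le_trans _ _ (eta * T)).
      by rewrite add0n -natr1 (le_trans _ D_T)// lerD2l ler1n.
    rewrite ler_wpM2r ?(ltW T_gt0)// (le_trans eta_le)// (@le_trans _ _ 1) ?lerDr//.
    by rewrite invf_le1// ler1n.
  have jK' : (j <= K)%N by exact: ltnW.
  by have [_ H] := X_bounds jK'; exact: le_trans H (level_le jK').
rewrite /hi addn_maxl; case: leqP => _ //.
exact: le_trans HX (level_le jK).
Qed.

Let h_dl x : x%:R <= (M + 2) * T -> h x * dl <= theta.
Proof.
move=> xe; apply: (@le_trans _ _ (H0 * (((M + 2) `^ L + 1) * p) * dl)).
  rewrite ler_wpM2r ?(ltW dl_gt0)// (le_trans (growth x))// ler_wpM2l//.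
  rewrite mulrDl mul1r lerD// -powRM ?(ltW T_gt0) ?addr_ge0//.
  by apply: ler_powR_base => //; exact: ltW.
rewrite (_ : _ * dl = (dl * p) * (H0 * ((M + 2) `^ L + 1))); last by ring.
rewrite dlp (le_trans _ kappa_theta)// ler_wpM2l ?(ltW kappa_gt0)//.
rewrite ler_wpM2r ?addr_ge0 ?powR_ge0//.
by rewrite -addrA lerDl !addr_ge0// mulr_ge0.
Qed.

Let hp_dl j : (j <= K)%N -> hp j * dl <= theta.
Proof.
move=> jK; apply: (@le_trans _ _ ((S2 + 1) * ((M + 2) `^ L * p) * dl)).
  rewrite ler_wpM2r ?(ltW dl_gt0)// /hp; apply: ler_pM; rewrite ?powR_ge0//.
  - by rewrite !addr_ge0 ?mulr_ge0// ltW.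
  - by rewrite lerD2l (le_trans theta_le)// invf_le1// ler1n.
  - rewrite -powRM ?(ltW T_gt0) ?addr_ge0//; apply: ler_powR_base; first exact: ltW.
      have /andP[f0 _] := fj_bound jK.
      by rewrite mulr_ge0 ?(ltW T_gt0)// addr_ge0// mulr_ge0// ltW.
    by rewrite (le_trans (level_le jK))// ler_wpM2r ?(ltW T_gt0)// lerD2l ler1n.
rewrite (_ : _ * dl = (dl * p) * ((S2 + 1) * (M + 2) `^ L)); last by ring.
rewrite dlp (le_trans _ kappa_theta)// ler_wpM2l ?(ltW kappa_gt0)//.
apply: ler_pM; rewrite ?powR_ge0 ?lerDl// ?addr_ge0 ?mulr_ge0//.
by rewrite lerD2r lerDr.
Qed.

Let w0_gt0 : 0 < w0.
Proof.
apply: mulr_gt0; last exact: expR_gt0.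
by apply: mulr_gt0 => //; rewrite lt_min l0_gt0 ltr01.
Qed.

Let w0_le1 : w0 <= 1.
Proof.
have e1' : expR (- 1) <= 1 :> R by rewrite -expR0 ler_expR oppr_le0.
have mn0 : 0 <= Num.min l0 1 by rewrite le_min ler01 (ltW l0_gt0).
rewrite /w0 -[leRHS]mulr1; apply: ler_pM; [|exact: expR_ge0| |exact: e1'].
  by rewrite mulr_ge0// ltW.
rewrite -[leRHS]mulr1; apply: ler_pM; [by []|exact: ltW| |].
  by rewrite ge_min lexx orbT.
exact: le_trans dl_le kappa_le1.
Qed.

Let w0_le a b : l0 <= a -> b <= theta -> w0 <= a * dl * expR (- b).
Proof.
move=> la bt; rewrite /w0; apply: ler_pM; rewrite ?expR_ge0//.
- by rewrite mulr_ge0 ?(ltW dl_gt0)// le_min ler01 (ltW l0_gt0).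
- by rewrite ler_wpM2r ?(ltW dl_gt0)// ge_min la.
- by rewrite ler_expR lerN2 (le_trans bt)// (le_trans theta_le)// invf_le1// ler1n.
Qed.

Let X_window j i : (j <= K)%N -> (i <= D)%N ->
  [/\ (x0 <= X j + i)%N, (fj j * T) <= (X j + i)%:R & (X j + i)%:R <= (fj j + 2 * eta) * T].
Proof.
move=> jK iD; have [HX1 HX2] := X_bounds jK; have /andP[f0 _] := fj_bound jK.
have XX : (X j)%:R <= (X j + i)%:R :> R by rewrite ler_nat leq_addr.
split.
- rewrite -(ler_nat R) (le_trans x0_T)// (le_trans _ XX)// (le_trans _ HX1)//.
  by rewrite ler_wpM2r ?(ltW T_gt0)// lerDr.
- by rewrite (le_trans _ XX)// (le_trans _ HX1)// ler_wpM2r ?(ltW T_gt0)// lerDl ltW.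
- by rewrite (le_trans _ HX2)// ler_nat leq_add2l ltnW.
Qed.

Let sj_ge0 j : 0 <= s j.
Proof.
rewrite !mulr_ge0 ?powR_ge0// subr_ge0 (le_trans theta_le)// invf_le1// ler1n//.
Qed.

Let tau_bounds : T < K%:R * tau /\ tau <= T / K%:R + dl.
Proof.
have Kdl : 0 < K%:R * dl by rewrite mulr_gt0.
have q0 : 0 <= T / (K%:R * dl) by rewrite divr_ge0// ltW.
have /andP[m1 m2] := truncn_itv q0; split.
  by move: m2; rewrite ltr_pdivrMr// /tau mulrCA.
rewrite /tau /m -natr1 mulrDl mul1r lerD2r.
move: m1; rewrite invfM mulrA ler_pdivlMr//.
Qed.

Let tau_le : tau <= 2 * T.
Proof.
have [_ H] := tau_bounds; apply: (le_trans H); rewrite mulrDl mul1r; apply: lerD.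
  by rewrite ler_pdivrMr// ler_peMr ?(ltW T_gt0)// ler1n.
exact: le_trans dl_le (le_trans kappa_le1 T_ge1).
Qed.

Let sigma := A * kappa * T.
Let wt j := w0 ^+ e.+1 * (theta * expR (- 2) * bump_weight D rho 1) *
     expR ((1 - theta) ^+ 3 * 2 * s j * tau - hp j * tau).

Let overshoot j N : (j <= K)%N -> N%:R <= 2 * s j * tau -> (e + N).+1%:R * dl <= sigma.
Proof.
move=> jK HN; have /andP[f0 fM] := fj_bound jK.
have sdl : s j * dl <= s0 * (M + 2) `^ L * kappa.
  have H1 : (fj j * T) `^ L <= (M + 2) `^ L * p.
    rewrite -powRM ?(ltW T_gt0) ?addr_ge0//; apply: ler_powR_base; first exact: ltW.
      by rewrite mulr_ge0// ltW.
    by rewrite ler_wpM2r ?(ltW T_gt0)// (le_trans fM)// lerDl.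
  have sd0 : 0 <= s0 * dl by rewrite mulr_ge0// ltW.
  have th1 : theta <= 1 by rewrite (le_trans theta_le)// invf_le1// ler1n.
  rewrite -dlp [leRHS](_ : _ = 1 * (s0 * dl * ((M + 2) `^ L * p))); last by ring.
  rewrite [leLHS](_ : _ = (1 - theta) * (s0 * dl * (fj j * T) `^ L)); last by rewrite /s; ring.
  apply: ler_pM; first by rewrite subr_ge0.
  - by rewrite mulr_ge0// powR_ge0.
  - by rewrite gerBl ltW.
  - exact: ler_wpM2l.
have tau0 : 0 <= tau by rewrite mulr_ge0// ltW.
have Ndl : N%:R * dl <= 4 * s0 * (M + 2) `^ L * kappa * T.
  apply: (@le_trans _ _ (2 * s j * tau * dl)); first by rewrite ler_wpM2r// ltW.
  rewrite (_ : 2 * s j * tau * dl = 2 * (s j * dl) * tau); last by ring.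
  rewrite (_ : 4 * s0 * (M + 2) `^ L * kappa * T = 2 * (s0 * (M + 2) `^ L * kappa) * (2 * T)); last by ring.
  have sdl0 : 0 <= s j * dl by apply: mulr_ge0; [exact: sj_ge0|exact: ltW].
  by apply: ler_pM; [rewrite mulr_ge0|by []|rewrite ler_wpM2l|exact: tau_le].
have edl : (e%:R + 1) * dl <= (M + 3) * T * kappa.
  apply: ler_pM => //; first exact: ltW.
  have eM : e%:R <= (M + 2) * T.
    by rewrite -truncn_ge_nat// mulr_ge0 ?addr_ge0// ltW.
  rewrite (_ : (M + 3) * T = (M + 2) * T + T); last by ring.
  exact: lerD.
rewrite -natr1 natrD addrAC mulrDl (le_trans (lerD edl Ndl))//.
rewrite /sigma (_ : A * kappa * T = (M + 3) * T * kappa + 4 * s0 * (M + 2) `^ L * kappa * T + kappa * T); last by ring.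
by rewrite lerDl mulr_ge0// ltW.
Qed.

Let level_traverses j : (j < K)%N ->
  traverses P Y S (lo j) (hi j) (X j) (X j + D.+1) tau sigma (wt j).
Proof.
move=> jltK; have jK := ltnW jltK; have /andP[f0 _] := fj_bound jK.
have th1 : theta <= 1 by rewrite (le_trans theta_le)// invf_le1// ler1n.
have hiT x : (x <= hi j)%N -> x%:R <= (M + 2) * T.
  move=> xh; have xe := leq_trans xh (hi_le jK).
  have eM : e%:R <= (M + 2) * T.
    by rewrite -truncn_ge_nat// mulr_ge0 ?addr_ge0// ltW.
  by rewrite (le_trans _ eM)// ler_nat.
have loX : (lo j <= X j)%N by exact: geq_minr.
have XDhi : (X j + D <= hi j)%N.
  by rewrite /hi addn_maxl leq_max leq_add2l leqnSn orbT.
have lohie : (hi j <= lo j + e)%N by rewrite (leq_trans (hi_le jK))// leq_addl.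
have [|||||N HN] := @traverses_level _ _ _ P lambda mu Y S mY mS law lambda_gt0 mu_gt0 mu0
  dl theta (s j) rho (hp j) w0 (lo j) (hi j) (X j) D e m dl_gt0 theta_gt0 th1 (sj_ge0 j)
  rho_gt0 D_gt1 D_theta loX XDhi lohie (ltW w0_gt0) w0_le1
  (fun x xB => w0_le (lambda_min x) (h_dl (hiT x (andP xB).2)))
  (fun x xB x0 => w0_le (mu_min x0) (h_dl (hiT x (andP xB).2))).
- move=> i iD; have [x0i xi1 xi2] := X_window jK iD.
  rewrite (le_trans (h_ge x0i))// /hp ler_wpM2l//.
    by rewrite !addr_ge0 ?mulr_ge0// ltW.
  by apply: ler_powR_base => //; exact: ltW.
- by move=> i iD; apply: w0_le => //; exact: hp_dl.
- move=> i iD; have [x0i xi1 xi2] := X_window jK iD.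
  rewrite (le_trans _ (lambda_ge x0i))//.
  rewrite (_ : s j / rho = (1 - theta) * s0 / rho * (fj j * T) `^ L); last by rewrite /s; ring.
  rewrite ler_wpM2l//; first by rewrite divr_ge0 ?(ltW rho_gt0)// mulr_ge0// subr_ge0.
  by apply: ler_powR_base => //; [exact: ltW|rewrite mulr_ge0// ltW].
- move=> i iD; have [x0i xi1 xi2] := X_window jK iD.
  rewrite (le_trans _ (mu_ge x0i))//.
  rewrite (_ : s j * rho = (1 - theta) * s0 * rho * (fj j * T) `^ L); last by rewrite /s; ring.
  rewrite ler_wpM2l//; first by rewrite mulr_ge0 ?(ltW rho_gt0)// mulr_ge0// subr_ge0.
  by apply: ler_powR_base => //; [exact: ltW|rewrite mulr_ge0// ltW].
- exact: hp_dl.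
- move=> tr; apply: traversesW tr; first exact: (overshoot jK HN).
  exact: lexx.
Qed.

Lemma fixed_scale_lower : ((\prod_(j < K) wt j)%:E <=
  P (traj_in (scaled xi T) (U_eps eps f)))%E.
Proof.
have [fc f00 _] := f_pos.
have e10 : 0 <= e1.
  have z01 : (0 : R) <= (0 : R) <= (1 : R) by rewrite lexx ler01.
  have := f_osc z01 z01; rewrite !subrr normr0; apply.
  by rewrite divr_ge0.
have near_grid j : (j < K)%N -> `|fj j.+1 - fj j| <= e1.
  move=> jK; apply: f_osc; [exact: grid|exact: grid (ltnW jK)|].
  rewrite -mulrBl -natr1 addrAC subrr add0r mul1r gtr0_norm ?invr_gt0//.
  by rewrite -[leLHS]mul1r ler_wpM2r ?ler1n// invr_ge0 ltW.
have A_ge0 : 0 <= A by rewrite !addr_ge0 ?mulr_ge0 ?powR_ge0.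
have fj0 : fj 0 = 0 by rewrite /fj mul0r.
have Xm_ge j : (j <= K)%N -> (fj j - e1) * T <= (Xm j)%:R.
  case: j => [|j] jK /=.
    by rewrite fj0 sub0r mulNr oppr_le0 mulr_ge0// ltW.
  have [H _] := X_bounds (ltnW jK); rewrite (le_trans _ H)// ler_wpM2r ?(ltW T_gt0)//.
  have := near_grid j jK; rewrite ler_norml => /andP[_].
  rewrite lerBlDl lerBlDr => /le_trans; apply.
  by rewrite -addrA [eta + _]addrC addrA lerDl ltW.
have Xm_le j : (j <= K)%N -> (Xm j + D.+1)%:R <= (fj j + e1 + 2 * eta) * T.
  case: j => [|j] jK /=.
    rewrite fj0 add0r add0n -natr1 (@le_trans _ _ (D%:R + 2))//.
      by rewrite lerD2l ler1n.
    rewrite (le_trans D_T)// ler_wpM2r ?(ltW T_gt0)//.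
    by rewrite -[leLHS]add0r lerD// ler_peMl ?(ltW eta_gt0)// ler1n.
  have [_ H] := X_bounds (ltnW jK); rewrite (le_trans H)// ler_wpM2r ?(ltW T_gt0)//.
  rewrite lerD2r; have := near_grid j jK; rewrite ler_norml => /andP[+ _].
  by rewrite lerBrDl lerBlDr.
have lo_ge j : (j <= K)%N -> (fj j - e1) * T <= (lo j)%:R.
  move=> jK; rewrite /lo; case: leqP => _; first exact: Xm_ge.
  have [H _] := X_bounds jK; rewrite (le_trans _ H)// ler_wpM2r ?(ltW T_gt0)//.
  by rewrite lerD2l (@le_trans _ _ 0) ?oppr_le0// ltW.
have hi_ge j : (j <= K)%N -> (hi j)%:R <= (fj j + e1 + 2 * eta) * T.
  move=> jK; rewrite /hi addn_maxl; case: leqP => _; last exact: Xm_le.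
  have [_ H] := X_bounds jK; rewrite (le_trans H)// ler_wpM2r ?(ltW T_gt0)//.
  by rewrite lerD2r lerDl.
(* The scaled state is between [fj j - e1] and [fj j + e1 + 2 * eta], and up to the delayed end of
   the step [f] itself moves by at most another [e1]. *)
pose ok (r : R) (y : nat) := `|f (r / T) - y%:R / T| <= 2 * e1 + 2 * eta.
have okP j r y : (j < K)%N -> j%:R * tau <= r -> r <= j.+1%:R * (tau + sigma) -> r <= T ->
    (lo j <= y <= hi j)%N -> ok r y.
  move=> jK s1 s2 sT /andP[ly yh].
  have fy1 : fj j - e1 <= y%:R / T.
    by rewrite ler_pdivlMr// (le_trans (lo_ge j (ltnW jK)))// ler_nat.
  have fy2 : y%:R / T <= fj j + e1 + 2 * eta.
    by rewrite ler_pdivrMr// (le_trans _ (hi_ge j (ltnW jK)))// ler_nat.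
  have [tau1 tau2] := tau_bounds.
  have tau0 : 0 <= tau by rewrite mulr_ge0// ltW.
  have sge0 : 0 <= r by rewrite (le_trans _ s1)// mulr_ge0.
  have sj : j%:R / K%:R <= r / T.
    rewrite ler_pdivlMr// mulrAC ler_pdivrMr//.
    apply: (@le_trans _ _ (j%:R * (K%:R * tau))); first by rewrite ler_wpM2l// ltW.
    by rewrite mulrCA mulrC ler_wpM2r// ltW.
  have js : r / T <= j%:R / K%:R + 2 / K%:R.
    apply: (schedule_le T_ge1 K_gt0' _ _ s2 tau2 dl_le A_ge0 kappa_gt0 kappa_K) => //.
      by rewrite natr1.
    by rewrite natr1 ler_nat.
  have t01 : 0 <= r / T <= 1 by rewrite divr_ge0 ?(ltW T_gt0)//= ler_pdivrMr// mul1r.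
  have : `|f (r / T) - fj j| <= e1.
    apply: f_osc => //; first exact: grid (ltnW jK).
    by rewrite ger0_norm ?subr_ge0// lerBlDl.
  by apply: close_trans => //; exact: ltW.
have wt_ge0 j : 0 <= wt j.
  apply: mulr_ge0; last exact: expR_ge0.
  apply: mulr_ge0; first exact: exprn_ge0 (ltW w0_gt0).
  apply: mulr_ge0; last by apply: bump_weight_ge0 => //; exact: ltnW.
  by apply: mulr_ge0; [exact: ltW|exact: expR_ge0].
have lohi j y : (j < K)%N -> (X j <= y <= X j + D.+1)%N -> (lo j.+1 <= y <= hi j.+1)%N.
  move=> _ /andP[Xy yX]; rewrite /lo /hi /= geq_min Xy/=.
  by rewrite (leq_trans yX)// leq_add2r leq_maxl.
have [T_lt _] := tau_bounds.
have lo0 : (lo 0 <= 0 <= hi 0)%N by rewrite andbT; exact: geq_minl.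
have [A' [mA' PA' A'cov]] := probability_covered mY mS Y0 wt_ge0 T_lt okP lohi level_traverses lo0.
apply: (le_trans PA'); apply: le_measure; rewrite ?inE//.
  exact: (measurable_traj_in mY mS S_gt0 xi_some xi_none).
by move=> w /A'cov; exact: (traj_in_of_covered S_gt0 xi_some T_gt0 eps_gt).
Qed.

Lemma fixed_scale_expR (F1 delta1 delta2 delta' : R) : 0 <= F1 -> 0 <= delta2 -> 0 <= delta' ->
  (forall j, (j < K)%N -> (fj j + 2 * eta) `^ L <= fj j `^ L + delta1) ->
  (forall a b, 0 <= a -> a <= M `^ L -> b <= a + delta1 ->
    (C + 2 * s0 + theta) * b - 2 * s0 * (1 - theta) ^+ 4 * a <= C * a + delta') ->
  \sum_(j < K) fj j `^ L <= K%:R * (F1 + delta2) ->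
  ((expR (K%:R * ((M + 3) * T * (ln (Num.min l0 1 * kappa * expR (- 1)) - ln (T `^ L))
     + ln (theta * expR (- 2) * bump_weight D rho 1))
     - (T + K%:R) * T `^ L * (C * (F1 + delta2) + delta')))%:E <=
   P (traj_in (scaled xi T) (U_eps eps f)))%E.
Proof.
move=> F10 d20 d0 pw const riem; apply: le_trans fixed_scale_lower; rewrite lee_fin.
set cD := theta * _ * _.
have B1 : 0 < bump_weight D rho 1 by apply: bump_weight_gt0.
have cD0 : 0 < cD by rewrite /cD; apply: mulr_gt0 => //; apply: mulr_gt0 => //; exact: expR_gt0.
have w'0 : 0 < Num.min l0 1 * kappa * expR (- 1).
  by apply: mulr_gt0; [apply: mulr_gt0 => //; rewrite lt_min l0_gt0 ltr01|exact: expR_gt0].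
have lnw0 : ln w0 = ln (Num.min l0 1 * kappa * expR (- 1)) - ln p.
  rewrite -ln_div ?posrE//; congr ln; rewrite /w0 /dl; ring.
have lnw0_le : ln w0 <= 0 by apply: ln_le0.
have tau0 : 0 <= tau by rewrite mulr_ge0// ltW.
(* Lower bound for the logarithm of [wt j]: the move between levels, a constant, and the net rate.
   Since [dl] is [kappa / p], the first term is where ln (T^L) enters. *)
pose q j := (M + 3) * T * ln w0 + ln cD - tau * p * (C * fj j `^ L + delta').
have wt_ge (j : 'I_K) : expR (q j) <= wt j.
  have jK := ltnW (ltn_ord j); have /andP[f0 fM] := fj_bound jK.
  rewrite /q !expRD lnK ?posrE// /wt -/cD.
  apply: ler_pM; [by apply: mulr_ge0; [exact: expR_ge0|exact: ltW]|exact: expR_ge0| |].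
    apply: ler_wpM2r; first exact: ltW.
    rewrite -[X in _ <= X ^+ _](lnK w0_gt0) -expRM_natl ler_expR.
    apply: ler_wnM2r => //.
    have eM : e%:R <= (M + 2) * T.
      by rewrite -truncn_ge_nat// mulr_ge0 ?addr_ge0// ltW.
    rewrite -natr1 (_ : (M + 3) * T = (M + 2) * T + T); last by ring.
    exact: lerD.
  rewrite ler_expR.
  have -> : hp j = (S2 + theta) * ((fj j + 2 * eta) `^ L * p).
    by rewrite /hp powRM ?(ltW T_gt0)// addr_ge0// mulr_ge0// ltW.
  have -> : s j = (1 - theta) * s0 * (fj j `^ L * p).
    by rewrite /s powRM ?(ltW T_gt0).
  have := const (fj j `^ L) ((fj j + 2 * eta) `^ L) (powR_ge0 _ _) _ (pw j (ltn_ord j)).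
  move=> /(_ (ler_powR_base (ltW L_gt0) f0 fM)) Hc.
  have tp0 : 0 <= tau * p by rewrite mulr_ge0 ?(ltW p_gt0).
  have := ler_wpM2l tp0 Hc; rewrite -lerN2.
  move=> /le_trans; apply; rewrite le_eqVlt; apply/orP; left; apply/eqP; ring.
apply: (@le_trans _ _ (\prod_(j < K) expR (q j))); last first.
  by apply: ler_prod => j _; rewrite expR_ge0 wt_ge.
rewrite -expR_sum ler_expR /q.
rewrite sumrB sumr_const card_ord -mulr_sumr big_split/= sumr_const card_ord.
rewrite -mulr_sumr lnw0 -[X in _ <= X - _]mulr_natl -[delta' *+ K]mulr_natl.
have [tau1 tau2] := tau_bounds.
have Ktau : K%:R * tau <= T + K%:R.
  have KT : K%:R * (T / K%:R) = T by rewrite mulrC divfK// gt_eqF.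
  have := ler_wpM2l (ltW K_gt0') tau2; rewrite mulrDr KT.
  move=> /le_trans; apply; rewrite lerD2l -[leRHS]mulr1 ler_wpM2l ?(ltW K_gt0')//.
  exact: le_trans dl_le kappa_le1.
rewrite lerD2l lerN2.
apply: (@le_trans _ _ (tau * p * (K%:R * (C * (F1 + delta2) + delta')))).
  apply: ler_wpM2l; first by apply: mulr_ge0 => //; exact: ltW.
  by rewrite [leRHS]mulrDr lerD2r [leRHS]mulrCA; exact: ler_wpM2l.
rewrite (_ : tau * p * _ = K%:R * tau * p * (C * (F1 + delta2) + delta')); last by ring.
apply: ler_wpM2r; first by apply: addr_ge0 => //; apply: mulr_ge0 => //; exact: addr_ge0.
by apply: ler_wpM2r => //; exact: ltW.
Qed.

End fixed_scale.

Hypothesis asym_h : forall e, 0 < e -> exists x0 : nat, forall x, (x0 <= x)%N ->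
  h x <= (C + 2 * s0 + e) * x%:R `^ L.
Hypothesis asym_lambda : forall e, 0 < e -> exists x0 : nat, forall x, (x0 <= x)%N ->
  (1 - e) * s0 / rho * x%:R `^ L <= lambda x.
Hypothesis asym_mu : forall e, 0 < e -> exists x0 : nat, forall x, (x0 <= x)%N ->
  (1 - e) * s0 * rho * x%:R `^ L <= mu x.

Theorem traj_in_lower (F : R -> R) (eps delta : R) : 0 < eps -> 0 < delta -> F 0 = 0 ->
  (forall u v c, 0 <= u -> u <= v -> v <= 1 ->
    (forall t, u <= t < v -> c <= f t `^ L) -> c * (v - u) <= F v - F u) ->
  0 <= F 1 ->
  \forall T \near +oo,
    ((expR (- (T `^ (L + 1) * (C * F 1 + delta))))%:E <=
     P (traj_in (scaled xi T) (U_eps eps f)))%E.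
Proof.
move=> eps0 delta0 F0 F_ge F1.
have [M M0 fM] := F_pos_bounded f_pos.
have [fc _ _] := f_pos.
have d80 : 0 < delta / 8 by rewrite divr_gt0.
have [theta [delta1 [th0 th1 d10 const]]] := rate_constants C_ge0 s0_ge0 (powR_ge0 M L) d80.
pose delta2 := delta / (8 * (C + 1)).
have C1 : 0 < C + 1 by rewrite ltr_wpDl.
have d20 : 0 < delta2 by rewrite divr_gt0// mulr_gt0.
have M20 : 0 < M + 2 by rewrite addr_gt0.
have [del1 del10 Hdel1] := powR_uniform_continuity L_gt0 M20 d10.
have [del2 del20 Hdel2] := powR_uniform_continuity L_gt0 M20 d20.
(* [eps / 8] leaves [2 * e1 + 2 * eta <= eps / 2]; [del1 / 4] ensures that raising the level by
   [2 * eta] changes its L-th power by less than [delta1]. *)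
pose eta := Num.min 2^-1 (Num.min (eps / 8) (del1 / 4)).
have eta0 : 0 < eta by rewrite !lt_min invr_gt0 ltr0n !divr_gt0.
have eta1 : eta <= 2^-1 by rewrite ge_min lexx.
have eta2 : eta <= eps / 8 by rewrite !ge_min lexx !orbT.
have eta3 : eta <= del1 / 4 by rewrite !ge_min lexx !orbT.
pose e1 := eps / 8.
have e10 : 0 < e1 by rewrite divr_gt0.
have m0 : 0 < Num.min e1 del2 by rewrite lt_min e10 del20.
have [del3 del30 Hdel3] := uniform_continuity fc m0.
(* Over two grid steps [f] moves by less than [e1], as the tube requires, and by less than [del2],
   so that the left Riemann sum of f^L is correct up to [delta2]. *)
pose K := (Num.truncn (2 / del3)).+1.
have K_gt0 : (0 < K)%N by [].
have K_gt0' : 0 < K%:R :> R by rewrite ltr0n.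
have K2 : 2 / K%:R < del3.
  rewrite ltr_pdivrMr// -ltr_pdivrMl// mulrC; exact: truncnS_gt.
(* Here D - 1 is the integer part of 1 / theta plus 1, so it exceeds 1 / theta. *)
pose D := (Num.truncn theta^-1).+2.
have D_gt1 : (1 < D)%N by [].
have D_theta : D.-1%:R^-1 <= theta.
  by rewrite invf_ple ?posrE ?ltr0n// ltW// truncnS_gt.
have [x1 Hx1] := asym_h th0; have [x2 Hx2] := asym_lambda th0; have [x3 Hx3] := asym_mu th0.
pose x0 := maxn x1 (maxn x2 x3).
have h_ge x : (x0 <= x)%N -> h x <= (C + 2 * s0 + theta) * x%:R `^ L.
  by rewrite !geq_max => /and3P[? _ _]; exact: Hx1.
have lambda_ge x : (x0 <= x)%N -> (1 - theta) * s0 / rho * x%:R `^ L <= lambda x.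
  by rewrite !geq_max => /and3P[_ ? _]; exact: Hx2.
have mu_ge x : (x0 <= x)%N -> (1 - theta) * s0 * rho * x%:R `^ L <= mu x.
  by rewrite !geq_max => /and3P[_ _ ?]; exact: Hx3.
pose B1 := (H0 + (C + 2 * s0) + 1) * ((M + 2) `^ L + 1).
have B10 : 0 < B1.
  apply: mulr_gt0; last by rewrite ltr_wpDl// powR_ge0.
  by apply: ltr_wpDl => //; apply: addr_ge0 => //; apply: addr_ge0 => //; exact: mulr_ge0.
pose B2 := (1 + (4 * s0 * (M + 2) `^ L + M + 4)) * (K%:R * K%:R).
have B20 : 0 < B2.
  apply: mulr_gt0; last exact: mulr_gt0.
  apply: ltr_pwDl => //; apply: addr_ge0 => //; apply: addr_ge0; last exact: ltW.
  by apply: mulr_ge0; [exact: mulr_ge0|exact: powR_ge0].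
(* The bound by [theta / B1] makes the exit rate times the cell length at most [theta]; the one by
   the inverse of [B2] limits the accumulated delay as [schedule_le] requires. *)
pose kappa := Num.min 1 (Num.min (theta / B1) B2^-1).
have kappa0 : 0 < kappa by rewrite !lt_min ltr01 divr_gt0// invr_gt0.
have kappa1 : kappa <= 1 by rewrite ge_min lexx.
have kappa_theta : kappa * B1 <= theta.
  by rewrite -ler_pdivlMr// !ge_min lexx !orbT.
have kappa_K : kappa * (1 + (4 * s0 * (M + 2) `^ L + M + 4)) * (K%:R * K%:R) <= 1.
  rewrite -mulrA -/B2 -ler_pdivlMr// mul1r !ge_min lexx !orbT//.
have eps_gt : 2 * e1 + 2 * eta < eps by rewrite /e1; lra.
have f_osc x y : 0 <= x <= 1 -> 0 <= y <= 1 -> `|x - y| <= 2 / K%:R -> `|f x - f y| <= e1.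
  move=> x01 y01 xy; have := Hdel3 x y x01 y01 (le_lt_trans xy K2).
  by rewrite lt_min => /andP[/ltW].
have grid j : (j <= K)%N -> 0 <= (j%:R / K%:R : R) <= 1.
  by move=> jK; rewrite divr_ge0//= ler_pdivrMr// mul1r ler_nat.
have pw j : (j < K)%N -> (f (j%:R / K%:R) + 2 * eta) `^ L <= f (j%:R / K%:R) `^ L + delta1.
  move=> jK; have /andP[f0 fjM] := fM _ (grid j (ltnW jK)).
  have := Hdel1 (f (j%:R / K%:R) + 2 * eta) (f (j%:R / K%:R)).
  have -> : 0 <= f (j%:R / K%:R) + 2 * eta <= M + 2.
    rewrite addr_ge0 ?mulr_ge0 ?(ltW eta0)//= lerD//; lra.
  rewrite f0 (le_trans fjM) ?lerDl//= addrAC subrr add0r gtr0_norm ?mulr_gt0//.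
  move=> /(_ isT isT); have -> : 2 * eta < del1 by lra.
  by move=> /(_ isT); rewrite ltr_norml => /andP[_ /ltW]; rewrite lerBlDl.
have riem : \sum_(j < K) f (j%:R / K%:R) `^ L <= K%:R * (F 1 + delta2).
  apply: (riemann_sum_le (a := fun t => f t `^ L)) => // j t jK /andP[jt tj].
  have /andP[g0 g1] := grid j (ltnW jK).
  have t01 : 0 <= t <= 1.
    by rewrite (le_trans g0)//=; have /andP[_ g1'] := grid j.+1 jK; rewrite (le_trans (ltW tj)).
  have tjK : `|j%:R / K%:R - t| < del3.
    rewrite distrC ger0_norm ?subr_ge0//.
    rewrite (lt_trans _ K2)// ltrBlDl (lt_le_trans tj)// -mulrDl ler_wpM2r ?invr_ge0//.
    by rewrite -natr1 lerD2l ler1n.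
  have := Hdel3 _ _ (grid j (ltnW jK)) t01 tjK.
  rewrite lt_min => /andP[_ fd].
  have /andP[f1 f2] := fM _ (grid j (ltnW jK)); have /andP[f3 f4] := fM _ t01.
  have := Hdel2 (f (j%:R / K%:R)) (f t); rewrite f1 f3 (le_trans f2) ?(le_trans f4) ?lerDl//.
  move=> /(_ isT isT fd); rewrite ltr_norml => /andP[_ /ltW].
  by rewrite lerBlDl -lerBlDr.
(* The rate actually obtained. It exceeds [C * F 1] by at most [delta / 4]; the logarithms of T take
   another quarter of [delta], the terms of lower order a half. *)
pose G := C * (F 1 + delta2) + delta / 8.
have G_le : G <= C * F 1 + delta / 4.
  have : C * delta2 <= delta / 8.
    apply: (@le_trans _ _ ((C + 1) * delta2)); first by rewrite ler_wpM2r ?(ltW d20)// lerDl.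
    by rewrite /delta2 le_eqVlt; apply/orP; left; apply/eqP; field; rewrite gt_eqF.
  by rewrite /G mulrDr; lra.
set lw := ln (Num.min l0 1 * kappa * expR (- 1)).
set lc := ln (theta * expR (- 2) * bump_weight D rho 1).
have M30 : 0 < M + 3 by rewrite addr_gt0.
have e20 : 0 < delta / (4 * (K%:R * (M + 3))) by rewrite divr_gt0// !mulr_gt0.
have delta20 : 0 < delta / 2 by rewrite divr_gt0.
near=> T.
have T0 : 0 < T by near: T; exact: (nbhs_pinfty_gt (num_real _)).
have T1 : 1 <= T by near: T; exact: (nbhs_pinfty_ge (num_real _)).
have D_T : D%:R + 2 <= eta * T.
  by rewrite mulrC -ler_pdivrMr//; near: T; exact: (nbhs_pinfty_ge (num_real _)).
have x0_T : x0%:R <= eta * T.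
  by rewrite mulrC -ler_pdivrMr//; near: T; exact: (nbhs_pinfty_ge (num_real _)).
have main := @fixed_scale_expR theta eta e1 M kappa T eps K D x0 th0 th1 h_ge lambda_ge mu_ge
  fM (ltW M0) f_osc K_gt0 D_gt1 D_theta T1 eta0 eta1 D_T x0_T kappa0 kappa1 kappa_theta kappa_K
  eps_gt (F 1) delta1 delta2 (delta / 8) F1 (ltW d20) (ltW d80) pw const riem.
apply: le_trans main; rewrite lee_fin ler_expR -/G -/lw -/lc.
have TL1 : T `^ (L + 1) = T * T `^ L.
  rewrite powRD; last by rewrite (gt_eqF T0) implybT.
  by rewrite powRr1 ?(ltW T0)// mulrC.
rewrite TL1.
have Hln : ln (T `^ L) <= delta / (4 * (K%:R * (M + 3))) * T `^ L.
  by near: T; exact: near_ln_le.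
have Hlin : - (K%:R * lc) + (- (K%:R * (M + 3) * lw)) * T + (K%:R * G) * T `^ L <= delta / 2 * (T * T `^ L).
  by near: T; exact: near_linear_le.
have Tp0 : 0 <= T * T `^ L by rewrite mulr_ge0 ?powR_ge0// ltW.
have KM : 0 <= K%:R * (M + 3) * T by rewrite !mulr_ge0// ltW.
have Hln' : K%:R * (M + 3) * T * ln (T `^ L) <= delta / 4 * (T * T `^ L).
  apply: (le_trans (ler_wpM2l KM Hln)).
  rewrite le_eqVlt; apply/orP; left; apply/eqP; field.
  by rewrite !gt_eqF.
have HG := ler_wpM2l Tp0 G_le.
exact: exponent_bound Hlin Hln' HG.
Unshelve. all: by end_near.
Qed.

End lower.

(** * Rates with power asymptotics *)

(** The error is additive rather than a ratio, so that [p = 0] is allowed and expresses that [u] is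
    negligible against x^L. *)
Definition power_asymptotics (R : realType) (u : nat -> R) (L p : R) : Prop :=
  forall e, 0 < e -> exists x0 : nat, forall x, (x0 <= x)%N ->
    `|u x - p * x%:R `^ L| <= e * x%:R `^ L.

Lemma powR_nat_gt0 (R : realType) (x : nat) (L : R) : (0 < x)%N -> 0 < x%:R `^ L.
Proof. by move=> x0; rewrite powR_gt0// ltr0n. Qed.

Lemma ratio_cvg1 (R : realType) (u : nat -> R) (a c : R) : 0 < c ->
  u x / (c * x%:R `^ a) @[x --> \oo] --> (1 : R) -> power_asymptotics u a c.
Proof.
move=> c0 /cvgrPdist_le lim e e0.
have ec : 0 < e / c by rewrite divr_gt0.
have [N _ HN] := lim _ ec; exists N.+1 => x Nx.
have x0 : 0 < x%:R `^ a :> R by apply: powR_nat_gt0; exact: leq_trans Nx.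
have cx0 : 0 < c * x%:R `^ a by rewrite mulr_gt0.
have := HN x (ltnW Nx); rewrite distrC => H.
have -> : u x - c * x%:R `^ a = (u x / (c * x%:R `^ a) - 1) * (c * x%:R `^ a).
  by rewrite mulrBl mul1r divfK// gt_eqF.
rewrite normrM (gtr0_norm cx0) (le_trans (ler_wpM2r (ltW cx0) H))//.
by rewrite mulrA divfK// gt_eqF.
Qed.

Lemma power_asymptotics_lt (R : realType) (u : nat -> R) (a L c : R) : a < L ->
  power_asymptotics u a c -> power_asymptotics u L 0.
Proof.
move=> aL uac e e0; have [x0 Hx0] := uac 1 ltr01.
have La : 0 < L - a by rewrite subr_gt0.
have [M [_ HM]] := @near_powR_ge R (L - a) ((`|c| + 1) / e) La.
exists (maxn x0 (Num.truncn `|M|).+1) => x; rewrite geq_max => /andP[x0x Mx].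
have x_gt0 : (0 < x)%N by exact: leq_trans Mx.
have Mx' : M < x%:R.
  by rewrite (le_lt_trans (ler_norm _))// (lt_le_trans (truncnS_gt _))// ler_nat.
have := HM _ Mx'; rewrite ler_pdivrMr// => H.
have xL : x%:R `^ L = x%:R `^ (L - a) * x%:R `^ a :> R.
  have xn0 : x%:R != 0 :> R by rewrite pnatr_eq0 -lt0n.
  by rewrite -powRD ?xn0 ?implybT// subrK.
have xa := @powR_nat_gt0 R x a x_gt0.
rewrite mul0r subr0 xL mulrA.
apply: (@le_trans _ _ ((`|c| + 1) * x%:R `^ a)); last by rewrite ler_wpM2r ?(ltW xa)// mulrC.
rewrite mulrDl mul1r -[u x](subrK (c * x%:R `^ a)) addrC (le_trans (ler_normD _ _))//.
rewrite lerD//; first by rewrite normrM (gtr0_norm xa).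
by have := Hx0 x x0x; rewrite mul1r.
Qed.

(** The moves between levels pass through small states, about which the asymptotics say nothing: a
    minimum over finitely many states is combined with [c / 2] beyond them. *)
Lemma power_asymptotics_ge (R : realType) (u : nat -> R) (a c : R) : 0 < c -> 0 <= a ->
  (forall x, (0 < x)%N -> 0 < u x) -> power_asymptotics u a c ->
  exists2 l0, 0 < l0 & forall x, (0 < x)%N -> l0 <= u x.
Proof.
move=> c0 a0 u0 uac; have c2 : 0 < c / 2 by rewrite divr_gt0.
have [x0 Hx0] := uac _ c2.
have small N : exists2 l0, 0 < l0 & forall x, (0 < x < N)%N -> l0 <= u x.
  elim: N => [|N [l0 l00 Hl0]]; first by exists 1 => // x; rewrite andbF.
  exists (Num.min l0 (if (0 < N)%N then u N else 1)).
    by rewrite lt_min l00/=; case: ifP => // N0; exact: u0.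
  move=> x /andP[x_gt0]; rewrite ltnS leq_eqVlt => /predU1P[xN|xN].
    by rewrite ge_min -xN x_gt0 lexx orbT.
  by rewrite ge_min Hl0// x_gt0.
have [l0 l00 Hl0] := small x0.
exists (Num.min l0 (c / 2)); first by rewrite lt_min l00.
move=> x x_gt0; have [xx0|x0x] := ltnP x x0; first by rewrite ge_min Hl0// x_gt0.
have x1 : 1 <= x%:R `^ a :> R.
  by have := @ler_powR_base R a 1 x%:R a0 ler01; rewrite powR1 ler1n; apply.
have := Hx0 x x0x; rewrite ler_norml => /andP[+ _].
rewrite ge_min => H; apply/orP; right.
have : c / 2 * 1 <= c / 2 * x%:R `^ a by rewrite ler_wpM2l// ltW.
move: (x%:R `^ a) H => p H; lra.
Qed.

Lemma finite_upper_bound (R : realType) (g : nat -> R) (N : nat) :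
  exists2 K, 0 <= K & forall x, (x < N)%N -> g x <= K.
Proof.
exists (\sum_(i < N) `|g i|); first by rewrite sumr_ge0.
move=> x xN; rewrite (bigD1 (Ordinal xN))//= (le_trans (ler_norm _))// lerDl.
by rewrite sumr_ge0.
Qed.

Section rates.
Context (R : realType) (lambda mu : nat -> R) (L p q : R).
Hypothesis lambda_asym : power_asymptotics lambda L p.
Hypothesis mu_asym : power_asymptotics mu L q.
Local Notation h := (exit_rate lambda mu).

Lemma asymptotic_pair e : 0 < e -> exists x0 : nat, forall x, (x0 <= x)%N ->
  `|lambda x - p * x%:R `^ L| <= e * x%:R `^ L /\ `|mu x - q * x%:R `^ L| <= e * x%:R `^ L.
Proof.
move=> e0; have [x1 H1] := lambda_asym e0; have [x2 H2] := mu_asym e0.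
by exists (maxn x1 x2) => x; rewrite geq_max => /andP[/H1 ? /H2 ?].
Qed.

Lemma exit_rate_growth : exists2 H0, 0 <= H0 & forall y, h y <= H0 * (y%:R `^ L + 1).
Proof.
have [x0 Hx0] := asymptotic_pair (@ltr01 R).
have [K K0 HK] := finite_upper_bound h x0.
exists (`|p| + `|q| + 2 + K); first by rewrite !addr_ge0.
move=> y; have y0 := powR_ge0 (y%:R : R) L.
have [yx|xy] := ltnP y x0.
  rewrite (le_trans (HK y yx))// mulrDr mulr1 (@le_trans _ _ (`|p| + `|q| + 2 + K))//.
    by rewrite lerDr !addr_ge0.
  by rewrite lerDr mulr_ge0// !addr_ge0.
have [] := Hx0 y xy; rewrite !ler_norml /exit_rate => /andP[_ H1] /andP[_ H2].
have H3 := ler_wpM2r y0 (ler_norm p); have H4 := ler_wpM2r y0 (ler_norm q).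
have H5 : 0 <= K * (y%:R `^ L) by rewrite mulr_ge0.
have H6 : 0 <= `|p| + `|q| + 2 + K by rewrite !addr_ge0.
by lra.
Qed.

Lemma exit_rate_asymptotics c e : 0 < e -> p + q <= c ->
  exists x0 : nat, forall x, (x0 <= x)%N -> h x <= (c + e) * x%:R `^ L.
Proof.
move=> e0 pq; have e20 : 0 < e / 2 by rewrite divr_gt0.
have [x0 Hx0] := asymptotic_pair e20; exists x0 => x /Hx0[].
rewrite !ler_norml /exit_rate => /andP[_ H1] /andP[_ H2].
have := ler_wpM2r (powR_ge0 (x%:R : R) L) pq.
by lra.
Qed.

(** For large y the gap absorbs the errors of the rates, which enter with the coefficients 1 - rho
    and 1 - 1 / rho; hence the normalisation by [N]. [K0] covers the remaining states and the added
    1. *)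
Lemma tilted_rates b rho : 0 < rho -> b < p + q - p * rho - q / rho ->
  exists K0, forall y,
  lambda y * rho + mu y / rho + 1 <= h y - (b * y%:R `^ L - K0).
Proof.
move=> rho0 brho; set gap := p + q - p * rho - q / rho - b.
have gap0 : 0 < gap by rewrite subr_gt0.
pose N := `|1 - rho| + `|1 - rho^-1| + 1.
have N0 : 0 < N by rewrite ltr_wpDl// addr_ge0.
have e0 : 0 < gap / N by rewrite divr_gt0.
have [x0 Hx0] := asymptotic_pair e0.
have [K K0 HK] := finite_upper_bound
  (fun y => lambda y * rho + mu y / rho + 1 - h y + b * y%:R `^ L) x0.
exists (K + 1) => y; have [yx|xy] := ltnP y x0; first by have := HK y yx; lra.
have [H1 H2] := Hx0 y xy.
set P := y%:R `^ L in H1 H2 *.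
have P0 : 0 <= P by exact: powR_ge0.
have G1 : - (gap / N * P * `|1 - rho|) <= (lambda y - p * P) * (1 - rho).
  rewrite lerNl -mulNr; apply: (le_trans (ler_norm _)); rewrite normrM normrN.
  by rewrite ler_wpM2r.
have G2 : - (gap / N * P * `|1 - rho^-1|) <= (mu y - q * P) * (1 - rho^-1).
  rewrite lerNl -mulNr; apply: (le_trans (ler_norm _)); rewrite normrM normrN.
  by rewrite ler_wpM2r.
have G3 : gap / N * P * `|1 - rho| + gap / N * P * `|1 - rho^-1| <= gap * P.
  rewrite -mulrDr (_ : gap * P = gap / N * P * N); last by field; rewrite gt_eqF.
  by apply: ler_wpM2l; [rewrite mulr_ge0 ?(ltW e0)|rewrite lerDl].
have G4 : gap * P = (p + q - p * rho - q / rho - b) * P by [].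
rewrite G4 in G3; rewrite /exit_rate.
move: (gap / N * P * `|1 - rho|) (gap / N * P * `|1 - rho^-1|) G1 G2 G3 => a1 a2.
move: (rho^-1) => r; lra.
Qed.

Lemma lambda_lower_asymptotics c e : 0 <= c -> c <= p -> (forall x, 0 <= lambda x) -> 0 < e ->
  exists x0 : nat, forall x, (x0 <= x)%N -> (1 - e) * c * x%:R `^ L <= lambda x.
Proof.
move=> c0 cp l0 e0; have [ceq0|cneq0] := eqVneq c 0.
  by exists 0%N => x _; rewrite ceq0 mulr0 mul0r.
have ec : 0 < e * c by rewrite mulr_gt0// lt_neqAle eq_sym cneq0.
have [x0 Hx0] := lambda_asym ec; exists x0 => x /Hx0.
rewrite ler_norml => /andP[H _]; have := ler_wpM2r (powR_ge0 (x%:R : R) L) cp.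
by lra.
Qed.

End rates.

(** * Matching the upper and the lower bound *)

Section assembly.
Context (R : realType) (d : measure_display) (Omega : measurableType d) (P : probability Omega R).
Context (lambda mu : nat -> R) (xi : R -> Omega -> option nat).
Hypothesis lambda_gt0 : forall x, 0 < lambda x.
Hypothesis mu_gt0 : forall x, (0 < x)%N -> 0 < mu x.
Hypothesis mu0 : mu 0%N = 0.
Hypothesis xi_bd : birth_death_process P lambda mu xi.
Variables (L p q s0 rho l0 : R).
Hypothesis L_gt0 : 0 < L.
Hypothesis lambda_asym : power_asymptotics lambda L p.
Hypothesis mu_asym : power_asymptotics mu L q.
Hypothesis s0_ge0 : 0 <= s0.
Hypothesis rho_gt0 : 0 < rho.
Hypothesis s0_p : s0 / rho <= p.
Hypothesis s0_q : s0 * rho <= q.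
Hypothesis l0_gt0 : 0 < l0.
Hypothesis lambda_min : forall x, l0 <= lambda x.
Hypothesis mu_min : forall x, (0 < x)%N -> l0 <= mu x.
Local Notation C := (p + q - 2 * s0).
Hypothesis C_gt0 : 0 < C.
Hypothesis tilt : forall b, b < C -> exists2 r, 0 < r & b < p + q - p * r - q / r.

(** The parameters cover all regimes: [s0] = sqrt (p q) with [rho] = sqrt (q / p) when both
    constants are positive, and [s0] = 0 with [rho] = 1 when one vanishes. Jumps gain [2 * s0] in
    the lower bound, and [tilt] says that no more can be gained. *)
Lemma local_ldp_birth_death :
  local_ldp P (scaled xi) (@F_pos R) (fun T => T `^ (L + 1))
    (fun f => (C%:E * power_integral L f)%E).
Proof.
have [Y [S [[mY mS] [Y0 S_gt0] law xi_some xi_none]]] := xi_bd.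
have [H0 H0_ge0 growth] := exit_rate_growth lambda_asym mu_asym.
have C_ge0 := ltW C_gt0.
have primitive f : F_pos f -> exists F : R -> R, [/\ power_integral L f = (F 1)%:E, F 0 = 0,
    forall u v c, 0 <= u -> u <= v -> v <= 1 ->
      (forall t, u <= t < v -> f t `^ L <= c) -> F v - F u <= c * (v - u),
    forall u v c, 0 <= u -> u <= v -> v <= 1 ->
      (forall t, u <= t < v -> c <= f t `^ L) -> c * (v - u) <= F v - F u & 0 <= F 1].
  move=> f_pos; have [F [FI F0 F_le F_ge]] := power_integral_primitive f_pos L_gt0.
  exists F; split=> //.
  have := F_ge 0 1 0 (lexx _) ler01 (lexx _) (fun t _ => powR_ge0 _ _).
  by rewrite mul0r F0 subr0.
move=> f f_pos; have [F [FI _ _ _ _]] := primitive f f_pos.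
rewrite FI -EFinM.
suff : local_ldp P (scaled xi) (@F_pos R) (fun T => T `^ (L + 1))
    (fun f => (C * fine (power_integral L f))%:E) by move=> /(_ f f_pos); rewrite FI.
apply: local_ldp_bounds.
- by move=> T T0; exact: powR_gt0.
- move=> {F FI}g delta g_pos delta0; have [F [FI F0 F_le F_ge F1]] := primitive g g_pos.
  rewrite FI; apply: (traj_in_upper mY mS Y0 S_gt0 law xi_some xi_none lambda_gt0 mu_gt0 mu0
    L_gt0 C_gt0 _ growth g_pos delta0 F0 F_le F1).
  move=> b /tilt[r r0 br]; exists r => //.
  exact: tilted_rates br.
- move=> {F FI}g eps delta g_pos eps0 delta0; have [F [FI F0 F_le F_ge F1]] := primitive g g_pos.
  rewrite FI; apply: (traj_in_lower mY mS Y0 S_gt0 law xi_some xi_none lambda_gt0 mu_gt0 mu0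
    L_gt0 C_ge0 s0_ge0 rho_gt0 l0_gt0 H0_ge0 growth lambda_min mu_min g_pos _ _ _ eps0 delta0 F0 F_ge F1).
  + by move=> e e0; apply: (exit_rate_asymptotics lambda_asym mu_asym e0); rewrite subrK.
  + move=> e e0; have s0r : 0 <= s0 / rho by rewrite divr_ge0// ltW.
    have [x0 Hx0] := lambda_lower_asymptotics lambda_asym s0r s0_p (fun x => ltW (lambda_gt0 x)) e0.
    by exists x0 => x /Hx0; rewrite !mulrA.
  + move=> e e0; have s0r : 0 <= s0 * rho by rewrite mulr_ge0// ltW.
    have [x0 Hx0] := lambda_lower_asymptotics mu_asym s0r s0_q (mu_ge0 mu_gt0 mu0) e0.
    by exists x0 => x /Hx0; rewrite !mulrA.
Qed.

End assembly.

Theorem theorem2p1 (R : realType) (d : measure_display)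
    (Omega : measurableType d) (P : probability Omega R)
    (lambda mu : nat -> R) (xi : R -> Omega -> option nat)
    (l m Pl Qm : R)
    (lambda_gt0 : forall x, 0 < lambda x)
    (mu_gt0 : forall x, (0 < x)%N -> 0 < mu x)
    (mu0 : mu 0%N = 0)
    (xi_bd : birth_death_process P lambda mu xi)
    (Pl_gt0 : 0 < Pl) (Qm_gt0 : 0 < Qm)
    (l_ge0 : 0 <= l) (m_ge0 : 0 <= m) (lm_gt0 : 0 < Num.max l m)
    (lambda_lim : lambda x / (Pl * x%:R `^ l) @[x --> \oo] --> (1 : R))
    (mu_lim : mu x / (Qm * x%:R `^ m) @[x --> \oo] --> (1 : R)) :
  [/\ m < l ->
        local_ldp P (scaled xi) (@F_pos R) (fun T => T `^ (l + 1))
          (fun f => (Pl%:E * power_integral l f)%E),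
      l = m -> Pl <> Qm ->
        local_ldp P (scaled xi) (@F_pos R) (fun T => T `^ (l + 1))
          (fun f => (((Num.sqrt Pl - Num.sqrt Qm) ^+ 2)%:E
                     * power_integral l f)%E)
    & l < m ->
        local_ldp P (scaled xi) (@F_pos R) (fun T => T `^ (m + 1))
          (fun f => (Qm%:E * power_integral m f)%E)].
Proof.
have lambda_asym := ratio_cvg1 Pl_gt0 lambda_lim.
have mu_asym := ratio_cvg1 Qm_gt0 mu_lim.
have [l1 l10 Hl1] := power_asymptotics_ge Pl_gt0 l_ge0 (fun x _ => lambda_gt0 x) lambda_asym.
have [l2 l20 Hl2] := power_asymptotics_ge Qm_gt0 m_ge0 mu_gt0 mu_asym.
pose l0 := Num.min (lambda 0%N) (Num.min l1 l2).
have l0_gt0 : 0 < l0 by rewrite !lt_min lambda_gt0 l10 l20.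
have lambda_min x : l0 <= lambda x.
  case: x => [|x]; first by rewrite ge_min lexx.
  by rewrite !ge_min Hl1// orbT.
have mu_min x : (0 < x)%N -> l0 <= mu x by move=> x0; rewrite !ge_min Hl2// !orbT.
(* with one of the two rates negligible, a tilt to 0 (or to infinity) suppresses the
   dominating jumps, and the total exit rate is the whole cost *)
split.
- move=> ml; have l0' : 0 < l by exact: le_lt_trans ml.
  have mu_asym0 := power_asymptotics_lt ml mu_asym.
  have := @local_ldp_birth_death R d Omega P lambda mu xi lambda_gt0 mu_gt0 mu0 xi_bd
    l Pl 0 0 1 l0 l0' lambda_asym mu_asym0 (lexx _) ltr01.
  rewrite !mulr0 !mul0r !addr0 !subr0; apply=> // [|b bP]; first exact: ltW.
  (* With b' the maximum of b and 0, this tilt leaves Pl - Pl rho = (Pl + b') / 2, which exceeds b'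
     and hence b. *)
  exists ((Pl - Num.max b 0) / (2 * Pl)).
    by rewrite divr_gt0 ?mulr_gt0// subr_gt0 gt_max bP Pl_gt0.
  have bP' : Num.max b 0 < Pl by rewrite gt_max bP Pl_gt0.
  rewrite (_ : Pl * _ = (Pl - Num.max b 0) / 2); last by field; rewrite gt_eqF.
  have : b <= Num.max b 0 by rewrite le_max lexx.
  move: (Num.max b 0) bP' => b' bP' bb'.
  rewrite mul0r; lra.
- move=> lm PQ; subst m.
  have l0' : 0 < l by move: lm_gt0; rewrite maxxx.
  (* The tilt b / a gives Pl rho = Qm / rho = a b, and with s0 = a b both s0 / rho = Pl and s0 rho =
     Qm, so the tilt is optimal in both bounds. *)
  pose a := Num.sqrt Pl; pose b := Num.sqrt Qm.
  have a0 : 0 < a by rewrite sqrtr_gt0.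
  have b0 : 0 < b by rewrite sqrtr_gt0.
  have aE : Pl = a ^+ 2 by rewrite sqr_sqrtr// ltW.
  have bE : Qm = b ^+ 2 by rewrite sqr_sqrtr// ltW.
  have CE : Pl + Qm - 2 * (a * b) = (a - b) ^+ 2 by rewrite aE bE; ring.
  have ab : a != b by apply/eqP => ab; apply: PQ; rewrite aE bE ab.
  have := @local_ldp_birth_death R d Omega P lambda mu xi lambda_gt0 mu_gt0 mu0 xi_bd
    l Pl Qm (a * b) (b / a) l0 l0' lambda_asym mu_asym.
  rewrite CE; apply=> //.
  + by rewrite mulr_ge0// ltW.
  + exact: divr_gt0.
  + by rewrite aE le_eqVlt; apply/orP; left; apply/eqP; field; rewrite !gt_eqF.
  + by rewrite bE le_eqVlt; apply/orP; left; apply/eqP; field; rewrite !gt_eqF.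
  + by rewrite lt_neqAle eq_sym sqrf_eq0 subr_eq0 ab sqr_ge0.
  + move=> c cab; exists (b / a); first exact: divr_gt0.
    rewrite (_ : Pl + Qm - Pl * (b / a) - Qm / (b / a) = (a - b) ^+ 2)//.
    by rewrite aE bE; field; rewrite !gt_eqF.
- move=> lm; have m0' : 0 < m by exact: le_lt_trans lm.
  have lambda_asym0 := power_asymptotics_lt lm lambda_asym.
  have := @local_ldp_birth_death R d Omega P lambda mu xi lambda_gt0 mu_gt0 mu0 xi_bd
    m 0 Qm 0 1 l0 m0' lambda_asym0 mu_asym (lexx _) ltr01.
  rewrite !mulr0 !mul0r !add0r !subr0; apply=> // [|b bQ]; first exact: ltW.
  have bQ' : Num.max b 0 < Qm by rewrite gt_max bQ Qm_gt0.
  (* The mirror image: Qm / rho = (Qm - b') / 2 with b' the maximum of b and 0. *)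
  exists ((2 * Qm) / (Qm - Num.max b 0)).
    by rewrite divr_gt0 ?mulr_gt0// subr_gt0.
  have : b <= Num.max b 0 by rewrite le_max lexx.
  move: (Num.max b 0) bQ' => b' bQ' bb'.
  rewrite (_ : Qm / _ = (Qm - b') / 2); last first.
    by field; rewrite !gt_eqF ?subr_gt0.
  rewrite mul0r; lra.
Qed.
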